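(* Let $k$ be even, $x,y\in\{1,\ldots,n\}^k$ and let $\varepsilon\in\{\cdot,-\}^k$ be a balanced sequence. Let $U=(U_{ij})$ be Haar-distributed on the unitary group $\mathbb{U}_n$ and let $(G_{ij})_{1\le i,j\le n}$ be independent standard complex Gaussian variables. If $n\ge4$ and $2k^{7/2}\le n^2$, then $$n^{k/2}\left|\mathbf{E}\Big(\prod_{i=1}^kU_{x_iy_i}^{\varepsilon_i}\Big)\right|\le\left(1+3k^{7/2}n^{-2}\right)\mathbf{E}\left(\prod_{i=1}^k\Big(G_{x_iy_i}^{\varepsilon_i}+k\,n^{-1/4}\Big)\right).$$ Moreover, the expectation on the left-hand side is zero unless $(x,y)$ is an even sequence.
   Context: For $z\in\mathbb{C}$, $z^\varepsilon=z$ if $\varepsilon=\cdot$ and $z^\varepsilon=\overline z$ if $\varepsilon=-$. The sequence $\varepsilon$ is balanced if it has as many $\cdot$ as $-$. A standard complex Gaussian variable $G$ is a centered complex Gaussian variable with $\mathbf{E}|G|^2=1$, $\mathbf{E}G^2=0$. The pair $(x,y)$ is an even sequence if for every $u\in\{1,\ldots,n\}$ both $\#\{i:x_i=u\}$ and $\#\{i:y_i=u\}$ are even. *)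

(* Defs.v *)
(* MathComp / MathComp-Analysis *)
From HB Require Import structures.
From mathcomp Require Import all_boot all_order all_algebra.
From mathcomp Require Import all_classical all_reals all_analysis.
From mathcomp Require Import complex.

Set Implicit Arguments.
Unset Strict Implicit.
Unset Printing Implicit Defensive.

Import Order.TTheory GRing.Theory Num.Theory.
Import numFieldNormedType.Exports.

Local Open Scope classical_set_scope.
Local Open Scope ring_scope.
Local Open Scope complex_scope.

(* R[i] itself has no canonical topology; as a [numFieldType] it has the one
   given by its modulus, and matrices over it have the product topology. *)
Definition Cplx (R : realType) : numFieldType := R[i].

Definition borel (X : topologicalType) : set (set X) := <<s @open X >>.

Definition random_element (d : measure_display) (T : measurableType d)
    (X : topologicalType) (f : T -> X) : Prop :=
  forall B : set X, borel B -> measurable (f @^-1` B).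

(* A junk value is only returned when Re X or Im X has no finite mean. *)
Definition Cexpect (d : measure_display) (T : measurableType d) (R : realType)
    (P : probability T R) (X : T -> R[i]) : R[i] :=
  fine 'E_P[fun t => complex.Re (X t)] +i* fine 'E_P[fun t => complex.Im (X t)].

(* Taking some of the [A i] to be [setT] gives the product rule for every
   subfamily. *)
Definition independent_family (d : measure_display) (T : measurableType d)
    (R : realType) (P : probability T R) (I : finType)
    (X : I -> T -> Cplx R) : Prop :=
  forall A : I -> set (Cplx R), (forall i, borel (A i)) ->
    P [set t | forall i, A i (X i t)] = (\prod_(i : I) P (X i @^-1` A i))%E.

(* [normal_prob m 0] is not the point mass at m in the library, hence the
   case distinction; s is the standard deviation. *)
Definition gaussian_law (R : realType) (mu : set R -> \bar R) : Prop :=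
  exists m s : R, forall A : set R, measurable A ->
    mu A = if s == 0 then \d_m A else normal_prob m s A.

(* (Re Z, Im Z) is a Gaussian vector: all its real linear combinations are
   (possibly degenerate) real Gaussian variables. *)
Definition complex_gaussian (d : measure_display) (T : measurableType d)
    (R : realType) (P : probability T R) (Z : T -> R[i]) : Prop :=
  random_element (Z : T -> Cplx R) /\
  forall a b : R, gaussian_law
    (fun A : set R =>
       P [set t | A (a * complex.Re (Z t) + b * complex.Im (Z t))]).

Definition std_complex_gaussian (d : measure_display) (T : measurableType d)
    (R : realType) (P : probability T R) (Z : T -> R[i]) : Prop :=
  [/\ complex_gaussian P Z,
      Cexpect P Z = 0,
      Cexpect P (fun t => `|Z t| ^+ 2) = 1
    & Cexpect P (fun t => Z t ^+ 2) = 0].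

(* The law of U is a (left) translation-invariant Borel probability measure
   carried by the compact group of unitary matrices, i.e. its Haar measure. *)
Definition haar_unitary (d : measure_display) (T : measurableType d)
    (R : realType) (P : probability T R) (n : nat)
    (U : T -> 'M[R[i]]_n) : Prop :=
  [/\ random_element (U : T -> 'M[Cplx R]_n),
      forall t, U t \is unitarymx
    & forall V : 'M[R[i]]_n, V \is unitarymx ->
        forall B : set 'M[Cplx R]_n, borel B ->
          P [set t | B (V *m U t)] = P [set t | B (U t)]].

(* [true] encodes the exponent "-" (conjugation), [false] the exponent ".". *)
Definition conj_pow (R : realType) (e : bool) (z : R[i]) : R[i] :=
  if e then z^* else z.

Definition balanced (k : nat) (eps : 'I_k -> bool) : Prop :=
  #|[pred i | ~~ eps i]| = #|[pred i | eps i]|.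

Definition even_sequence (n k : nat) (x y : 'I_k -> 'I_n) : Prop :=
  forall u : 'I_n,
    ~~ odd #|[pred i | x i == u]| /\ ~~ odd #|[pred i | y i == u]|.

(* Main.v *)
(* Left invariance of the Haar measure gives Schwinger-Dyson equations for the
   moments of U, from which every moment of degree q = k/2 is expanded as a sum
   over pairs of permutations (sigma, tau), compatible with the rows and the
   columns respectively, of Weingarten functions at sigma^-1 tau.  These satisfy
   the recursion given by the orthogonality of the columns, and comparison with
   an explicit supersolution bounds n^q |Wg(p)| by
   (1 + 7 q^2 / n^2) (4 / sqrt n)^(number of points moved by p).
   A pair (sigma, tau) is then encoded by the partial matching on which sigma and
   tau agree, which matches equal entries, and by at most q^2 choices at each
   unmatched point: since c^2 = q^2 (4 / sqrt n) for c = k n^(-1/4), this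
   leaves the sum over the partial matchings of c^(2 #unmatched), which is at
   most the Gaussian expectation: expand its product over the choices of G or c
   in each factor and apply Wick's formula to the factors G.
   The expectation vanishes when some row or column index has different numbers
   of occurrences in the conjugated and in the other factors. *)

Require Import Defs.
From HB Require Import structures.
From mathcomp Require Import all_boot all_order all_algebra all_fingroup.
From mathcomp Require Import all_classical all_reals all_analysis.
From mathcomp Require Import complex.
From mathcomp Require Import measurable_realfun.
From mathcomp Require Import ring lra zify.

Set Implicit Arguments.
Unset Strict Implicit.
Unset Printing Implicit Defensive.

Import Order.TTheory GRing.Theory Num.Theory.
Import numFieldNormedType.Exports.

Local Open Scope ring_scope.
Local Open Scope complex_scope.

(** * Complex-valued expectations *)

(** Only left invariance is given, so row labels are handled directly and column labels through the
    symmetry [moment_swap]. Derivatives in [w] are never taken under an integral: after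
    multiplication by a power of [w], the expectations are polynomials on the unit circle, and their
    coefficients are compared. The weight counts moved points because a transposition changes their
    number by at most two: if [r] is moved, only two terms of the recursion at [r] can have fewer
    moved points, and with [th = 3 / sqrt n] their gain [th ^ -2 = n / 9] is absorbed by the factor
    [n] of the recursion. The identity has its own bound [1 + 7 m ^ 2 / n ^ 2], since its error must
    stay of order [q ^ 2 / n ^ 2]; elsewhere a factor 3/2 is tolerated, and as a permutation other
    than the identity moves at least two points, enlarging [3 / sqrt n] to [4 / sqrt n] pays for it.
    The moved points of sigma^-1 tau correspond to the points where sigma and tau disagree, so the
    weight of a pair can be read off its partial matching. *)

Section ComplexParts.
Variable R : realType.
Implicit Types z w : R[i].

Lemma complex_ReD z w : complex.Re (z + w) = complex.Re z + complex.Re w.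
Proof. by case: z w => [a b] [c e]. Qed.

Lemma complex_ImD z w : complex.Im (z + w) = complex.Im z + complex.Im w.
Proof. by case: z w => [a b] [c e]. Qed.

Lemma complex_ReM z w : complex.Re (z * w) =
  complex.Re z * complex.Re w - complex.Im z * complex.Im w.
Proof. by case: z w => [a b] [c e]. Qed.

Lemma complex_ImM z w : complex.Im (z * w) =
  complex.Re z * complex.Im w + complex.Im z * complex.Re w.
Proof. by case: z w => [a b] [c e]. Qed.

Lemma Re_conjc z : complex.Re z^* = complex.Re z.
Proof. by case: z. Qed.

Lemma Im_conjc z : complex.Im z^* = - complex.Im z.
Proof. by case: z. Qed.

Lemma eq_complexP z w : complex.Re z = complex.Re w ->
  complex.Im z = complex.Im w -> z = w.
Proof. by case: z w => [a b] [c e] /= -> ->. Qed.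

Lemma normr_Re_le z (M : R) : `|z| <= M%:C -> `|complex.Re z| <= M.
Proof.
by move=> zM; rewrite -lecR (le_trans (normc_ge_Re z)).
Qed.

Lemma normr_Im_le z (M : R) : `|z| <= M%:C -> `|complex.Im z| <= M.
Proof.
move=> zM; have -> : complex.Im z = - complex.Re (z * 'i%C).
  by rewrite complex_ReM /= mulr0 mulr1 sub0r opprK.
rewrite normrN; apply: normr_Re_le; rewrite normrM.
suff -> : `|'i%C : R[i]| = 1 by rewrite mulr1.
by rewrite normc_def /= expr0n /= add0r expr1n sqrtr1.
Qed.

End ComplexParts.

Section ComplexExpectation.
Context (d : measure_display) (T : measurableType d) (R : realType).
Variable P : probability T R.
Implicit Types (f g : T -> R[i]) (u v : T -> R).

Definition cintegrable f :=
  P.-integrable setT (EFin \o (fun t => complex.Re (f t))) /\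
  P.-integrable setT (EFin \o (fun t => complex.Im (f t))).

Lemma eq_Cexpect f g : f =1 g -> Cexpect P f = Cexpect P g.
Proof. by move=> /funext ->. Qed.

Let Ere u := fine ('E_P[u])%E.

Let EreD u v : P.-integrable setT (EFin \o u) ->
  P.-integrable setT (EFin \o v) -> Ere (fun t => u t + v t) = Ere u + Ere v.
Proof.
move=> iu iv; rewrite /Ere unlock -fineD; try exact: integrable_fin_num.
by rewrite -integralD //; congr fine; apply: eq_integral => t _; rewrite EFinD.
Qed.

Let EreZ (k : R) u : P.-integrable setT (EFin \o u) ->
  Ere (fun t => k * u t) = k * Ere u.
Proof.
move=> iu; rewrite /Ere unlock.
under eq_integral do rewrite EFinM.
by rewrite integralZl // fineM //; apply: integrable_fin_num.
Qed.

Let intD u v : P.-integrable setT (EFin \o u) ->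
  P.-integrable setT (EFin \o v) ->
  P.-integrable setT (EFin \o (fun t => u t + v t)).
Proof. by move=> iu iv; exact: (integrableD _ iu iv). Qed.

Let intZ (k : R) u : P.-integrable setT (EFin \o u) ->
  P.-integrable setT (EFin \o (fun t => k * u t)).
Proof. by move=> iu; exact: (integrableZl _ k iu). Qed.

Lemma cintegrableD f g : cintegrable f -> cintegrable g ->
  cintegrable (fun t => f t + g t).
Proof.
move=> [f1 f2] [g1 g2]; split.
  by under [X in _ \o X]funext do rewrite complex_ReD; exact: intD.
by under [X in _ \o X]funext do rewrite complex_ImD; exact: intD.
Qed.

Lemma CexpectD f g : cintegrable f -> cintegrable g ->
  Cexpect P (fun t => f t + g t) = Cexpect P f + Cexpect P g.
Proof.
move=> [f1 f2] [g1 g2]; apply: eq_complexP; rewrite ?complex_ReD ?complex_ImD /=.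
  by under [X in 'E_P[X]%E]funext do rewrite complex_ReD; exact: EreD.
by under [X in 'E_P[X]%E]funext do rewrite complex_ImD; exact: EreD.
Qed.

Lemma cintegrableZ (c : R[i]) f : cintegrable f ->
  cintegrable (fun t => c * f t).
Proof.
move=> [f1 f2]; split.
  under [X in _ \o X]funext do rewrite complex_ReM -mulNr.
  by apply: intD; exact: intZ.
under [X in _ \o X]funext do rewrite complex_ImM.
by apply: intD; exact: intZ.
Qed.

Lemma CexpectZ (c : R[i]) f : cintegrable f ->
  Cexpect P (fun t => c * f t) = c * Cexpect P f.
Proof.
move=> [f1 f2]; apply: eq_complexP; rewrite ?complex_ReM ?complex_ImM /=.
  under [X in 'E_P[X]%E]funext do rewrite complex_ReM -mulNr.
  by rewrite -mulNr -[LHS]/(Ere _) EreD ?EreZ//; exact: intZ.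
under [X in 'E_P[X]%E]funext do rewrite complex_ImM.
by rewrite -[LHS]/(Ere _) EreD ?EreZ//; exact: intZ.
Qed.

Lemma cintegrable_cst (c : R[i]) : cintegrable (fun=> c).
Proof. by split; exact: finite_measure_integrable_cst. Qed.

Lemma Cexpect_cst (c : R[i]) : Cexpect P (fun=> c) = c.
Proof. by apply: eq_complexP => /=; rewrite (expectation_cst P). Qed.

Lemma cintegrable_sum (I : Type) (r : seq I) (Q : pred I) (F : I -> T -> R[i]) :
  (forall i, Q i -> cintegrable (F i)) ->
  cintegrable (fun t => \sum_(i <- r | Q i) F i t).
Proof.
move=> iF; elim: r => [|i r IH].
  by under [X in cintegrable X]funext do rewrite big_nil; exact: cintegrable_cst.
under [X in cintegrable X]funext do rewrite big_cons.
by case Qi: (Q i) => //; apply: cintegrableD => //; exact: iF.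
Qed.

Lemma Cexpect_sum (I : Type) (r : seq I) (Q : pred I) (F : I -> T -> R[i]) :
  (forall i, Q i -> cintegrable (F i)) ->
  Cexpect P (fun t => \sum_(i <- r | Q i) F i t) =
  \sum_(i <- r | Q i) Cexpect P (F i).
Proof.
move=> iF; elim: r => [|i r IH].
  by under [X in Cexpect P X]funext do rewrite big_nil;
     rewrite Cexpect_cst big_nil.
under [X in Cexpect P X]funext do rewrite big_cons.
rewrite big_cons; case Qi: (Q i) => //.
by rewrite CexpectD ?IH //; [exact: iF | exact: cintegrable_sum].
Qed.

Definition cmeasurable f :=
  measurable_fun setT (fun t => complex.Re (f t)) /\
  measurable_fun setT (fun t => complex.Im (f t)).

Lemma cmeasurable_cst (c : R[i]) : cmeasurable (fun=> c).
Proof. by split; exact: measurable_cst. Qed.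

Lemma cmeasurableD f g : cmeasurable f -> cmeasurable g ->
  cmeasurable (fun t => f t + g t).
Proof.
move=> [f1 f2] [g1 g2]; split.
  by under [X in measurable_fun _ X]funext do rewrite complex_ReD; exact: measurable_funD.
by under [X in measurable_fun _ X]funext do rewrite complex_ImD; exact: measurable_funD.
Qed.

Lemma cmeasurableM f g : cmeasurable f -> cmeasurable g ->
  cmeasurable (fun t => f t * g t).
Proof.
move=> [f1 f2] [g1 g2]; split.
  under [X in measurable_fun _ X]funext do rewrite complex_ReM.
  by apply: measurable_funB; exact: measurable_funM.
under [X in measurable_fun _ X]funext do rewrite complex_ImM.
by apply: measurable_funD; exact: measurable_funM.
Qed.

Lemma cmeasurable_conj f : cmeasurable f -> cmeasurable (fun t => (f t)^*).
Proof.
move=> [f1 f2]; split.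
  by under [X in measurable_fun _ X]funext do rewrite Re_conjc.
under [X in measurable_fun _ X]funext do rewrite Im_conjc.
exact: measurableT_comp.
Qed.

Lemma cmeasurable_prod (I : Type) (r : seq I) (Q : pred I) (F : I -> T -> R[i]) :
  (forall i, Q i -> cmeasurable (F i)) ->
  cmeasurable (fun t => \prod_(i <- r | Q i) F i t).
Proof.
move=> iF; elim: r => [|i r IH].
  by under [X in cmeasurable X]funext do rewrite big_nil; exact: cmeasurable_cst.
under [X in cmeasurable X]funext do rewrite big_cons.
by case Qi: (Q i) => //; apply: cmeasurableM => //; exact: iF.
Qed.

Lemma cmeasurableX f n : cmeasurable f -> cmeasurable (fun t => f t ^+ n).
Proof.
move=> mf; elim: n => [|n IH]; first exact: cmeasurable_cst.
by under [X in cmeasurable X]funext do rewrite exprS; exact: cmeasurableM.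
Qed.

(** Unlike integrability, this class is closed under products, so every polynomial in the entries of
    a unitary matrix and their conjugates is integrable. *)
Definition cbounded f := cmeasurable f /\ exists M : R, forall t, `|f t| <= M%:C.

Lemma cbounded_cst (c : R[i]) : cbounded (fun=> c).
Proof.
split; first exact: cmeasurable_cst.
by exists (complex.Re `|c|) => _; rewrite RRe_real // normr_real.
Qed.

Lemma cboundedD f g : cbounded f -> cbounded g -> cbounded (fun t => f t + g t).
Proof.
move=> [mf [M fM]] [mg [N gN]]; split; first exact: cmeasurableD.
exists (M + N) => t; rewrite rmorphD /= (le_trans (ler_normD _ _)) //.
exact: lerD.
Qed.

Lemma cboundedM f g : cbounded f -> cbounded g -> cbounded (fun t => f t * g t).
Proof.
move=> [mf [M fM]] [mg [N gN]]; split; first exact: cmeasurableM.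
by exists (M * N) => t; rewrite rmorphM /= normrM; exact: ler_pM.
Qed.

Lemma cbounded_conj f : cbounded f -> cbounded (fun t => (f t)^*).
Proof.
move=> [mf [M fM]]; split; first exact: cmeasurable_conj.
by exists M => t; rewrite normcJ.
Qed.

Lemma cbounded_sum (I : Type) (r : seq I) (Q : pred I) (F : I -> T -> R[i]) :
  (forall i, Q i -> cbounded (F i)) ->
  cbounded (fun t => \sum_(i <- r | Q i) F i t).
Proof.
move=> iF; elim: r => [|i r IH].
  by under [X in cbounded X]funext do rewrite big_nil; exact: cbounded_cst.
under [X in cbounded X]funext do rewrite big_cons.
by case Qi: (Q i) => //; apply: cboundedD => //; exact: iF.
Qed.

Lemma cbounded_prod (I : Type) (r : seq I) (Q : pred I) (F : I -> T -> R[i]) :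
  (forall i, Q i -> cbounded (F i)) ->
  cbounded (fun t => \prod_(i <- r | Q i) F i t).
Proof.
move=> iF; elim: r => [|i r IH].
  by under [X in cbounded X]funext do rewrite big_nil; exact: cbounded_cst.
under [X in cbounded X]funext do rewrite big_cons.
by case Qi: (Q i) => //; apply: cboundedM => //; exact: iF.
Qed.

Lemma cbounded_integrable f : cbounded f -> cintegrable f.
Proof.
move=> [[m1 m2] [M fM]].
have PT : (P setT < +oo)%E by apply: (le_lt_trans (probability_le1 P _) (ltry 1)).
split; apply: measurable_bounded_integrable => //.
- exists M; split; first exact: num_real.
  by move=> K MK t _ /=; apply: le_trans (ltW MK); exact: normr_Re_le.
- exists M; split; first exact: num_real.
  by move=> K MK t _ /=; apply: le_trans (ltW MK); exact: normr_Im_le.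
Qed.

End ComplexExpectation.

(** * Borel measurability of complex coordinates and matrix entries *)

Section Borel.
Variable R : realType.

Lemma continuous_Re : continuous (fun z : Cplx R => complex.Re (z : R[i])).
Proof.
move=> z s /= /(nbhs_ballP _) [e e0 es].
apply/nbhs_ballP; exists (e%:C) => /=; first by rewrite ltcR.
move=> w zw; apply: es; rewrite -ball_normE /=.
have zw1 : `|z - w : R[i]| < e%:C := zw.
rewrite -ltcR (le_lt_trans _ zw1) // (le_trans _ (normc_ge_Re _)) //.
by rewrite lecR; move: z w {zw zw1} => [a b] [c e'].
Qed.

Lemma continuous_Im : continuous (fun z : Cplx R => complex.Im (z : R[i])).
Proof.
move=> z s /= /(nbhs_ballP _) [e e0 es].
apply/nbhs_ballP; exists (e%:C) => /=; first by rewrite ltcR.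
move=> w zw; apply: es; rewrite -ball_normE /=.
have zw1 : `|z - w : R[i]| < e%:C := zw.
rewrite -ltcR (le_lt_trans _ zw1) // (complexE `|_|) ger0_Im // mulr0 addr0.
rewrite lecR; have := @normr_Im_le _ (z - w : R[i]) (complex.Re `|z - w : R[i]|).
have -> : (complex.Re `|z - w : R[i]|)%:C = `|z - w : R[i]|.
  by rewrite RRe_real // normr_real.
by move=> /(_ (lexx _)); move: z w {zw zw1} => [a b] [c e'].
Qed.

Lemma continuous_borel_measurable (X : ptopologicalType) (f : X -> R) :
  continuous f ->
  measurable_fun setT (f : g_sigma_algebraType (@open X) -> R).
Proof.
move=> cf; apply: (measurability _ (RGenOInfty.measurableE R)).
move=> _ [_ [x ->] <-]; rewrite setTI; apply: sub_sigma_algebra.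
by apply: open_comp => [? _|]; [exact: cf|exact: interval_open].
Qed.

Lemma random_element_measurable_comp (d : measure_display)
    (T : measurableType d) (X : ptopologicalType) (U : T -> X)
    (f : g_sigma_algebraType (@open X) -> R) :
  random_element U -> measurable_fun setT f ->
  measurable_fun setT (fun t => f (U t)).
Proof.
move=> mU mf _ B mB; rewrite setTI.
have := mf measurableT B mB; rewrite setTI => mfB.
exact: (mU _ mfB).
Qed.

Lemma random_element_cmeasurable (d : measure_display)
    (T : measurableType d) (Z : T -> R[i]) :
  random_element (Z : T -> Cplx R) -> cmeasurable Z.
Proof.
move=> mZ; split.
  apply: (@random_element_measurable_comp _ _ (Cplx R) Z (@complex.Re R)) => //.
  exact: continuous_borel_measurable continuous_Re.
apply: (@random_element_measurable_comp _ _ (Cplx R) Z (@complex.Im R)) => //.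
exact: continuous_borel_measurable continuous_Im.
Qed.

Lemma coord_cmeasurable n (i j : 'I_n) :
  cmeasurable (fun A : g_sigma_algebraType (@open 'M[Cplx R]_n) =>
    (A : 'M[R[i]]_n) i j).
Proof.
split; apply: continuous_borel_measurable.
  move=> A; apply: (@continuous_comp _ _ _ (fun A : 'M[Cplx R]_n => A i j)
    (fun z : Cplx R => complex.Re (z : R[i]))).
  - exact: coord_continuous.
  - exact: continuous_Re.
move=> A; apply: (@continuous_comp _ _ _ (fun A : 'M[Cplx R]_n => A i j)
    (fun z : Cplx R => complex.Im (z : R[i]))).
- exact: coord_continuous.
- exact: continuous_Im.
Qed.

End Borel.

(** * Expectations determined by laws, and Haar invariance *)

Section Law.
Context (d : measure_display) (T : measurableType d) (R : realType).
Variable P : probability T R.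
Local Open Scope classical_set_scope.

Lemma ge0_integral_law (X : T -> R) (nu : {measure set R -> \bar R})
    (f : R -> \bar R) :
  measurable_fun setT X ->
  (forall B, measurable B -> P (X @^-1` B) = nu B) ->
  measurable_fun setT f -> (forall r, (0 <= f r)%E) ->
  (\int[P]_t f (X t) = \int[nu]_r f r)%E.
Proof.
move=> mX lawX mf f0.
pose X' : {mfun T >-> R} := HB.pack X (isMeasurableFun.Build _ _ _ _ _ mX).
rewrite -[LHS]/(\int[P]_t (f \o X') t)%E -ge0_integral_distribution //.
by apply: eq_measure_integral => A mA _; exact: lawX.
Qed.

(** The law determines the integrals of the positive and of the negative part separately, so
    infinite values are covered as well. *)
Lemma eq_law_expectation (X Y : T -> R) :
  measurable_fun setT X -> measurable_fun setT Y ->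
  (forall B, measurable B -> P (X @^-1` B) = P (Y @^-1` B)) ->
  ('E_P[X] = 'E_P[Y])%E.
Proof.
move=> mX mY XY; rewrite unlock.
pose Y' : {mfun T >-> R} := HB.pack Y (isMeasurableFun.Build _ _ _ _ _ mY).
have tr (f : R -> \bar R) : measurable_fun setT f -> (forall r, (0 <= f r)%E) ->
    (\int[P]_t f (X t) = \int[P]_t f (Y t))%E.
  move=> mf f0; rewrite (@ge0_integral_law X (distribution P Y')) //.
  by rewrite (@ge0_integral_law Y (distribution P Y')).
rewrite (integralE _ _ (fun t => (X t)%:E)) (integralE _ _ (fun t => (Y t)%:E)).
have mE : measurable_fun setT (EFin \o @idfun R).
  by apply/measurable_EFinP; exact: measurable_id.
rewrite -![fun t => (_ t)%:E]/(EFin \o _).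
congr (_ - _)%E.
  by under eq_integral do rewrite funepos_comp;
    under [RHS]eq_integral do rewrite funepos_comp;
    apply: (tr _ (measurable_funepos mE)) => r; exact: funepos_ge0.
by under eq_integral do rewrite funeneg_comp;
  under [RHS]eq_integral do rewrite funeneg_comp;
  apply: (tr _ (measurable_funeneg mE)) => r; exact: funeneg_ge0.
Qed.

End Law.

Section HaarInvariance.
Context (d : measure_display) (T : measurableType d) (R : realType).
Variables (P : probability T R) (n : nat) (U : T -> 'M[R[i]]_n).
Hypothesis U_haar : haar_unitary P U.

Lemma haar_cmeasurable (f : g_sigma_algebraType (@open 'M[Cplx R]_n) -> R[i]) :
  cmeasurable f -> cmeasurable (fun t => f (U t)).
Proof.
have [mU _ _] := U_haar.
case=> m1 m2; split.
  exact: (@random_element_measurable_comp R _ _ 'M[Cplx R]_n U _ mU m1).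
exact: (@random_element_measurable_comp R _ _ 'M[Cplx R]_n U _ mU m2).
Qed.

(** The squared moduli of a row of a unitary matrix sum to 1. *)
Lemma haar_entry_cbounded (i j : 'I_n) : cbounded (fun t => U t i j).
Proof.
split; first exact: (haar_cmeasurable (coord_cmeasurable R i j)).
exists 1 => t; have [_ uU _] := U_haar.
have /unitarymxP/matrixP/(_ i i) := uU t.
rewrite !mxE eqxx => UU.
have h : `|U t i j| ^+ 2 <= true%:R.
  rewrite -UU (bigD1 j) //= !mxE -normCK lerDl sumr_ge0 // => l _.
  by rewrite !mxE mul_conjC_ge0.
by rewrite -(@ler_pXn2r _ 2) ?nnegrE // expr1n.
Qed.

(** Invariance on Borel sets, applied to preimages under the real and imaginary parts of [f], says
    that these have the same law at [V *m U] and at [U]. *)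
Lemma haar_invariance (V : 'M[R[i]]_n)
    (f : g_sigma_algebraType (@open 'M[Cplx R]_n) -> R[i]) :
  V \is unitarymx -> cmeasurable f -> cmeasurable (fun t => f (V *m U t)) ->
  Cexpect P (fun t => f (V *m U t)) = Cexpect P (fun t => f (U t)).
Proof.
move=> uV [f1 f2] [fV1 fV2]; have [mU _ invU] := U_haar.
have [m1 m2] := haar_cmeasurable (conj f1 f2).
apply: eq_complexP; rewrite /=; congr fine; apply: eq_law_expectation => // B mB.
  have := f1 measurableT B mB; rewrite setTI => mfB.
  exact: (invU V uV _ mfB).
have := f2 measurableT B mB; rewrite setTI => mfB.
exact: (invU V uV _ mfB).
Qed.

End HaarInvariance.

Section Density.
Import HBNNSimple.
Context (d : measure_display) (T : measurableType d) (R : realType).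
Variables (mu : {measure set T -> \bar R}) (nu : {measure set R -> \bar R}).
Local Open Scope classical_set_scope.

(** From indicators to simple functions by linearity, then to [h] by monotone convergence. It serves
    twice: with the normal density as [F], and with the product of the remaining independent
    variables as [F]. *)
Lemma ge0_integral_density (Y F : T -> R) (h : R -> R) :
  measurable_fun setT Y -> measurable_fun setT F -> (forall t, 0 <= F t) ->
  (forall B, measurable B ->
     (\int[mu]_t ((\1_B (Y t) : R) * F t)%:E = nu B)%E) ->
  measurable_fun setT h -> (forall r, 0 <= h r) ->
  (\int[mu]_t (h (Y t) * F t)%:E = \int[nu]_r (h r)%:E)%E.
Proof.
move=> mY mF F0 HB mh h0.
have simple (g : {nnsfun R >-> R}) :
    (\int[mu]_t (g (Y t) * F t)%:E = \int[nu]_r (g r)%:E)%E.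
  pose s : seq R := finmap.enum_fset (fset_set (range g)).
  have gE : forall r, g r = _ := fimfunEord g.
  have s0 i : (i < size s)%N -> 0 <= s`_i.
    move=> ilt; have : s`_i \in s by exact: mem_nth.
    by rewrite in_fset_set // => /set_mem[r _ <-].
  pose B i := g @^-1` [set s`_i].
  have mB i : measurable (B i) by exact: measurable_funPTI.
  have m1 i : measurable_fun setT (fun t => \1_(B i) (Y t) : R).
    by apply: measurableT_comp => //; exact: measurable_indic.
  have EL t : (g (Y t) * F t)%:E =
      (\sum_(i < size s) (s`_i)%:E * (\1_(B i) (Y t) * F t)%:E)%E.
    rewrite gE mulr_suml -sumEFin; apply: eq_bigr => i _.
    by rewrite -EFinM mulrA.
  have ER r : (g r)%:E =
      (\sum_(i < size s) (s`_i)%:E * (\1_(B i) r)%:E)%E.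
    by rewrite gE -sumEFin; apply: eq_bigr => i _; rewrite -EFinM.
  under eq_integral do rewrite EL.
  under [in RHS]eq_integral do rewrite ER.
  rewrite !ge0_integral_sum //; last 4 first.
  - by move=> i; apply: measurable_funeM; apply/measurable_EFinP;
      exact: measurable_indic.
  - by move=> i t _; rewrite mule_ge0 // lee_fin ?s0 ?indic_ge0.
  - move=> i; apply: measurable_funeM; apply/measurable_EFinP.
    exact: measurable_funM.
  - by move=> i t _; rewrite mule_ge0 // lee_fin ?s0 ?mulr_ge0 ?indic_ge0.
  apply: eq_bigr => i _.
  have Z (d' : measure_display) (S : measurableType d')
      (m : {measure set S -> \bar R}) (u : S -> R) :
      measurable_fun setT u -> (forall t, 0 <= u t) ->
      (\int[m]_t ((s`_i)%:E * (u t)%:E) = (s`_i)%:E * \int[m]_t (u t)%:E)%E.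
    move=> mu' u0; apply: ge0_integralZl_EFin => //; try exact: s0.
      by move=> t _; rewrite lee_fin.
    exact/measurable_EFinP.
  rewrite !Z //; last first.
  - by move=> t; rewrite mulr_ge0.
  - exact: measurable_funM.
  by rewrite HB // integral_indic // setIT.
have mhE : measurable_fun setT (EFin \o h) by exact/measurable_EFinP.
pose g := nnsfun_approx measurableT mhE.
have gh r : (g n r)%:E @[n --> \oo] --> (h r)%:E.
  by apply: (@cvg_nnsfun_approx _ _ _ setT measurableT (EFin \o h) mhE) => // ? _;
    rewrite lee_fin.
have gnd r : nondecreasing_seq (fun n => g n r).
  by move=> m n mn; exact/lefP/nd_nnsfun_approx.
have mg n : measurable_fun setT (g n) by [].
have mgY n : measurable_fun setT (fun t => g n (Y t)) by exact: measurableT_comp.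
have L : (\int[mu]_t (g n (Y t) * F t)%:E @[n --> \oo] -->
    \int[mu]_t (h (Y t) * F t)%:E)%E.
  rewrite (eq_integral (fun t => limn (fun n => (g n (Y t) * F t)%:E)));
    last first.
    move=> t _; apply/esym/cvg_lim => //.
    under eq_fun do rewrite EFinM.
    rewrite EFinM; apply: cvgeZr => //; exact: gh.
  apply: cvg_monotone_convergence => //.
  - by move=> n; apply/measurable_EFinP; exact: measurable_funM.
  - by move=> n t _; rewrite lee_fin mulr_ge0.
  - by move=> t _ m n mn; rewrite lee_fin ler_wpM2r // gnd.
have L' : (\int[nu]_r (g n r)%:E @[n --> \oo] --> \int[nu]_r (h r)%:E)%E.
  rewrite (eq_integral (fun r => limn (fun n => (g n r)%:E)));
    last by move=> r _; apply/esym/cvg_lim => //; exact: gh.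
  apply: cvg_monotone_convergence => //.
  - by move=> n; exact/measurable_EFinP.
  - by move=> n t _; rewrite lee_fin.
  - by move=> t _ m n mn; rewrite lee_fin gnd.
apply: (cvg_unique _ L) => //.
have -> : (fun n => \int[mu]_t (g n (Y t) * F t)%:E)%E =
    (fun n => \int[nu]_r (g n r)%:E)%E.
  by apply/funext => n; exact: simple.
exact: L'.
Qed.

End Density.

(** * Haar moments *)

Section UnitCircle.
Variable R : realType.

(* Cayley transform of the real axis *)
Let circle_point (r : nat) : R[i] := (1 +i* r%:R) / (1 -i* r%:R).

Let cayley_den_neq0 (r : nat) : (1 -i* r%:R : R[i]) != 0.
Proof. by rewrite eq_complex /= oner_eq0. Qed.

Let norm_circle_point r : `|circle_point r| = 1.
Proof.
rewrite /circle_point normrM normfV -(normcJ (1 -i* _)) /= opprK divff //.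
by rewrite normr_eq0 eq_complex /= oner_eq0.
Qed.

Let circle_point_inj : injective circle_point.
Proof.
move=> r s /eqP; rewrite /circle_point eqr_div ?cayley_den_neq0 //.
rewrite eq_complex /= => /andP[_ /eqP h].
apply/eqP; rewrite -(eqr_nat R); apply/eqP; move: h; lra.
Qed.

(** The Cayley images of the naturals are infinitely many points of the circle, more than a nonzero
    polynomial has roots. Identities on the circle thus become identities between coefficients. *)
Lemma poly_unit_circle_eq0 (p : {poly R[i]}) :
  (forall w : R[i], `|w| = 1 -> p.[w] = 0) -> p = 0.
Proof.
move=> p0; apply/eqP; apply: contraT => pN0.
have := @max_poly_roots _ p (map circle_point (iota 0 (size p))) pN0.
rewrite size_map size_iota ltnn; apply.
  by apply/allP => _ /mapP[r _ ->]; apply/rootP/p0/norm_circle_point.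
by rewrite map_inj_uniq ?iota_uniq //; exact: circle_point_inj.
Qed.

End UnitCircle.

(** * Expectations of random polynomials *)

Section RandomPolynomials.
Context (d : measure_display) (T : measurableType d) (R : realType).
Variable P : probability T R.
Implicit Types Q : T -> {poly R[i]}.

(** The uniform bound on the degree makes the expected value at [w] a polynomial in [w], with the
    expected coefficients. *)
Definition cbounded_poly Q :=
  (exists N, forall t, (size (Q t) <= N)%N) /\
  forall j, cbounded (fun t => (Q t)`_j).

Lemma cbounded_polyC (f : T -> R[i]) : cbounded f ->
  cbounded_poly (fun t => (f t)%:P).
Proof.
move=> bf; split; first by exists 1 => t; rewrite size_polyC; case: eqP.
move=> [|j]; first by under [X in cbounded X]funext do rewrite coefC.
by under [X in cbounded X]funext do rewrite coefC /=; exact: cbounded_cst.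
Qed.

Lemma cbounded_poly_cst (q : {poly R[i]}) : cbounded_poly (fun=> q).
Proof. by split=> [|j]; [exists (size q)|exact: cbounded_cst]. Qed.

Lemma cbounded_polyD Q1 Q2 : cbounded_poly Q1 -> cbounded_poly Q2 ->
  cbounded_poly (fun t => Q1 t + Q2 t).
Proof.
move=> [[N1 s1] b1] [[N2 s2] b2]; split.
  exists (maxn N1 N2) => t; rewrite (leq_trans (size_polyD _ _)) //.
  by rewrite geq_max !leq_max s1 s2 orbT.
by move=> j; under [X in cbounded X]funext do rewrite coefD; exact: cboundedD.
Qed.

Lemma cbounded_polyM Q1 Q2 : cbounded_poly Q1 -> cbounded_poly Q2 ->
  cbounded_poly (fun t => Q1 t * Q2 t).
Proof.
move=> [[N1 s1] b1] [[N2 s2] b2]; split.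
  exists (N1 + N2)%N => t; rewrite (leq_trans (size_polyMleq _ _)) //.
  by rewrite (leq_trans (leq_pred _)) // leq_add.
move=> j; under [X in cbounded X]funext do rewrite coefM.
by apply: cbounded_sum => i _; exact: cboundedM.
Qed.

Lemma cbounded_poly_prod (I : Type) (r : seq I) (C : pred I)
    (Q : I -> T -> {poly R[i]}) :
  (forall i, C i -> cbounded_poly (Q i)) ->
  cbounded_poly (fun t => \prod_(i <- r | C i) Q i t).
Proof.
move=> bQ; elim: r => [|i r IH].
  by under [X in cbounded_poly X]funext do rewrite big_nil;
    exact: cbounded_poly_cst.
under [X in cbounded_poly X]funext do rewrite big_cons.
by case Ci: (C i) => //; apply: cbounded_polyM => //; exact: bQ.
Qed.

(** Replaces differentiation under the integral: the polynomial of the expected coefficients agrees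
    with [kappa *: 'X^m] on the circle, hence equals it, and differentiation acts on
    coefficients. *)
Lemma Cexpect_deriv_unit_circle Q (kappa : R[i]) (m : nat) :
  cbounded_poly Q ->
  (forall w, `|w| = 1 -> Cexpect P (fun t => (Q t).[w]) = kappa * w ^+ m) ->
  Cexpect P (fun t => (Q t)^`().[1]) = kappa *+ m.
Proof.
move=> [[N sN] bQ] Qw.
pose EQ : {poly R[i]} := \poly_(j < N) Cexpect P (fun t => (Q t)`_j).
have cb j (c : R[i]) : cintegrable P (fun t => c * (Q t)`_j).
  by apply: cintegrableZ; exact: cbounded_integrable.
have EQE : EQ = kappa *: 'X^m.
  apply/eqP; rewrite -subr_eq0; apply/eqP/poly_unit_circle_eq0 => w w1.
  rewrite !hornerE -Qw // /EQ horner_poly.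
  under [X in _ - Cexpect P X]funext do rewrite (horner_coef_wide _ (sN _)).
  under [X in _ - Cexpect P X]funext do under eq_bigr do rewrite mulrC.
  rewrite Cexpect_sum => [|j _]; last exact: cb.
  apply/eqP; rewrite subr_eq0; apply/eqP; apply: eq_bigr => j _.
  by rewrite CexpectZ; [exact: mulrC|exact: cbounded_integrable].
have -> : kappa *+ m = EQ^`().[1].
  by rewrite EQE derivZ derivXn hornerZ hornerMn hornerXn expr1n mulr_natr.
have sd (q : {poly R[i]}) : (size q <= N)%N -> (size q^`() <= N)%N.
  by move=> qN; rewrite (leq_trans _ qN) // (leq_trans (size_poly _ _)) // leq_pred.
under [X in Cexpect P X]funext do rewrite (horner_coef_wide _ (sd _ (sN _))).
rewrite (horner_coef_wide _ (sd _ (size_poly _ _))).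
have cE t (j : nat) : (Q t)^`()`_j * 1 ^+ j = j.+1%:R * (Q t)`_j.+1.
  by rewrite expr1n mulr1 coef_deriv mulr_natl.
under [X in Cexpect P X]funext do under eq_bigr do rewrite cE.
rewrite Cexpect_sum => [|j _]; last exact: cb.
apply: eq_bigr => j _; rewrite CexpectZ; last exact: cbounded_integrable.
rewrite coef_deriv expr1n mulr1 coef_poly -[RHS]mulr_natl.
case: ltnP => // jN; rewrite mulr0.
under [X in Cexpect P X]funext do rewrite nth_default ?(leq_trans (sN _)) //.
by rewrite Cexpect_cst mulr0.
Qed.

End RandomPolynomials.

Lemma deriv_prod (K : comNzRingType) (I : finType) (D : {set I})
    (F : I -> {poly K}) :
  (\prod_(i in D) F i)^`() = \sum_(i in D) (F i)^`() * \prod_(j in D :\ i) F j.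
Proof.
elim: {D}_.+1 {-2}D (ltnSn #|D|) => // m IH D.
have [->|[i iD]] := set_0Vmem D; first by rewrite !big_set0 derivC.
move=> Dm; rewrite (big_setD1 i) //= derivM IH; last first.
  by rewrite -ltnS (leq_trans _ Dm) // ltnS [X in (_ < X)%N](cardsD1 i) iD.
rewrite [RHS](big_setD1 i) //=; congr (_ + _); rewrite mulr_sumr.
apply: eq_bigr => j; rewrite !inE => /andP[ji jD].
rewrite mulrCA; congr (_ * _).
rewrite [RHS](big_setD1 i) ?inE 1?eq_sym ?ji //; congr (_ * _).
by apply: eq_bigl => l; rewrite !inE; case: (l == i); case: (l == j).
Qed.

Definition upd (J : eqType) (A : Type) (x : J -> A) (i : J) (a : A) : J -> A :=
  fun j => if j == i then a else x j.

Lemma big_upd (K : comNzRingType) (J : finType) (A B : Type) (D : {set J})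
    (f : A -> B -> K) (x : J -> A) (y : J -> B) (i : J) (a : A) :
  i \in D ->
  \prod_(j in D) f (upd x i a j) (y j) =
  f a (y i) * \prod_(j in D :\ i) f (x j) (y j).
Proof.
move=> iD; rewrite (big_setD1 i) //= /upd eqxx; congr (_ * _).
by apply: eq_bigr => j; rewrite !inE => /andP[/negPf -> _].
Qed.

(** * Equations for the moments from invariance and unitarity *)

Section Moments.
Context (d : measure_display) (T : measurableType d) (R : realType).
Variables (P : probability T R) (n : nat) (U : T -> 'M[R[i]]_n).
Hypothesis U_haar : haar_unitary P U.

Lemma conjCE (z : R[i]) : Num.conj z = conjc z.
Proof. by []. Qed.

Section Slots.
Variable J : finType.
Implicit Types (D : {set J}) (x y : J -> 'I_n).

(** [x], [y] label the plain factors and [x'], [y'] the conjugated ones. The set [D] of active slots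
    is a parameter because orthogonality of the columns removes a slot. *)
Definition monomial D x y x' y' (A : 'M[R[i]]_n) : R[i] :=
  (\prod_(i in D) A (x i) (y i)) * \prod_(i in D) conjc (A (x' i) (y' i)).

Definition moment D x y x' y' : R[i] :=
  Cexpect P (fun t => monomial D x y x' y' (U t)).

Lemma monomial_cmeasurable D x y x' y' :
  cmeasurable (fun A : g_sigma_algebraType (@open 'M[Cplx R]_n) =>
    monomial D x y x' y' A).
Proof.
apply: cmeasurableM; apply: cmeasurable_prod => i _.
  exact: coord_cmeasurable.
by apply: cmeasurable_conj; exact: coord_cmeasurable.
Qed.

Lemma monomial_cbounded D x y x' y' :
  cbounded (fun t => monomial D x y x' y' (U t)).
Proof.
apply: cboundedM; apply: cbounded_prod => i _.
  exact: (haar_entry_cbounded U_haar).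
by apply: cbounded_conj; exact: (haar_entry_cbounded U_haar).
Qed.

Lemma mulmx_entry_cbounded (V : 'M[R[i]]_n) (i j : 'I_n) :
  cbounded (fun t => (V *m U t) i j).
Proof.
under [X in cbounded X]funext do rewrite mxE.
apply: cbounded_sum => l _; apply: cboundedM; first exact: cbounded_cst.
exact: (haar_entry_cbounded U_haar).
Qed.

Lemma moment_invariance (V : 'M[R[i]]_n) D x y x' y' : V \is unitarymx ->
  Cexpect P (fun t => monomial D x y x' y' (V *m U t)) = moment D x y x' y'.
Proof.
move=> uV; apply: (haar_invariance U_haar uV (monomial_cmeasurable D x y x' y')).
apply: cmeasurableM; apply: cmeasurable_prod => i _.
  by case: (mulmx_entry_cbounded V (x i) (y i)).
by apply: cmeasurable_conj; case: (mulmx_entry_cbounded V (x' i) (y' i)).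
Qed.

(** The matrix multiplies the range of the orthogonal projection [H] by the phase [w] and fixes its
    orthogonal complement. *)
Lemma reflection_unitarymx (H : 'M[R[i]]_n) (w : R[i]) :
  H *m H = H -> (H^t*)%sesqui = H -> `|w| = 1 ->
  (1%:M + (w - 1) *: H) \is unitarymx.
Proof.
move=> HH Hh w1; apply/unitarymxP.
have ww : w * conjc w = 1 by rewrite -conjCE -normCK w1 expr1n.
have -> : ((1%:M + (w - 1) *: H)^t*)%sesqui = 1%:M + (conjc w - 1) *: H.
  apply/matrixP => i j; rewrite -{2}Hh !mxE rmorphD rmorphM rmorphB rmorph1 /=.
  by rewrite conjCE conjc_nat eq_sym.
rewrite mulmxDl mul1mx mulmxDr mulmx1 -scalemxAl -scalemxAr HH scalerA.
rewrite -addrA -!scalerDl -[RHS]addr0 -(scale0r H); congr (_ + _ *: _).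
have -> : conjc w - 1 + (w - 1 + (w - 1) * (conjc w - 1)) =
  w * conjc w - 1 by ring.
by rewrite ww subrr.
Qed.

(** Under left multiplication by [1 + (w - 1) H], plain factors are affine in [w] and conjugated
    factors affine in [conjc w]. Multiplied by [w ^ #|D|], the monomial becomes a polynomial [Q] in
    [w] on the circle; invariance gives its expectation there, and the derivative at 1 is the
    claim. *)
Lemma moment_projection (H : 'M[R[i]]_n) D x y x' y' :
  H *m H = H -> (H^t*)%sesqui = H ->
  \sum_(i in D) \sum_c H (x i) c * moment D (upd x i c) y x' y' =
  \sum_(i in D) \sum_c conjc (H (x' i) c) * moment D x y (upd x' i c) y'.
Proof.
move=> HH Hh.
pose u i t := U t (x i) (y i); pose u' i t := conjc (U t (x' i) (y' i)).
pose B i t := \sum_c H (x i) c * U t c (y i).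
pose B' i t := \sum_c conjc (H (x' i) c) * conjc (U t c (y' i)).
pose F i t : {poly R[i]} := (u i t - B i t)%:P + (B i t)%:P * 'X.
(* The value at [w] is [w] times the transformed conjugated factor, since [w * conjc w = 1]. *)
pose F' i t : {poly R[i]} := (u' i t - B' i t)%:P * 'X + (B' i t)%:P.
pose Q t := (\prod_(i in D) F i t) * \prod_(i in D) F' i t.
have bu i : cbounded (u i) by exact: (haar_entry_cbounded U_haar).
have bu' i : cbounded (u' i).
  by apply: cbounded_conj; exact: (haar_entry_cbounded U_haar).
have bB i : cbounded (B i).
  apply: cbounded_sum => c _; apply: cboundedM; first exact: cbounded_cst.
  exact: (haar_entry_cbounded U_haar).
have bB' i : cbounded (B' i).
  apply: cbounded_sum => c _; apply: cboundedM; first exact: cbounded_cst.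
  by apply: cbounded_conj; exact: (haar_entry_cbounded U_haar).
have bN (f : T -> R[i]) : cbounded f -> cbounded (fun t => - f t).
  move=> bf; under [X in cbounded X]funext do rewrite -mulN1r.
  by apply: cboundedM => //; exact: cbounded_cst.
have bQ : cbounded_poly Q.
  apply: cbounded_polyM; apply: cbounded_poly_prod => i _;
    apply: cbounded_polyD; try apply: cbounded_polyM;
    try exact: cbounded_poly_cst; apply: cbounded_polyC => //;
    by apply: cboundedD => //; exact: bN.
have Qw w : `|w| = 1 ->
    Cexpect P (fun t => (Q t).[w]) = moment D x y x' y' * w ^+ #|D|.
  move=> w1; have ww : w * conjc w = 1 by rewrite -conjCE -normCK w1 expr1n.
  rewrite -(moment_invariance D x y x' y' (reflection_unitarymx HH Hh w1)).
  rewrite mulrC -CexpectZ; last first.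
    apply: cbounded_integrable.
    apply: cboundedM; apply: cbounded_prod => i _.
      exact: mulmx_entry_cbounded.
    by apply: cbounded_conj; exact: mulmx_entry_cbounded.
  apply: eq_Cexpect => t; rewrite /Q hornerM !horner_prod /monomial mulrCA.
  have VE a b : ((1%:M + (w - 1) *: H) *m U t) a b =
      U t a b + (w - 1) * \sum_c H a c * U t c b.
    by rewrite mulmxDl mul1mx -scalemxAl !mxE.
  congr (_ * _).
    apply: eq_bigr => i _; rewrite VE !hornerE /u /B.
    set s := (\sum_c _); ring.
  rewrite -prodr_const -big_split /=; apply: eq_bigr => i _.
  rewrite VE !hornerE /u' /B' rmorphD rmorphM rmorphB rmorph1 rmorph_sum /=.
  under [in RHS]eq_bigr do rewrite rmorphM /=.
  set s := (\sum_c _); set v := conjc (U _ _ _).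
  have -> : w * (v + (conjc w - 1) * s) = w * v + (w * conjc w - w) * s by ring.
  rewrite ww; ring.
have DQ t : (Q t)^`().[1] =
    (\sum_(i in D) \sum_c H (x i) c * monomial D (upd x i c) y x' y' (U t)) +
    (monomial D x y x' y' (U t) *+ #|D| -
    \sum_(i in D) \sum_c
      conjc (H (x' i) c) * monomial D x y (upd x' i c) y' (U t)).
  have F1 i : (F i t).[1] = u i t by rewrite /F !hornerE subrK.
  have F'1 i : (F' i t).[1] = u' i t by rewrite /F' !hornerE subrK.
  have DF1 i : (F i t)^`().[1] = B i t by rewrite /F derivD derivM derivX !derivC !hornerE.
  have DF'1 i : (F' i t)^`().[1] = u' i t - B' i t.
    by rewrite /F' derivD derivM derivX !derivC !hornerE.
  rewrite /Q derivM hornerD !hornerM !deriv_prod !horner_sum !horner_prod.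
  congr (_ + _).
    rewrite mulr_suml; apply: eq_bigr => i iD.
    rewrite hornerM DF1 horner_prod.
    under eq_bigr do rewrite F1; under [X in _ * X]eq_bigr do rewrite F'1.
    rewrite /B !mulr_suml; apply: eq_bigr => c _.
    by rewrite /monomial (big_upd (fun a b => U t a b)) // !mulrA.
  under eq_bigr do rewrite F1.
  rewrite -sumr_const -sumrB mulr_sumr; apply: eq_bigr => i iD.
  rewrite hornerM DF'1 horner_prod.
  under [X in _ * (_ * X)]eq_bigr do rewrite F'1.
  rewrite mulrBl mulrBr; congr (_ - _).
    by rewrite /monomial; congr (_ * _); rewrite [RHS](big_setD1 i).
  rewrite /B' mulr_suml mulr_sumr; apply: eq_bigr => c _.
  rewrite /monomial (big_upd (fun a b => conjc (U t a b))) //.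
  by rewrite !mulrA; congr (_ * _); rewrite mulrAC mulrC mulrA.
have := Cexpect_deriv_unit_circle bQ Qw.
under [X in Cexpect P X = _]funext do rewrite DQ.
have im D1 x1 y1 x2 y2 (c : R[i]) :
    cintegrable P (fun t => c * monomial D1 x1 y1 x2 y2 (U t)).
  by apply/cintegrableZ/cbounded_integrable/monomial_cbounded.
have is1 : cintegrable P (fun t => \sum_(i in D) \sum_c
    H (x i) c * monomial D (upd x i c) y x' y' (U t)).
  by do 2!apply: cintegrable_sum => ? _.
have is2 : cintegrable P (fun t => \sum_(i in D) \sum_c
    conjc (H (x' i) c) * monomial D x y (upd x' i c) y' (U t)).
  by do 2!apply: cintegrable_sum => ? _.
under [X in Cexpect P X = _]funext do
  rewrite -mulr_natl -(mulN1r (\sum_(i in D) _)).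
rewrite CexpectD //; last first.
  by apply: cintegrableD => //; exact: cintegrableZ.
rewrite CexpectD //; last exact: cintegrableZ.
rewrite !CexpectZ //; last by apply/cbounded_integrable/monomial_cbounded.
rewrite mulN1r mulr_natl -/(moment D x y x' y').
(* The [#|D|] copies of the moment, created by the factor [w ^ #|D|], occur on both sides and
   cancel. *)
rewrite addrCA -[RHS]addr0 => /addrI/eqP; rewrite subr_eq0 => /eqP.
rewrite !Cexpect_sum; try by move=> ? _; apply: cintegrable_sum => ? _.
under eq_bigr do rewrite Cexpect_sum //.
under [in X in _ = X]eq_bigr do rewrite Cexpect_sum //.
have CE D1 x1 y1 x2 y2 (c : R[i]) :
    Cexpect P (fun t => c * monomial D1 x1 y1 x2 y2 (U t)) =
    c * moment D1 x1 y1 x2 y2.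
  by rewrite CexpectZ //; apply/cbounded_integrable/monomial_cbounded.
move=> E; transitivity (\sum_(i in D) \sum_c
  Cexpect P (fun t => H (x i) c * monomial D (upd x i c) y x' y' (U t))).
  by apply: eq_bigr => i _; apply: eq_bigr => c _; rewrite CE.
by rewrite E; apply: eq_bigr => i _; apply: eq_bigr => c _; rewrite CE.
Qed.

(** The projection onto the line of [v] has entries [v a * conjc (v b)] divided by the squared norm
    [s]. Clearing [s] leaves the sesquilinear expression that polarization requires; if [s = 0],
    then [v = 0] and both sides vanish. *)
Lemma moment_rank_one (v : 'I_n -> R[i]) D x y x' y' :
  \sum_(i in D) \sum_c v (x i) * conjc (v c) * moment D (upd x i c) y x' y' =
  \sum_(i in D) \sum_c v c * conjc (v (x' i)) * moment D x y (upd x' i c) y'.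
Proof.
pose s := \sum_c v c * conjc (v c).
have [s0|s0] := eqVneq s 0.
  have v0 c : v c = 0.
    have := s0; move/eqP; rewrite psumr_eq0 => [/allP|l _]; last exact: mulcJ_ge0.
    move=> /(_ c (mem_index_enum c)) /=.
    by rewrite mulf_eq0 conjc_eq0 orbb => /eqP.
  rewrite !big1 // => i _; rewrite big1 // => c _; first by rewrite !v0 !mul0r.
  by rewrite v0 !mul0r.
pose H : 'M[R[i]]_n := \matrix_(a, b) (s^-1 * (v a * conjc (v b))).
have sr : conjc s = s.
  rewrite -conjCE /s rmorph_sum; apply: eq_bigr => c _.
  by rewrite rmorphM /= !conjCE conjcK mulrC.
have HH : H *m H = H.
  apply/matrixP => a b; rewrite !mxE.
  under eq_bigr do rewrite !mxE.
  transitivity (s^-1 * s^-1 * s * (v a * conjc (v b))); last by rewrite mulfVK.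
  rewrite /s mulr_sumr mulr_suml; apply: eq_bigr => c _; ring.
have Hh : (H^t*)%sesqui = H.
  apply/matrixP => a b; rewrite !mxE !rmorphM /= fmorphV /= !conjCE conjcK sr.
  by rewrite (mulrC (v a)).
have := moment_projection D x y x' y' HH Hh.
have E1 i c : H (x i) c * moment D (upd x i c) y x' y' =
    s^-1 * (v (x i) * conjc (v c) * moment D (upd x i c) y x' y').
  by rewrite mxE !mulrA.
have E2 i c : conjc (H (x' i) c) * moment D x y (upd x' i c) y' =
    s^-1 * (v c * conjc (v (x' i)) * moment D x y (upd x' i c) y').
  rewrite mxE -conjCE !rmorphM fmorphV /= !conjCE conjcK sr; ring.
under eq_bigr do under eq_bigr do rewrite E1.
under [RHS]eq_bigr do under eq_bigr do rewrite E2.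
under eq_bigr do rewrite -mulr_sumr.
under [RHS]eq_bigr do rewrite -mulr_sumr.
by rewrite -!mulr_sumr => /mulfI; apply; rewrite invr_eq0.
Qed.

(* Differentiate the left invariance of the law along [1 + (w - 1) H], where [H]
   is a rank-one projection and [w] runs over the unit circle; polarization then
   gives the matrix unit [E_ab]. *)
Lemma schwinger_dyson (a b : 'I_n) D x y x' y' :
  \sum_(i in D | x i == a) moment D (upd x i b) y x' y' =
  \sum_(i in D | x' i == b) moment D x y (upd x' i a) y'.
Proof.
(* For [v z = e_a + z e_b], weighting by [z] and summing over the fourth roots of unity keeps only
   the part of the rank-one matrix proportional to [conjc z], which gives [4 E_ab]. *)
pose v (z : R[i]) (c : 'I_n) : R[i] := (c == a)%:R + z * (c == b)%:R.
pose s : seq R[i] := [:: 1; 'i%C; - 1; - 'i%C].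
have K p q : \sum_(z <- s) z * (v z p * conjc (v z q)) =
    4 * ((p == a)%:R * (q == b)%:R).
  rewrite !big_cons big_nil /v.
  by case: (p == a); case: (p == b); case: (q == a); case: (q == b);
    apply: eq_complexP => /=; ring.
have E : \sum_(z <- s) z * (\sum_(i in D) \sum_c
      v z (x i) * conjc (v z c) * moment D (upd x i c) y x' y') =
    \sum_(z <- s) z * (\sum_(i in D) \sum_c
      v z c * conjc (v z (x' i)) * moment D x y (upd x' i c) y').
  by apply: eq_bigr => z _; rewrite moment_rank_one.
have L : \sum_(z <- s) z * (\sum_(i in D) \sum_c
      v z (x i) * conjc (v z c) * moment D (upd x i c) y x' y') =
    4 * \sum_(i in D | x i == a) moment D (upd x i b) y x' y'.
  under eq_bigr do rewrite mulr_sumr.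
  rewrite exchange_big mulr_sumr big_mkcondr /=; apply: eq_bigr => i _.
  under eq_bigr do rewrite mulr_sumr.
  rewrite exchange_big /= (bigD1 b) //= [X in _ + X]big1 => [|c /negPf cb].
    under eq_bigr do rewrite mulrA.
    rewrite -mulr_suml K eqxx addr0.
    by case: (x i == a); rewrite /= ?mulr1n ?mulr0n ?mulr1 ?mul0r ?mulr0 ?mul0r.
  under eq_bigr do rewrite mulrA.
  by rewrite -mulr_suml K cb !mulr0 mul0r.
have Rr : \sum_(z <- s) z * (\sum_(i in D) \sum_c
      v z c * conjc (v z (x' i)) * moment D x y (upd x' i c) y') =
    4 * \sum_(i in D | x' i == b) moment D x y (upd x' i a) y'.
  under eq_bigr do rewrite mulr_sumr.
  rewrite exchange_big mulr_sumr big_mkcondr /=; apply: eq_bigr => i _.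
  under eq_bigr do rewrite mulr_sumr.
  rewrite exchange_big /= (bigD1 a) //= [X in _ + X]big1 => [|c /negPf ca].
    under eq_bigr do rewrite mulrA.
    rewrite -mulr_suml K eqxx addr0.
    by case: (x' i == b); rewrite /= ?mulr1n ?mulr0n ?mulr1 ?mul0r ?mulr0 ?mul0r.
  under eq_bigr do rewrite mulrA.
  by rewrite -mulr_suml K ca mul0r mulr0 mul0r.
move: E; rewrite L Rr => /mulfI; apply.
by rewrite pnatr_eq0.
Qed.

(** Summing over a common row label contracts the two factors of slot [r] into the scalar product of
    two columns. *)
Lemma moment_orthogonality (r : J) D x y x' y' : r \in D ->
  \sum_a moment D (upd x r a) y (upd x' r a) y' =
  (y r == y' r)%:R * moment (D :\ r) x y x' y'.
Proof.
move=> rD; have [_ uU _] := U_haar.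
rewrite /moment -Cexpect_sum => [|a _]; last first.
  exact/cbounded_integrable/monomial_cbounded.
rewrite -CexpectZ; last exact/cbounded_integrable/monomial_cbounded.
apply: eq_Cexpect => t.
have UU : \sum_a U t a (y r) * conjc (U t a (y' r)) = (y r == y' r)%:R.
  have /unitarymxP/mulmx1C/matrixP/(_ (y' r) (y r)) := uU t.
  rewrite !mxE eq_sym => <-; apply: eq_bigr => a _.
  by rewrite !mxE mulrC.
rewrite -UU mulr_suml; apply: eq_bigr => a _; rewrite /monomial.
rewrite (big_upd (fun a b => U t a b)) //.
rewrite (big_upd (fun a b => conjc (U t a b))) //; ring.
Qed.

(** For each outcome [t] the adjoint of [U t] is unitary and may be inserted on the left. Expanding
    the product and averaging over [t], as over an independent copy of [U], gives a right-hand side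
    with the symmetry used in [moment_swap]. *)
Lemma moment_sqr x y x' y' : moment [set: J]%SET x y x' y' =
  \sum_(z : {ffun J -> 'I_n}) \sum_(z' : {ffun J -> 'I_n})
    moment [set: J]%SET z y z' y' * moment [set: J]%SET z' x' z x.
Proof.
have expand (V : 'M[R[i]]_n) t : monomial [set: J]%SET x y x' y' (V *m U t) =
    \sum_(z : {ffun J -> 'I_n}) \sum_(z' : {ffun J -> 'I_n})
      monomial [set: J]%SET x z x' z' V * monomial [set: J]%SET z y z' y' (U t).
  rewrite /monomial.
  have big1T (g : J -> R[i]) : \prod_(i in [set: J]%SET) g i = \prod_i g i.
    by apply: eq_bigl => i; rewrite inE.
  rewrite !big1T.
  under eq_bigr do rewrite mxE.
  under [X in _ * X]eq_bigr do rewrite mxE -conjCE rmorph_sum /=.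
  rewrite !bigA_distr_bigA big_distrlr /=.
  apply: eq_bigr => z _; apply: eq_bigr => z' _; rewrite !big1T.
  under [X in _ * X]eq_bigr do rewrite rmorphM /=.
  rewrite !big_split /=; ring.
have [_ uU _] := U_haar.
have E t : moment [set: J]%SET x y x' y' =
    \sum_(z : {ffun J -> 'I_n}) \sum_(z' : {ffun J -> 'I_n})
      moment [set: J]%SET z y z' y' * monomial [set: J]%SET z' x' z x (U t).
  have uV : (U t)^t*%sesqui \is unitarymx by rewrite trmxC_unitary.
  rewrite -(moment_invariance [set: J]%SET x y x' y' uV).
  under [X in Cexpect P X]funext do rewrite expand.
  have im x1 y1 x2 y2 (c : R[i]) :
      cintegrable P (fun t => c * monomial [set: J]%SET x1 y1 x2 y2 (U t)).
    by apply/cintegrableZ/cbounded_integrable/monomial_cbounded.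
  rewrite Cexpect_sum => [|z _]; last by apply: cintegrable_sum => ? _.
  apply: eq_bigr => z _; rewrite Cexpect_sum //; apply: eq_bigr => z' _.
  rewrite CexpectZ; last exact/cbounded_integrable/monomial_cbounded.
  rewrite mulrC; congr (_ * _); rewrite /monomial mulrC; congr (_ * _).
    by apply: eq_bigr => i _; rewrite !mxE /= conjCE conjcK.
  by apply: eq_bigr => i _; rewrite !mxE.
have im x1 y1 x2 y2 (c : R[i]) :
    cintegrable P (fun t => c * monomial [set: J]%SET x1 y1 x2 y2 (U t)).
  by apply/cintegrableZ/cbounded_integrable/monomial_cbounded.
(* The left-hand side is constant in [t], so [E t] can be integrated over [t]. *)
rewrite -[LHS](Cexpect_cst P).
under [X in Cexpect P X]funext => t do rewrite (E t).
rewrite Cexpect_sum => [|z _]; last by apply: cintegrable_sum => ? _.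
apply: eq_bigr => z _; rewrite Cexpect_sum //; apply: eq_bigr => z' _.
by rewrite CexpectZ //; apply/cbounded_integrable/monomial_cbounded.
Qed.

(* The law of [U] is also that of [U^*]: the matrix of the moments is a
   projection, hence Hermitian. *)
Lemma moment_swap x y x' y' :
  moment [set: J]%SET x y x' y' = moment [set: J]%SET y' x' y x.
Proof.
rewrite moment_sqr exchange_big [RHS]moment_sqr.
by apply: eq_bigr => z _; apply: eq_bigr => z' _; rewrite mulrC.
Qed.

End Slots.
End Moments.

(** * The Weingarten expansion *)

Section Expansion.
Context (d : measure_display) (T : measurableType d) (R : realType).
Variables (P : probability T R) (n : nat) (U : T -> 'M[R[i]]_n).
Hypothesis U_haar : haar_unitary P U.
Variable J : finType.
Implicit Types (D : {set J}) (x y s t : J -> 'I_n).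

Local Notation moment := (moment P U).

Lemma upd_id (A : Type) (x : J -> A) i : upd x i (x i) = x.
Proof. by apply/funext => j; rewrite /upd; case: eqP => [->|]. Qed.

Lemma upd_upd (A : Type) (x : J -> A) i a b : upd (upd x i a) i b = upd x i b.
Proof. by apply/funext => j; rewrite /upd; case: eqP. Qed.

(** At [a = b = u] all updates are trivial, and the Schwinger-Dyson equation multiplies the same
    moment by the two numbers of occurrences of [u]. *)
Lemma moment_weight (u : 'I_n) D x y x' y' :
  #|[set i in D | x i == u]| != #|[set i in D | x' i == u]| ->
  moment D x y x' y' = 0.
Proof.
move=> cN; have := schwinger_dyson U_haar u u D x y x' y'.
have cst (z : J -> 'I_n) (F : (J -> 'I_n) -> R[i]) :
    \sum_(i in D | z i == u) F (upd z i u) = F z *+ #|[set i in D | z i == u]|.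
  rewrite -sumr_const; apply: eq_big => [i|i /andP[_ /eqP <-]].
    by rewrite inE.
  by rewrite upd_id.
rewrite (cst x (fun z => moment D z y x' y')).
rewrite (cst x' (fun z => moment D x y z y')).
rewrite -[LHS]mulr_natr -[RHS]mulr_natr => /eqP.
rewrite -subr_eq0 -mulrBr mulf_eq0 => /orP[/eqP//|].
by rewrite subr_eq0 eqr_nat (negPf cN).
Qed.

(** Schwinger-Dyson equation for [upd x r b]: only slot [r] carries the fresh label [b], so one side
    has the single term in which the original label is restored. *)
Lemma moment_fresh (r : J) (b : 'I_n) D x y x' y' : r \in D ->
  (forall i, i \in D -> x i != b) ->
  moment D x y x' y' =
  \sum_(j in D | x' j == x r) moment D (upd x r b) y (upd x' j b) y'.
Proof.
move=> rD xb; rewrite -(schwinger_dyson U_haar b (x r) D (upd x r b)).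
rewrite (big_pred1 r) => [|i]; first by rewrite upd_upd upd_id.
rewrite /upd /=; case: (eqVneq i r) => [->|_]; first by rewrite eqxx rD.
by case: (boolP (i \in D)) => //= /xb/negPf.
Qed.

(** A permutation compatible with the updated labels must send the updated slot [j] to [r], the only
    place of the fresh label; hence only [j = sg^-1 r] can contribute. *)
Lemma upd_perm_sum (K : nzRingType) x x' (r : J) (b : 'I_n) (sg : {perm J}) :
  (forall i, x i != b) ->
  \sum_(j | x' j == x r)
    [forall i, upd x' j b i == upd x r b (sg i)]%:R =
  [forall i, x' i == x (sg i)]%:R :> K.
Proof.
move=> xb; pose j0 := (sg^-1)%g r.
have sgj0 : sg j0 = r by rewrite permKV.
have sgN i : i != j0 -> sg i != r by rewrite -sgj0 (inj_eq perm_inj).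
have other j : j != j0 ->
    [forall i, upd x' j b i == upd x r b (sg i)] = false.
  move=> jj0; apply/negP => /forallP/(_ j).
  by rewrite /upd eqxx (negPf (sgN _ jj0)) eq_sym (negPf (xb _)).
have [/forallP xx'|/forallP xx'] := boolP [forall i, x' i == x (sg i)].
  rewrite (bigD1 j0) /=; last by rewrite (eqP (xx' j0)) sgj0.
  rewrite big1 => [|j /andP[_ /other ->] //].
  rewrite addr0 (_ : [forall i, _] = true) //; apply/forallP => i.
  rewrite /upd; case: (eqVneq i j0) => [->|ij0]; first by rewrite sgj0 eqxx.
  by rewrite (negPf (sgN _ ij0)); exact: xx'.
rewrite big1 // => j /eqP x'j; case: (eqVneq j j0) => [jj0|/other -> //].
case: (boolP [forall _, _]) => // /forallP h; case: xx' => i.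
case: (eqVneq i j0) => [->|ij0]; first by rewrite sgj0 -jj0 x'j.
by have := h i; rewrite /upd jj0 (negPf ij0) (negPf (sgN _ ij0)).
Qed.

(** By [moment_weight], a nonzero moment forces each label of [s] to occur exactly once in [x'].
    Then [x'] is [s] composed with a permutation, unique since [s] is injective. *)
Lemma moment_expand_base s y x' y' : injective s ->
  moment [set: J]%SET s y x' y' =
  \sum_(sg : {perm J}) [forall i, x' i == s (sg i)]%:R *
    moment [set: J]%SET s y (s \o sg) y'.
Proof.
move=> s_inj.
have [/existsP[sg /forallP x'E]|/existsPn N] :=
    boolP [exists sg : {perm J}, [forall i, x' i == s (sg i)]].
  have -> : x' = s \o sg by apply/funext => i; exact/eqP/x'E.
  rewrite (bigD1 sg) //= big1 => [|tu tusg].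
    rewrite addr0 (_ : [forall i, _] = true) ?mul1r //.
    exact/forallP.
  case: (boolP [forall _, _]) => [/forallP h|_]; last by rewrite mul0r.
  case/eqP: tusg; apply/permP => i; apply: s_inj; apply/eqP.
  by rewrite eq_sym; exact: h.
rewrite [RHS]big1 => [|sg _]; last by rewrite (negPf (N sg)) mul0r.
apply/eqP; apply: contraT => mN0.
have cnt u : #|[set i in [set: J]%SET | s i == u]| =
             #|[set i in [set: J]%SET | x' i == u]|.
  by apply/eqP; apply: contraNT mN0 => /(moment_weight y y') ->.
have ex i : exists j, s j == x' i.
  have := cnt (x' i); have [j sj _|sN] := pickP (fun j => s j == x' i).
    by exists j.
  rewrite (_ : finset _ = finset.set0); last by apply/setP => j; rewrite !inE sN.
  by rewrite cards0 => /esym/eqP; rewrite cards_eq0 => /eqP/setP/(_ i);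
    rewrite !inE eqxx.
pose f i := xchoose (ex i).
have fE i : s (f i) = x' i by apply/eqP; exact: (xchooseP (ex i)).
have f_inj : injective f.
  move=> i j fij; have := cnt (s (f i)).
  rewrite (_ : finset _ = [set f i]%SET); last first.
    by apply/setP => l; rewrite !inE (inj_eq s_inj).
  rewrite cards1 => /esym/eqP/cards1P[l] /setP lE.
  have := lE i; rewrite !inE fE eqxx => /esym/eqP ->.
  by have := lE j; rewrite !inE fij fE eqxx => /esym/eqP ->.
have /forallP[] := N (perm f_inj).
by move=> i; rewrite permE fE.
Qed.

(* The labels [x i] are replaced by the fresh labels [s i] one at a time. *)
Lemma moment_expand s x y x' y' : injective s -> (forall i j, x i != s j) ->
  moment [set: J]%SET x y x' y' =
  \sum_(sg : {perm J}) [forall i, x' i == x (sg i)]%:R *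
    moment [set: J]%SET s y (s \o sg) y'.
Proof.
move=> s_inj xs.
pose z (A : {set J}) i := if i \in A then s i else x i.
suff main m : forall (A : {set J}) x', #|~: A| = m ->
    moment [set: J]%SET (z A) y x' y' =
    \sum_(sg : {perm J}) [forall i, x' i == z A (sg i)]%:R *
      moment [set: J]%SET s y (s \o sg) y'.
  have z0 : z finset.set0 = x by apply/funext => i; rewrite /z inE.
  by have := main _ finset.set0 x' erefl; rewrite z0.
elim: m => [|m IH] A {}x' Am.
  have -> : z A = s; last exact: moment_expand_base.
  apply/funext => i; rewrite /z; case: ifPn => //.
  by move/eqP: Am; rewrite cards_eq0 => /eqP/setP/(_ i); rewrite !inE => /negbFE ->.
have [r rA] : exists r, r \in ~: A by apply/set0Pn; rewrite -cards_eq0 Am.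
have rA' : r \notin A by rewrite inE in rA.
have zb i : z A i != s r.
  rewrite /z; case: ifPn => [iA|_]; last exact: xs.
  by rewrite (inj_eq s_inj); apply: contraNneq rA' => <-.
have zE : upd (z A) r (s r) = z (r |: A).
  apply/funext => i; rewrite /upd /z !inE.
  by case: (eqVneq i r) => [->|].
rewrite (@moment_fresh r (s r)) ?inE // zE.
have Am' : #|~: (r |: A)| = m.
  apply/eqP; rewrite -eqSS -Am (cardsD1 r (~: A)) rA add1n; apply/eqP.
  by congr _.+1; apply: eq_card => i; rewrite !inE negb_or.
under eq_bigr => j _ do rewrite (IH (r |: A) _ Am').
rewrite exchange_big; apply: eq_bigr => sg _; rewrite -mulr_suml; congr (_ * _).
rewrite -(upd_perm_sum _ x' r sg zb) zE.
by apply: eq_bigl => j; rewrite inE.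
Qed.

End Expansion.

(** * The Weingarten function: recursion and bound *)

Section Weingarten.
Context (d : measure_display) (T : measurableType d) (R : realType).
Variables (P : probability T R) (n : nat) (U : T -> 'M[R[i]]_n).
Hypothesis U_haar : haar_unitary P U.
Variable J : finType.
Variables (s t : J -> 'I_n).
Hypotheses (s_inj : injective s) (t_inj : injective t).
Implicit Types (D : {set J}) (p : {perm J}).

Local Notation moment := (moment P U).

Lemma moment_reindex_conj D x y x' y' p : perm_on D p ->
  moment D x y (x' \o p) (y' \o p) = moment D x y x' y'.
Proof.
move=> pD; rewrite /moment; apply: eq_Cexpect => w; congr (_ * _).
rewrite [RHS](reindex_inj (@perm_inj _ p)) /=.
by apply: eq_bigl => i; rewrite (perm_closed _ pD).
Qed.

(* The Weingarten function of [U(n)] in degree [#|D|]: as [s] and [t] are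
   injective, it depends only on the permutation [p] of [D]. *)
Definition wein D p := moment D s t s (t \o p).

(** In the orthogonality relation at [r], each of the [n] row labels [a] contributes one copy of
    [wein D p]: directly if [a = s r], otherwise after [moment_fresh] has restored [s r]. A label
    [a = s j] with [j] another slot of [D] contributes in addition the term where [r] and [j] are
    exchanged. *)
Lemma wein_recursion D (r : J) p : r \in D -> perm_on D p ->
  n%:R * wein D p + \sum_(j in D :\ r) wein D (tperm r j * p)%g =
  (p r == r)%:R * wein (D :\ r) p.
Proof.
move=> rD pD.
have := moment_orthogonality U_haar s t s (t \o p) rD.
rewrite /= (inj_eq t_inj) eq_sym => <-.
have E a : moment D (upd s r a) t (upd s r a) (t \o p) =
    wein D p + \sum_(j in D :\ r | s j == a) wein D (tperm r j * p)%g.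
  have [->|ar] := eqVneq a (s r).
    rewrite upd_id big_pred0 ?addr0 // => j; rewrite !inE (inj_eq s_inj).
    by case: (j == r); rewrite ?andbF.
  have fresh i : i \in D -> upd s r a i != s r.
    by move=> _; rewrite /upd; case: (eqVneq i r) => [//|ir]; rewrite (inj_eq s_inj).
  rewrite (moment_fresh U_haar _ _ _ rD fresh) (bigD1 r) /=; last first.
    by rewrite rD eqxx.
  rewrite !upd_upd !upd_id -/(wein D p); congr (_ + _).
  have Ea : upd s r a r = a by rewrite /upd eqxx.
  apply: eq_big => [j|j /andP[/andP[jD]]].
    rewrite Ea !inE /upd; case: (eqVneq j r) => [->|_].
      by rewrite andbF.
    by rewrite andbT andbC.
  rewrite Ea /upd => ja jr; rewrite (negPf jr) in ja.
  have tD : perm_on D (tperm r j).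
    apply/fintype.subsetP => i; rewrite inE.
    by case: tpermP => [->|->|]; rewrite ?eqxx.
  rewrite /wein -[RHS](moment_reindex_conj _ _ _ _ tD).
  have -> : (t \o (tperm r j * p)%g) \o tperm r j = t \o p.
    by apply/funext => i; rewrite /= permM tpermK.
  congr (Defs.Cexpect _ _); apply/funext => w.
  congr (_ * _); apply: eq_bigr => i _; rewrite /=; congr (conjc (U w _ _)).
  case: tpermP => [->|->|/eqP ir /eqP ij].
  - by rewrite eq_sym (negPf jr) eqxx (eqP ja).
  - by rewrite eqxx.
  - by rewrite (negPf ij) (negPf ir).
under [RHS]eq_bigr do rewrite E.
rewrite big_split /= sumr_const card_ord mulr_natl; congr (_ + _).
under [RHS]eq_bigr do rewrite big_mkcondr /=.
rewrite exchange_big /=; apply: eq_bigr => j _.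
by rewrite -big_mkcond /= (big_pred1 (s j)) // => a; rewrite /= eq_sym.
Qed.

(** The usual decay of Weingarten functions is in the transposition length, which is at least half
    of this number. Moved points are counted because they translate into disagreements of two
    permutations. *)
Definition moved p := #|[set i | p i != i]|.

End Weingarten.

Section SuperSolution.
Variables (R : realFieldType) (n q : nat) (th : R).
Hypotheses (th_gt0 : 0 < th) (th2 : th ^+ 2 * n%:R = 9)
  (q_n2 : 14 * q%:R ^+ 2 <= n%:R ^+ 2 :> R)
  (q_n3 : 9 * q%:R ^+ 2 * th <= 3 * n%:R :> R)
  (th_le1 : (1 < q)%N -> th <= 1).

(* Majorant of [n ^ m * |wein|] in degree [m <= q] at a permutation moving [l]
   points; the constants make it a supersolution of [wein_recursion]. *)
Definition wein_bound (m l : nat) : R :=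
  if l == 0 then 1 + 7 * m%:R ^+ 2 / n%:R ^+ 2
  else (1 + m%:R / (2 * q%:R)) * th ^+ l.

Let n_gt0 : 0 < n%:R :> R.
Proof.
have := th2; rewrite lt0r ler0n andbT => h; apply: contraTneq isT => n0.
by move: h; rewrite n0 mulr0 => /eqP; rewrite eq_sym pnatr_eq0.
Qed.

Let q_le n' : (n' <= q)%N -> n'%:R <= q%:R :> R.
Proof. by rewrite ler_nat. Qed.

Lemma wein_bound0_le m : (m <= q)%N -> 1 + 7 * m%:R ^+ 2 / n%:R ^+ 2 <= 3 / 2 :> R.
Proof.
move=> mq; have n2 : 0 < n%:R ^+ 2 :> R by rewrite exprn_gt0.
suff : 7 * m%:R ^+ 2 / n%:R ^+ 2 <= 1 / 2 :> R by lra.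
rewrite ler_pdivrMr //.
have : m%:R ^+ 2 <= q%:R ^+ 2 :> R by rewrite lerXn2r ?nnegrE ?ler0n ?q_le.
move: q_n2; set a := _ ^+ 2; set b := _ ^+ 2; set c := _ ^+ 2; lra.
Qed.

Lemma wein_bound_factor m : (m <= q)%N -> 1 + m%:R / (2 * q%:R) <= 3 / 2 :> R.
Proof.
move=> mq; case: (posnP q) => [q0|q_gt0].
  have -> : m%:R = 0 :> R by move: mq; rewrite q0 leqn0 => /eqP ->.
  by rewrite mul0r addr0; lra.
have q0 : 0 < q%:R :> R by rewrite ltr0n.
suff : m%:R / (2 * q%:R) <= 1 / 2 :> R by lra.
rewrite ler_pdivrMr ?mulr_gt0 //; have := q_le mq; lra.
Qed.

Lemma wein_bound_le m l l0 : (1 < q)%N -> (m <= q)%N -> (l0 <= l)%N ->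
  wein_bound m l <= 3 / 2 * th ^+ l0.
Proof.
move=> q1 mq l0l; rewrite /wein_bound.
have th0 : 0 <= th by exact: ltW.
case: eqP => [l_0|_].
  have -> : l0 = 0 by move: l0l; rewrite l_0 leqn0 => /eqP.
  by rewrite expr0 mulr1 wein_bound0_le.
apply: ler_pM.
- by rewrite addr_ge0 ?divr_ge0 ?mulr_ge0 ?ler0n.
- exact: exprn_ge0.
- exact: wein_bound_factor.
- by apply: ler_wiXn2l => //; exact: th_le1.
Qed.

Variable J : finType.
Implicit Types (D : {set J}) (p : {perm J}).

(** If [p] moves [r], only [j = p r] and [j = p^-1 r] can lower the number of moved points, by at
    most two, and the factor [n] absorbs this. If [p] fixes [r], every transposition raises that
    number, and the growth of the bound from degree [#|D| - 1] to [#|D|] pays for the sum. *)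
Lemma wein_bound_supersolution D (r : J) p : r \in D -> (#|D| <= q)%N ->
  perm_on D p ->
  (p r == r)%:R * wein_bound #|D :\ r| (moved p) +
    n%:R^-1 * \sum_(j in D :\ r) wein_bound #|D| (moved (tperm r j * p)%g) <=
  wein_bound #|D| (moved p).
Proof.
move=> rD Dq pD.
have Dr : #|D| = #|D :\ r|.+1 by rewrite (cardsD1 r) rD.
have n0 : n%:R != 0 :> R by rewrite gt_eqF.
have q1 : (0 < #|D :\ r|)%N -> (1 < q)%N by move=> h; rewrite (leq_trans _ Dq) // Dr.
have tE j i : (tperm r j * p)%g i = if i == r then p j else if i == j then p r
    else p i.
  rewrite permM; case: tpermP => [->|->|/eqP/negPf -> /eqP/negPf ->] //.
    by rewrite eqxx.
  by case: eqVneq => [->|_]; rewrite ?eqxx.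
set m := #|D :\ r| in Dr *.
have bound l0 : (forall j, j \in D :\ r -> (l0 <= moved (tperm r j * p)%g)%N) ->
    \sum_(j in D :\ r) wein_bound #|D| (moved (tperm r j * p)%g) <=
    m%:R * (3 / 2 * th ^+ l0).
  move=> l0P; rewrite mulr_natl -sumr_const; apply: ler_sum => j jD.
  apply: wein_bound_le => //; last exact: l0P.
  by apply: q1; rewrite (cardsD1 j) jD.
have mleq : m%:R <= q%:R :> R by rewrite q_le // ltnW // -Dr.
have q3 : 3 * q%:R <= n%:R :> R.
  rewrite -(@ler_pXn2r _ 2) ?nnegrE ?mulr_ge0 ?ler0n // exprMn.
  by move: q_n2 (sqr_ge0 (q%:R : R)); set a := _ ^+ 2; set b := n%:R ^+ 2; lra.
have th0 : 0 <= th by exact: ltW.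
have [pr|pr] := eqVneq (p r) r; last first.
  rewrite mul0r add0r ler_pdivrMl //.
  set l := moved p; set A := 3 / 2 * th ^+ (l - 2).
  have A0 : 0 <= A by rewrite mulr_ge0 ?exprn_ge0.
  have l2 : (1 < l)%N.
    apply: (@leq_trans #|[set r; p r]%SET|); first by rewrite cards2 eq_sym pr.
    apply: subset_leq_card; apply/fintype.subsetP => i; rewrite !inE.
    by move=> /orP[]/eqP -> //; rewrite (inj_eq perm_inj).
  have term j : j \in D :\ r ->
      wein_bound #|D| (moved (tperm r j * p)%g) <=
      3 / 2 * th ^+ l + ((j == p r)%:R * A + (j == (p^-1)%g r)%:R * A).
    move=> jD; have q1' : (1 < q)%N by apply: q1; rewrite /m (cardsD1 j) jD.
    have jr : j != r by move: jD; rewrite !inE => /andP[].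
    have [Cj|] := boolP ((j == p r) || (j == (p^-1)%g r)).
      apply: (@le_trans _ _ A).
        apply: wein_bound_le => //; rewrite leq_subLR.
        rewrite /l /moved (cardsD1 r) (cardsD1 j) addnA.
        apply: leq_add; first by do 2!case: (_ \in _).
        apply: subset_leq_card; apply/fintype.subsetP => i.
        by rewrite !inE tE => /and3P[/negPf -> /negPf ->].
      have : 0 <= th ^+ l by rewrite exprn_ge0.
      have : A <= (j == p r)%:R * A + (j == (p^-1)%g r)%:R * A.
        by move: Cj A0; case: (j == p r); case: (j == (p^-1)%g r) => //= _;
          move: A => ?; lra.
      move: (_ + _) => B AB; move: (th ^+ l) => ? ?; lra.
    rewrite negb_or => /andP[j1 j2].
    rewrite (negPf j1) (negPf j2) !mul0r !addr0.
    apply: wein_bound_le => //; apply: subset_leq_card.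
    apply/fintype.subsetP => i; rewrite !inE tE.
    case: (eqVneq i r) => [-> _|_ pi].
      by rewrite -(inj_eq (@perm_inj _ (p^-1)%g)) permK.
    by case: (eqVneq i j) => [->|//]; rewrite eq_sym.
  apply: (le_trans (ler_sum _ term)).
  have one c : \sum_(j in D :\ r) (j == c)%:R * A <= A.
    rewrite -mulr_suml ler_piMl //.
    have [cD|cD] := boolP (c \in D :\ r).
      rewrite (bigD1 c) //= eqxx big1 ?addr0 //.
      by move=> j /andP[_ /negPf ->].
    rewrite big1 // => j jD; case: (eqVneq j c) => // jc.
    by rewrite -jc jD in cD.
  rewrite !big_split /= sumr_const -/m -[_ *+ m]mulr_natl.
  have E1 := one (p r); have E2 := one ((p^-1)%g r).
  have thl : th ^+ l = th ^+ (l - 2) * th ^+ 2 by rewrite -exprD subnK.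
  have kge : th ^+ l <= wein_bound #|D| l.
    rewrite /wein_bound ifF; last by apply/eqP => l0; rewrite l0 in l2.
    rewrite ler_peMl ?exprn_ge0 // lerDl.
    by rewrite divr_ge0 ?mulr_ge0 ?ler0n.
  apply: (@le_trans _ _ (n%:R * th ^+ l)); last by rewrite ler_pM2l.
  move: E1 E2; rewrite thl /A; set X := th ^+ (l - 2).
  have X0 : 0 <= X by rewrite exprn_ge0.
  move=> E1 E2.
  (* From [m <= q <= n / 3] and [th ^ 2 * n = 9]. The sum is then at most [(9 / 2 + 3) X], below
     [9 X = n * th ^ l]. *)
  have h1 : m%:R * (th ^+ 2 * X) <= 3 * X.
    rewrite mulrA ler_wpM2r //.
    have h : m%:R * th ^+ 2 <= q%:R * th ^+ 2 by rewrite ler_wpM2r ?exprn_ge0.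
    have : 3 * q%:R * th ^+ 2 <= n%:R * th ^+ 2 by rewrite ler_wpM2r ?exprn_ge0.
    by move: h; rewrite (mulrC n%:R) th2 -mulrA; lra.
  have -> : n%:R * (X * th ^+ 2) = 9 * X by rewrite -th2; ring.
  have -> : m%:R * (3 / 2 * (X * th ^+ 2)) = 3 / 2 * (m%:R * (th ^+ 2 * X)).
    by ring.
  lra.
rewrite mul1r.
have low j : j \in D :\ r -> ((maxn (moved p) 1).+1 <= moved (tperm r j * p)%g)%N.
  rewrite !inE => /andP[jr jD].
  have pjr : p j != r by rewrite -pr (inj_eq perm_inj).
  case: (leqP (moved p) 1) => _.
    apply: (@leq_trans #|[set r; j]%SET|); first by rewrite cards2 eq_sym jr.
    apply: subset_leq_card; apply/fintype.subsetP => i; rewrite !inE tE.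
    move=> /orP[]/eqP ->; first by rewrite eqxx.
    by rewrite (negPf jr) eqxx pr eq_sym.
  rewrite /moved (cardsD1 r [set i | (tperm r j * p)%g i != i]%SET).
  rewrite inE tE eqxx pjr add1n ltnS; apply: subset_leq_card.
  apply/fintype.subsetP => i; rewrite !inE tE.
  case: (eqVneq i r) => [->|_ pi]; first by rewrite pr eqxx.
  by case: (eqVneq i j) => [->|//]; rewrite pr eq_sym.
rewrite {1 3}/wein_bound; case: eqP => [l0|/eqP l0].
  have := bound 2%N; rewrite l0 max0n in low => /(_ low) S.
  apply: (@le_trans _ _ (1 + 7 * m%:R ^+ 2 / n%:R ^+ 2 +
      n%:R^-1 * (m%:R * (3 / 2 * th ^+ 2)))).
    by rewrite lerD2l ler_wpM2l ?invr_ge0 ?ler0n.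
  have -> : th ^+ 2 = 9 / n%:R by rewrite -th2 mulfK.
  rewrite Dr -[m.+1%:R]natr1 -addrA lerD2l.
  (* At the identity the sum costs [27 m / (2 n ^ 2)], while passing from [m] to [m + 1] gains
     [(14 m + 7) / n ^ 2]: hence the constant 7. *)
  have -> : 7 * m%:R ^+ 2 / n%:R ^+ 2 + n%:R^-1 * (m%:R * (3 / 2 * (9 / n%:R)))
     = (7 * m%:R ^+ 2 + 27 / 2 * m%:R) / n%:R ^+ 2 :> R by field.
  rewrite ler_pM2r ?invr_gt0 ?exprn_gt0 //.
  have := ler0n R m; set a := m%:R; have := sqr_ge0 a; nra.
have := bound (moved p).+1.
rewrite (maxn_idPl _) ?lt0n // in low => /(_ low) S.
have q0 : 0 < q%:R :> R by rewrite ltr0n (leq_trans _ Dq) // Dr.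
apply: (@le_trans _ _ ((1 + m%:R / (2 * q%:R)) * th ^+ moved p +
    n%:R^-1 * (m%:R * (3 / 2 * th ^+ (moved p).+1)))).
  by rewrite lerD2l ler_wpM2l ?invr_ge0 ?ler0n.
rewrite Dr -[m.+1%:R]natr1 exprS; set X := th ^+ moved p.
have X0 : 0 <= X by rewrite exprn_ge0.
have -> : (1 + m%:R / (2 * q%:R)) * X + n%:R^-1 * (m%:R * (3 / 2 * (th * X))) =
  (1 + m%:R / (2 * q%:R) + 3 / 2 * (m%:R * th) / n%:R) * X by ring.
rewrite ler_wpM2r //.
have -> : 1 + (m%:R + 1) / (2 * q%:R) =
  1 + m%:R / (2 * q%:R) + 1 / (2 * q%:R) :> R by ring.
rewrite lerD2l.
(* What remains is [3 * m * q * th <= n], which follows from [q_n3] and [m <= q]. *)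
rewrite ler_pdivrMr // [leRHS]mulrAC ler_pdivlMr ?mulr_gt0 //.
have : m%:R * th * q%:R <= q%:R * th * q%:R.
  by rewrite ler_wpM2r // ler_wpM2r.
by move: q_n3; rewrite expr2; nra.
Qed.

End SuperSolution.

Section WeingartenBound.
Context (d : measure_display) (T : measurableType d) (R : realType).
Variables (P : probability T R) (n : nat) (U : T -> 'M[R[i]]_n).
Hypothesis U_haar : haar_unitary P U.
Variable J : finType.
Variables (s t : J -> 'I_n).
Hypotheses (s_inj : injective s) (t_inj : injective t).
Variables (q : nat) (th : R).
Hypotheses (th_gt0 : 0 < th) (th2 : th ^+ 2 * n%:R = 9)
  (q_n2 : 14 * q%:R ^+ 2 <= n%:R ^+ 2 :> R)
  (q_n3 : 9 * q%:R ^+ 2 * th <= 3 * n%:R :> R)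
  (th_le1 : (1 < q)%N -> th <= 1).

Local Notation wein := (wein P U s t).

(** Moduli are elements of [R[i]]; taking real parts moves the estimates to [R], where a maximum
    over permutations exists. *)
Lemma Re_norm_le (I : Type) (r : seq I) (Q : pred I) (F : I -> R[i]) (z : R[i]) :
  z = \sum_(i <- r | Q i) F i ->
  complex.Re `|z| <= \sum_(i <- r | Q i) complex.Re `|F i|.
Proof.
move=> ->; rewrite -lecR RRe_real ?normr_real // rmorph_sum /=.
rewrite (le_trans (ler_norm_sum _ _ _)) //.
Qed.

Lemma Re_normM_real (c : R) (z : R[i]) : 0 <= c ->
  complex.Re `|c%:C * z| = c * complex.Re `|z|.
Proof.
move=> c0; rewrite normrM [Num.norm c%:C]ger0_norm ?ler0c //.
by rewrite complex_ReM mul0r subr0.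
Qed.

(** Induction on [#|D|] with a maximum principle at each degree. Subtracting the supersolution
    bounds the excess [h] at any permutation by a sum of excesses of total weight
    [c = (#|D| - 1) / n < 1]; at a maximum this reads [h p0 <= c * h p0], so [h p0] cannot be
    positive. *)
Lemma wein_le (D : {set J}) (p : {perm J}) : (#|D| <= q)%N -> perm_on D p ->
  n%:R ^+ #|D| * complex.Re `|wein D p| <= wein_bound n q th #|D| (moved p).
Proof.
have [m] := ubnP #|D|; elim: m D p => // m IH D p Dm Dq pD.
have [D0|[r rD]] := set_0Vmem D.
  have -> : wein D p = 1.
    rewrite -[RHS](Cexpect_cst P); apply: eq_Cexpect => w.
    by rewrite /monomial D0 !big_set0 mulr1.
  rewrite D0 cards0 expr0 mul1r normr1 /wein_bound.
  rewrite (_ : moved p = 0) ?eqxx; first by rewrite lerDl divr_ge0 ?mulr_ge0 ?exprn_ge0 ?ler0n.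
  apply/eqP; rewrite cards_eq0; apply/eqP/setP => i; rewrite !inE.
  apply/negbTE; rewrite negbK; apply/eqP; apply: (out_perm pD).
  by rewrite D0 inE.
have Dr : #|D| = #|D :\ r|.+1 by rewrite (cardsD1 r) rD.
have n0 : 0 < n%:R :> R.
  rewrite ltr0n lt0n; apply: contraTneq isT => nE.
  by move/eqP: th2; rewrite nE mulr0 eq_sym pnatr_eq0.
pose rho p' : R := n%:R ^+ #|D| * complex.Re `|wein D p'|.
pose h p' : R := rho p' - wein_bound n q th #|D| (moved p').
pose c : R := #|D :\ r|%:R / n%:R.
have c1 : c < 1.
  rewrite ltr_pdivrMr // mul1r ltr_nat.
  have : (#|D :\ r| < q)%N by rewrite -Dr.
  have : 3 * q%:R <= n%:R :> R.
    rewrite -(@ler_pXn2r _ 2) ?nnegrE ?mulr_ge0 ?ler0n // exprMn.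
    by move: q_n2 (sqr_ge0 (q%:R : R)); set a := _ ^+ 2; set b := n%:R ^+ 2; lra.
  rewrite -natrM ler_nat; lia.
have step p' : perm_on D p' ->
    h p' <= n%:R^-1 * \sum_(j in D :\ r) h (tperm r j * p')%g.
  move=> pD'.
  have := wein_bound_supersolution th_gt0 th2 q_n2 q_n3 th_le1 rD Dq pD'.
  suff : rho p' <= (p' r == r)%:R * wein_bound n q th #|D :\ r| (moved p') +
      n%:R^-1 * \sum_(j in D :\ r) rho (tperm r j * p')%g.
    by rewrite /h sumrB mulrBr; lra.
  have rec := wein_recursion U_haar s_inj t_inj rD pD'.
  have E : (n%:R : R)%:C * wein D p' = (p' r == r)%:R * wein (D :\ r) p' +
      \sum_(j in D :\ r) - wein D (tperm r j * p')%g.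
    by rewrite rmorph_nat -rec sumrN addrK.
  have N1 : n%:R * complex.Re `|wein D p'| <=
      (p' r == r)%:R * complex.Re `|wein (D :\ r) p'| +
      \sum_(j in D :\ r) complex.Re `|wein D (tperm r j * p')%g|.
    rewrite -Re_normM_real ?ler0n // E.
    rewrite (le_trans (_ : _ <= complex.Re `|(p' r == r)%:R * wein (D :\ r) p'| +
      complex.Re `|\sum_(j in D :\ r) - wein D (tperm r j * p')%g|)) //.
      by rewrite -complex_ReD -lecR !RRe_real ?ler_normD ?normr_real ?rpredD ?normr_real.
    apply: lerD.
      by case: (p' r == r); rewrite ?mul1r // !mul0r normr0.
    apply: (le_trans (Re_norm_le erefl)).
    by apply: ler_sum => j _; rewrite normrN.
  have X0 : 0 <= n%:R ^+ #|D :\ r| :> R by rewrite exprn_ge0 ?ler0n.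
  have N2 := ler_wpM2l X0 N1.
  have IHr : (p' r == r)%:R * (n%:R ^+ #|D :\ r| *
        complex.Re `|wein (D :\ r) p'|) <=
      (p' r == r)%:R * wein_bound n q th #|D :\ r| (moved p').
    case: (eqVneq (p' r) r) => [pr|]; last by rewrite !mul0r.
    rewrite !mul1r; apply: IH; [by rewrite -ltnS -Dr|by rewrite ltnW // -Dr|].
    apply/fintype.subsetP => i; rewrite !inE => pi.
    rewrite (fintype.subsetP pD') ?inE // andbT.
    by apply: contraNneq pi => ->; rewrite pr.
  have rhoE p1 : rho p1 = n%:R ^+ #|D :\ r| * (n%:R * complex.Re `|wein D p1|).
    by rewrite /rho Dr exprSr -mulrA.
  have sumE : n%:R^-1 * \sum_(j in D :\ r) rho (tperm r j * p')%g =
      n%:R ^+ #|D :\ r| *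
      \sum_(j in D :\ r) complex.Re `|wein D (tperm r j * p')%g|.
    rewrite !mulr_sumr; apply: eq_bigr => j _.
    by rewrite rhoE mulrCA mulKf ?gt_eqF.
  rewrite sumE rhoE; apply: (le_trans N2).
  by rewrite mulrDr mulrCA lerD2r.
have [p0 p0D p0max] : exists2 p0, perm_on D p0 &
    forall p', perm_on D p' -> h p' <= h p0.
  have D1 : perm_on D (1%g : {perm J}) by exact: perm_on1.
  case: (@Order.TotalTheory.arg_maxP _ _ _ (1%g : {perm J}) (perm_on D) h D1).
  by move=> p0 p0D p0m; exists p0 => // p' /p0m.
suff h0 : h p0 <= 0 by rewrite -subr_le0; exact: le_trans (p0max p pD) h0.
have := step p0 p0D.
have S : \sum_(j in D :\ r) h (tperm r j * p0)%g <= #|D :\ r|%:R * h p0.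
  rewrite mulr_natl -sumr_const; apply: ler_sum => j jD; apply: p0max.
  apply/fintype.subsetP => i; rewrite inE permM; move: jD; rewrite !inE => /andP[_ jD].
  case: tpermP => [-> //|-> //|_ _ pi].
  by rewrite (fintype.subsetP p0D) ?inE.
have := ler_wpM2l (ltW (eqbRL (invr_gt0 _) n0)) S.
rewrite mulrA (mulrC _ #|_|%:R) -/c => S' st.
rewrite leNgt; apply/negP => hp.
have : c * h p0 < h p0 by rewrite gtr_pMl.
lra.
Qed.
End WeingartenBound.

(** * Products of independent variables *)

Section Independence.
Import HBNNSimple.
Context (d : measure_display) (T : measurableType d) (R : realType).
Variable P : probability T R.
Local Open Scope classical_set_scope.

(** The measure with density [F], pushed forward by [Y], is [K] times the law of [Y]. *)
Lemma ge0_integral_decouple (Y F : T -> R) (K : R) (h : R -> R) :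
  measurable_fun setT Y -> measurable_fun setT F -> (forall t, 0 <= F t) ->
  0 <= K ->
  (forall B, measurable B ->
     (\int[P]_t ((\1_B (Y t) : R) * F t)%:E = P (Y @^-1` B) * K%:E)%E) ->
  measurable_fun setT h -> (forall r, 0 <= h r) ->
  (\int[P]_t (h (Y t) * F t)%:E = (\int[P]_t (h (Y t))%:E) * K%:E)%E.
Proof.
move=> mY mF F0 K0 HB mh h0.
pose Y' : {mfun T >-> R} := HB.pack Y (isMeasurableFun.Build _ _ _ _ _ mY).
rewrite (@ge0_integral_density _ _ _ P (mscale (NngNum K0) (distribution P Y')) Y F h) //.
  rewrite ge0_integral_mscale //; try exact/measurable_EFinP;
    try by move=> r _; rewrite lee_fin.
  rewrite muleC; congr (_ * _)%E.
  by rewrite ge0_integral_distribution //; exact/measurable_EFinP.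
by move=> B mB; rewrite HB // /mscale /= muleC.
Qed.

Lemma integral_indic_comp (Y : T -> R) (B : set R) :
  measurable_fun setT Y -> measurable B ->
  (\int[P]_t (\1_B (Y t) : R)%:E = P (Y @^-1` B))%E.
Proof.
move=> mY mB; rewrite -[in RHS](setIT (Y @^-1` B)) -integral_indic //.
by rewrite -[X in measurable X]setTI; exact: mY.
Qed.

Lemma prod_EFin (I : Type) (r : seq I) (Q : pred I) (f : I -> R) :
  (\prod_(i <- r | Q i) (f i)%:E = (\prod_(i <- r | Q i) f i)%:E)%E.
Proof. by elim/big_rec2: _ => // i y1 y2 _ ->. Qed.

(** Induction on the number of indices at which [g i] is not an indicator. With indicators only,
    this is the definition of independence; replacing one [g j] by an indicator gives exactly the
    hypothesis of [ge0_integral_decouple]. *)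
Lemma ge0_independent_prod (I : finType) (Y : I -> T -> R) :
  (forall i, measurable_fun setT (Y i)) ->
  (forall B : I -> set R, (forall i, measurable (B i)) ->
    P [set t | forall i, B i (Y i t)] = (\prod_i P (Y i @^-1` B i))%E) ->
  forall g : I -> R -> R, (forall i, measurable_fun setT (g i)) ->
  (forall i r, 0 <= g i r) ->
  (forall i, \int[P]_t (g i (Y i t))%:E < +oo)%E ->
  (\int[P]_t (\prod_i g i (Y i t))%:E = \prod_i \int[P]_t (g i (Y i t))%:E)%E.
Proof.
move=> mY indep.
suff main m : forall (A : {set I}) (g : I -> R -> R), #|A| = m ->
    (forall i, measurable_fun setT (g i)) ->
    (forall i r, 0 <= g i r) ->
    (forall i, \int[P]_t (g i (Y i t))%:E < +oo)%E ->
    (forall i, i \notin A -> exists2 B, measurable B & g i = \1_B) ->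
    (\int[P]_t (\prod_i g i (Y i t))%:E =
     \prod_i \int[P]_t (g i (Y i t))%:E)%E.
  move=> g mg g0 gfin; apply: (main _ [set: I]%SET) => // i.
  by rewrite inE.
elim: m => [|m IH] A g Am mg g0 gfin gB.
  have AN i : i \notin A.
    by move/eqP: Am; rewrite cards_eq0 => /eqP ->; rewrite inE.
  pose B i := s2val (cid2 (gB i (AN i))).
  have mB i : measurable (B i) by rewrite /B; case: cid2.
  have gE i : g i = \1_(B i) by rewrite /B; case: cid2.
  have mYB i : measurable (Y i @^-1` B i).
    by rewrite -[X in measurable X]setTI; exact: mY.
  have -> : (\prod_i \int[P]_t (g i (Y i t))%:E = \prod_i P (Y i @^-1` B i))%E.
    apply: eq_bigr => i _; rewrite -integral_indic_comp //.
    by apply: eq_integral => t _; rewrite gE.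
  rewrite -indep //.
  have -> : [set t | forall i, B i (Y i t)] = \bigcap_(i in setT) (Y i @^-1` B i).
    by apply/seteqP; split => [t h i _|t h i]; [exact: h|exact: (h i Logic.I)].
  have mcap : measurable (\bigcap_(i in [set: I]) (Y i @^-1` B i)).
    by apply: fin_bigcap_measurable => //; exact: finite_finset.
  rewrite -[RHS](congr1 P (setIT _)) -integral_indic //.
  apply: eq_integral => t _; congr _%:E.
  under eq_bigr do rewrite gE.
  rewrite indicE; case: (boolP (t \in _)) => [/set_mem h|/negP h].
    by rewrite big1 // => i _; rewrite indicE mem_set //; exact: h.
  have [i iN] : exists i, ~ B i (Y i t).
    apply: contrapT => /forallNP h'; apply: h; apply/mem_set => i _.
    exact: contrapT (h' i).
  by rewrite (bigD1 i) //= indicE memNset // mul0r.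
have [j jA] : exists j, j \in A by apply/set0Pn; rewrite -cards_eq0 Am.
have Am' : #|A :\ j| = m by apply/eqP; rewrite -eqSS -Am (cardsD1 j A) jA.
have finE i : (\int[P]_t (g i (Y i t))%:E)%E =
    (fine (\int[P]_t (g i (Y i t))%:E))%:E.
  rewrite fineK // ge0_fin_numE // integral_ge0 // => t _.
  by rewrite lee_fin.
pose F t := \prod_(i | i != j) g i (Y i t).
pose K := \prod_(i | i != j) fine (\int[P]_t (g i (Y i t))%:E).
have KE : (\prod_(i | i != j) \int[P]_t (g i (Y i t))%:E = K%:E)%E.
  by rewrite /K -prod_EFin; apply: eq_bigr => i _; exact: finE.
rewrite (bigD1 j) //= KE.
have -> : (fun t => (\prod_i g i (Y i t))%:E) =
    (fun t => (g j (Y j t) * F t)%:E).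
  by apply/funext => t; rewrite (bigD1 j).
apply: (@ge0_integral_decouple (Y j) F K (g j)) => //.
- have -> : F = fun t => \prod_i (if i != j then g i (Y i t) else 1).
    by apply/funext => t; rewrite /F big_mkcond.
  apply: measurable_prod => i _; case: (i != j) => //; exact: measurableT_comp.
- by move=> t; rewrite /F prodr_ge0.
- rewrite /K prodr_ge0 // => i _; apply: fine_ge0; apply: integral_ge0 => t _.
  by rewrite lee_fin.
- move=> B mB; pose g' i := if i == j then \1_B else g i.
  have g'E i : i != j -> g' i = g i by rewrite /g' => /negPf ->.
  have g'j : g' j = \1_B by rewrite /g' eqxx.
  have mYB : measurable (Y j @^-1` B) by rewrite -[X in measurable X]setTI; exact: mY.
  have PB : (\int[P]_t (g' j (Y j t))%:E)%E = P (Y j @^-1` B).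
    rewrite -integral_indic_comp //.
    by apply: eq_integral => t _; rewrite g'j.
  have := IH (A :\ j) g' Am'; rewrite (bigD1 j) //= PB.
  have -> : (\prod_(i | i != j) \int[P]_t (g' i (Y i t))%:E = K%:E)%E.
    by rewrite -KE; apply: eq_bigr => i ij; rewrite g'E.
  have -> : (fun t => (\prod_i g' i (Y i t))%:E) =
      (fun t => (\1_B (Y j t) * F t)%:E).
    apply/funext => t; rewrite (bigD1 j) //= g'j; congr (_ * _)%:E.
    by apply: eq_bigr => i ij; rewrite g'E.
  apply.
  + move=> i; rewrite /g'; case: eqP => // _; exact: measurable_indic.
  + by move=> i r; rewrite /g'; case: eqP => // _; exact: indic_ge0.
  + move=> i; case: (eqVneq i j) => [->|ij].
      by rewrite PB (le_lt_trans (probability_le1 P _)) // ltry.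
    by rewrite g'E.
  + move=> i iA; case: (eqVneq i j) => [->|ij]; first by exists B; rewrite ?g'j.
    by rewrite g'E //; apply: gB; apply: contra iA => iA; rewrite !inE ij.
Qed.

Lemma ge0_independent_expectation (I : finType) (Y : I -> T -> R) :
  (forall i, measurable_fun setT (Y i)) -> (forall i t, 0 <= Y i t) ->
  (forall B : I -> set R, (forall i, measurable (B i)) ->
    P [set t | forall i, B i (Y i t)] = (\prod_i P (Y i @^-1` B i))%E) ->
  (forall i, \int[P]_t (Y i t)%:E < +oo)%E ->
  (\int[P]_t (\prod_i Y i t)%:E = \prod_i \int[P]_t (Y i t)%:E)%E.
Proof.
move=> mY Y0 indep Yfin.
have YE i : (\int[P]_t (`|Y i t|)%:E = \int[P]_t (Y i t)%:E)%E.
  by apply: eq_integral => t _; rewrite ger0_norm.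
have := @ge0_independent_prod I Y mY indep (fun _ r => `|r|)
  (fun i => @measurable_realfun.normr_measurable R setT) (fun _ r => normr_ge0 r).
move=> H; transitivity (\prod_i \int[P]_t (`|Y i t|)%:E)%E; last first.
  by apply: eq_bigr => i _; rewrite YE.
rewrite -H => [|i]; last by rewrite YE.
by apply: eq_integral => t _; congr _%:E; apply: eq_bigr => i _; rewrite ger0_norm.
Qed.

Lemma integrable_ge0 (u : T -> R) : measurable_fun setT u ->
  (forall t, 0 <= u t) -> (\int[P]_t (u t)%:E < +oo)%E ->
  P.-integrable setT (EFin \o u).
Proof.
move=> mu u0 ufin; apply/integrableP; split; first exact/measurable_EFinP.
under eq_integral do rewrite /= ger0_norm //.
exact: ufin.
Qed.

Lemma cintegrable_real (u : T -> R) : P.-integrable setT (EFin \o u) ->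
  cintegrable P (fun t => (u t)%:C).
Proof. by move=> iu; split => //=; exact: finite_measure_integrable_cst. Qed.

Lemma Cexpect_real (u : T -> R) :
  Cexpect P (fun t => (u t)%:C) = (fine (\int[P]_t (u t)%:E))%:C.
Proof.
by apply: eq_complexP => //=; rewrite ?(expectation_cst P) // unlock.
Qed.

(** The order follows the powers of the imaginary unit in [quarterE]: a complex variable becomes a
    combination of four nonnegative ones. *)
Definition quarter (k : 'I_4) (z : R[i]) : R :=
  nth 0 [:: Num.max (complex.Re z) 0; Num.max (complex.Im z) 0;
            Num.max (- complex.Re z) 0; Num.max (- complex.Im z) 0] k.

Lemma quarterE z : z = \sum_(k < 4) 'i%C ^+ k * (quarter k z)%:C.
Proof.
rewrite !big_ord_recl big_ord0 /quarter /= /bump /=.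
rewrite expr0 expr1 [_ ^+ 3]exprS sqr_i.
have mx (r : R) : r = Num.max r 0 - Num.max (- r) 0.
  case: (lerP 0 r) => h.
    have /max_idPr -> : - r <= 0 by rewrite oppr_le0.
    by rewrite subr0.
  have /max_idPl -> : 0 <= - r by rewrite oppr_ge0 ltW.
  by rewrite sub0r opprK.
apply: eq_complexP; rewrite !(complex_ReD, complex_ImD, complex_ReM, complex_ImM) /=.
  by rewrite [LHS]mx; ring.
by rewrite [LHS]mx; ring.
Qed.

Lemma quarter_ge0 k z : 0 <= quarter k z.
Proof.
rewrite /quarter; case: k => -[|[|[|[|//]]]] ? /=;
by rewrite le_max lexx orbT.
Qed.

Lemma measurable_quarter (d' : measure_display) (T' : measurableType d')
  (f : T' -> R[i]) k :
  cmeasurable f -> measurable_fun setT (fun t => quarter k (f t)).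
Proof.
move=> [m1 m2]; have mN (u : T' -> R) : measurable_fun setT u ->
  measurable_fun setT (fun t => - u t) by exact: measurableT_comp.
rewrite /quarter; case: k => -[|[|[|[|//]]]] ? /=;
  by apply: measurable_maxr => //; exact: mN.
Qed.

Lemma integral_quarter_lty (f : T -> R[i]) k : cintegrable P f ->
  (\int[P]_t (quarter k (f t))%:E < +oo)%E.
Proof.
move=> [i1 i2].
have mf : cmeasurable f.
  split; apply/measurable_EFinP; [exact: (measurable_int _ i1)|exact: (measurable_int _ i2)].
have mq := measurable_quarter k mf.
have le (u : T -> R) : P.-integrable setT (EFin \o u) ->
    (forall t, quarter k (f t) <= `|u t|) ->
    (\int[P]_t (quarter k (f t))%:E < +oo)%E.
  move=> iu le; have /integrableP[_] := iu; apply: le_lt_trans.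
  apply: ge0_le_integral => //.
  - by move=> t _; rewrite lee_fin quarter_ge0.
  - exact/measurable_EFinP.
  - by apply: measurableT_comp => //; exact: (measurable_int _ iu).
  - by move=> t _; rewrite lee_fin.
have mle (r : R) : Num.max r 0 <= `|r| by rewrite ge_max ler_norm normr_ge0.
have mle' (r : R) : Num.max (- r) 0 <= `|r| by rewrite -normrN.
case: k mq le => -[|[|[|[|//]]]] ? mq le; rewrite /quarter /= in le *.
- by apply: (le _ i1) => t.
- by apply: (le _ i2) => t.
- by apply: (le _ i1) => t.
- by apply: (le _ i2) => t.
Qed.

(** Each factor is split into its four quarters and the product is distributed; for every choice of
    quarters the nonnegative product rule gives both the value and the integrability. *)
Lemma independent_Cexpect_prod (I : finType) (X : I -> T -> Cplx R)
    (f : I -> g_sigma_algebraType (@open (Cplx R)) -> R[i]) :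
  (forall i, random_element (X i)) -> independent_family P X ->
  (forall i, cmeasurable (f i)) ->
  (forall i, cintegrable P (fun t => f i (X i t))) ->
  cintegrable P (fun t => \prod_i f i (X i t)) /\
  Cexpect P (fun t => \prod_i f i (X i t)) =
  \prod_i Cexpect P (fun t => f i (X i t)).
Proof.
move=> mX iX mf intf.
have mq i k : measurable_fun setT (fun z => quarter k (f i z)).
  exact: measurable_quarter.
have mXq i k : measurable_fun setT (fun t => quarter k (f i (X i t))).
  exact: (@random_element_measurable_comp R d T (Cplx R) (X i)
    (fun z => quarter k (f i z)) (mX i) (mq i k)).
have q0 i k t : 0 <= quarter k (f i (X i t)) by exact: quarter_ge0.
have qfin i k := integral_quarter_lty k (intf i).
have E (phi : {ffun I -> 'I_4}) :
    (\int[P]_t (\prod_i quarter (phi i) (f i (X i t)))%:E =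
     \prod_i \int[P]_t (quarter (phi i) (f i (X i t)))%:E)%E.
  apply: (@ge0_independent_expectation I
    (fun i t => quarter (phi i) (f i (X i t)))) => // B mB.
  apply: (iX (fun i => [set z | B i (quarter (phi i) (f i z))])) => i.
  by have := mq i (phi i) measurableT (B i) (mB i); rewrite setTI.
have finE i k : (\int[P]_t (quarter k (f i (X i t)))%:E =
    (fine (\int[P]_t (quarter k (f i (X i t)))%:E))%:E)%E.
  by rewrite fineK // ge0_fin_numE // integral_ge0 // => t _; rewrite lee_fin.
have fE t : \prod_i f i (X i t) = \sum_(phi : {ffun I -> 'I_4})
    (\prod_i 'i%C ^+ phi i) * (\prod_i quarter (phi i) (f i (X i t)))%:C.
  under eq_bigr do rewrite [f _ _]quarterE.
  rewrite bigA_distr_bigA; apply: eq_bigr => phi _.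
  by rewrite big_split rmorph_prod.
have iprod (phi : {ffun I -> 'I_4}) :
    cintegrable P (fun t => (\prod_i quarter (phi i) (f i (X i t)))%:C).
  apply: cintegrable_real; apply: integrable_ge0.
  - by apply: measurable_prod => i _.
  - by move=> t; apply: prodr_ge0 => i _.
  by rewrite E; under eq_bigr do rewrite finE; rewrite prod_EFin ltry.
split.
  under [X in cintegrable P X]funext do rewrite fE.
  by apply: cintegrable_sum => phi _; exact: cintegrableZ.
under [X in Cexpect P X]funext do rewrite fE.
rewrite Cexpect_sum => [|phi _]; last exact: cintegrableZ.
have fiE i : Cexpect P (fun t => f i (X i t)) =
    \sum_(k < 4) 'i%C ^+ k * (fine (\int[P]_t (quarter k (f i (X i t)))%:E))%:C.
  under [X in Cexpect P X]funext do rewrite [f _ _]quarterE.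
  have iq k : cintegrable P (fun t => (quarter k (f i (X i t)))%:C).
    by apply: cintegrable_real; exact: integrable_ge0.
  rewrite Cexpect_sum => [|k _]; last exact: cintegrableZ.
  by apply: eq_bigr => k _; rewrite CexpectZ // Cexpect_real.
under [RHS]eq_bigr do rewrite fiE.
rewrite bigA_distr_bigA; apply: eq_bigr => phi _.
rewrite CexpectZ // big_split /= Cexpect_real E -rmorph_prod /=.
congr (_ * _%:C).
by under eq_bigr do rewrite finE; rewrite prod_EFin.
Qed.

End Independence.

(** * Gaussian moments *)

Section GaussianHalfLine.
Variables (R : realType) (gam : R).
Hypothesis gam_gt0 : 0 < gam.
Local Notation mu := (@lebesgue_measure R).
Local Open Scope classical_set_scope.

Definition bell (j : nat) (x : R) : R := x ^+ j * expR (- (gam * x ^+ 2)).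

Lemma is_derive_bell j x :
  is_derive x (1 : R) (bell j.+1)
    (j.+1%:R * bell j x - 2 * gam * bell j.+2 x).
Proof.
have e : is_derive x (1 : R) (fun x : R => - (gam * x ^+ 2)) (- (2 * gam * x)).
  by apply: is_derive_eq; rewrite /GRing.scale /=; ring.
have e2 : is_derive x (1 : R) (fun x : R => expR (- (gam * x ^+ 2)))
    (expR (- (gam * x ^+ 2)) * - (2 * gam * x)).
  exact: (is_derive1_comp (f := expR) (g := fun x : R => - (gam * x ^+ 2))).
have e1 : is_derive x (1 : R) (fun x : R => x ^+ j.+1) (j.+1%:R * x ^+ j).
  apply: DeriveDef; first exact: exprn_derivable.
  by rewrite exp_derive /GRing.scale /= mulr1.
apply: (is_derive_eq (is_deriveM (f := fun x : R => x ^+ j.+1) e1 e2)).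
rewrite /bell /GRing.scale /= !exprS; ring.
Qed.

Lemma continuous_bell j : continuous (bell j).
Proof.
case: j => [|j] x; apply/differentiable_continuous/derivable1_diffP; last first.
  by case: (is_derive_bell j x).
rewrite /bell; under eq_fun do rewrite expr0 mul1r.
have e : is_derive x (1 : R) (fun x : R => - (gam * x ^+ 2)) (- (2 * gam * x)).
  by apply: is_derive_eq; rewrite /GRing.scale /=; ring.
by case: (is_derive1_comp (f := expR) (g := fun x : R => - (gam * x ^+ 2)) _ e).
Qed.

Lemma bell_ge0 j x : 0 <= x -> 0 <= bell j x.
Proof. by move=> x0; rewrite mulr_ge0 ?exprn_ge0 ?expR_ge0. Qed.

(** One term of the exponential series, exp(u) >= u^(j+1) / (j+1)! at u = gam x^2, beats x^j and
    leaves [C / x]. *)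
Lemma cvg_bell j : bell j n%:R @[n --> \oo] --> (0 : R).
Proof.
pose C := j.+1`!%:R / gam ^+ j.+1.
have C0 : 0 < C by rewrite divr_gt0 ?exprn_gt0 ?ltr0n ?fact_gt0.
have bnd n : bell j n.+1%:R <= C * n.+1%:R^-1.
  have x0 : 0 < n.+1%:R :> R by rewrite ltr0n.
  have gx0 : 0 <= gam * n.+1%:R ^+ 2 by rewrite mulr_ge0 ?exprn_ge0 // ltW.
  have h := expR_ge1Dxn j gx0.
  have {}h : (gam * n.+1%:R ^+ 2) ^+ j.+1 / j.+1`!%:R <= expR (gam * n.+1%:R ^+ 2).
    by apply: le_trans h; rewrite lerDr.
  rewrite /bell expRN ler_pdivrMr ?expR_gt0 //.
  apply: (@le_trans _ _ (C / n.+1%:R *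
      ((gam * n.+1%:R ^+ 2) ^+ j.+1 / j.+1`!%:R))); last first.
    by rewrite ler_wpM2l // divr_ge0 // ltW.
  have -> : C / n.+1%:R * ((gam * n.+1%:R ^+ 2) ^+ j.+1 / j.+1`!%:R) =
      n.+1%:R ^+ (j + j.+1).
    have f0 : j.+1`!%:R != 0 :> R by rewrite pnatr_eq0 -lt0n fact_gt0.
    rewrite /C exprMn -exprM mul2n -addnn addSn (exprS _ (j + j.+1)); field.
    by rewrite f0 expf_neq0 ?gt_eqF //= !gt_eqF.
  by rewrite ler_weXn2l ?leq_addr // ler1n.
rewrite -(@cvg_shiftS R (fun n => bell j n%:R)).
apply: (@squeeze_cvgr _ _ _ _ (fun=> 0) (fun n => C * harmonic n)).
- by near=> n; rewrite bnd bell_ge0.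
- exact: cvg_cst.
- by rewrite -[X in _ --> X](mulr0 C); apply: cvgMr; exact: cvg_harmonic.
Unshelve. all: by end_near. Qed.

Lemma integrable_bell j (b : R) : mu.-integrable `[0, b] (EFin \o bell j).
Proof.
apply: continuous_compact_integrable; first exact: segment_compact.
by apply: continuous_subspaceT => x; exact: continuous_bell.
Qed.

Lemma integrable_bell_fin j (b : R) :
  (\int[mu]_(x in `[0%R, b]) (bell j x)%:E)%E \is a fin_num.
Proof. by apply: integrable_fin_num => //; exact: integrable_bell. Qed.

Lemma integral_bell_by_parts j (b : R) : 0 < b ->
  ((2 * gam)%:E * \int[mu]_(x in `[0%R, b]) (bell j.+2 x)%:E + (bell j.+1 b)%:E =
   j.+1%:R%:E * \int[mu]_(x in `[0%R, b]) (bell j x)%:E)%E.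
Proof.
move=> b0.
have ib k := integrable_bell k b.
pose f x := j.+1%:R * bell j x - 2 * gam * bell j.+2 x.
have fE : (bell j.+1)^`() =1 f.
  by move=> x; rewrite derive1E; have [] := is_derive_bell j x.
have cf : {within `[0, b], continuous f}.
  apply: continuous_subspaceT => x.
  apply: (@cvgB _ R^o); apply: (@cvgMr R); exact: continuous_bell.
have dF : derivable_oo_LRcontinuous (bell j.+1) 0 b.
  split; first by move=> x _; have [] := is_derive_bell j x.
    by apply: cvg_at_right_filter; exact: continuous_bell.
  by apply: cvg_at_left_filter; exact: continuous_bell.
have FTC := @continuous_FTC2 R f (bell j.+1) 0 b b0 cf dF (fun x _ => fE x).
have fin k := integrable_bell_fin k b.
have Z k (c : R) : (\int[mu]_(x in `[0%R, b]) (c * bell k x)%:E =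
    c%:E * \int[mu]_(x in `[0%R, b]) (bell k x)%:E)%E.
  under eq_integral do rewrite EFinM.
  by rewrite integralZl //; exact: ib.
move: FTC; rewrite {1}/f.
have iZ k (c : R) : mu.-integrable `[0, b] (fun x => (c * bell k x)%:E).
  exact: (integrableZl _ c (ib k)).
under eq_integral do rewrite EFinB.
rewrite integralB //; try exact: iZ.
rewrite !Z [bell j.+1 0]/bell exprS mul0r mul0r sube0.
move: (fin j) (fin j.+2).
case: (integral _ _ _) => // u; case: (integral _ _ _) => // v _ _.
rewrite -!EFinM -EFinB => -[<-]; rewrite -EFinD; congr _%:E; ring.
Qed.

Definition bell_integral j : \bar R := (\int[mu]_(x in `[0%R, +oo[) (bell j x)%:E)%E.

Lemma cvg_bell_integral j :
  (\int[mu]_(x in `[0%R, n%:R]) (bell j x)%:E @[n --> \oo] --> bell_integral j)%E.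
Proof.
have := @ge0_cvgn_integral R mu (fun x => `|bell j x|) (fun=> normr_ge0 _).
have mb : measurable_fun setT (fun x => `|bell j x|).
  apply: measurableT_comp => //; apply: continuous_measurable_fun.
  exact: continuous_bell.
have eD (D : set R) : D `<=` [set x | 0 <= x] ->
    (\int[mu]_(x in D) (bell j x)%:E = \int[mu]_(x in D) (`|bell j x|)%:E)%E.
  move=> D0; apply: eq_integral => x /set_mem/D0 /= x0.
  by rewrite ger0_norm ?bell_ge0.
move=> /(_ mb) L.
have -> : (fun n => \int[mu]_(x in `[0%R, n%:R]) (bell j x)%:E)%E =
    (fun n => \int[mu]_(x in `[0%R, n%:R]) (`|bell j x|)%:E)%E.
  by apply/funext => n; apply: eD => x /=; rewrite in_itv /= => /andP[].
rewrite /bell_integral eD //.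
by move=> x /=; rewrite in_itv /= andbT.
Qed.

(** Limit of the integration by parts on [[0, n]], whose boundary term vanishes. Propagating a
    finite value [c] yields the finiteness of the higher integrals together with their values. *)
Lemma bell_integral_rec j (c : R) : bell_integral j = c%:E ->
  bell_integral j.+2 = ((j.+1%:R * c) / (2 * gam))%:E.
Proof.
move=> jc; have g0 : 2 * gam != 0 by rewrite mulf_neq0 ?gt_eqF.
have L1 := @cvg_bell_integral j.+2.
have L2 := @cvg_bell_integral j; rewrite jc in L2.
have L3 : ((j.+1%:R / (2 * gam))%:E * \int[mu]_(x in `[0%R, n%:R]) (bell j x)%:E
    - ((2 * gam)^-1 * bell j.+1 n%:R)%:E @[n --> \oo] -->
    ((j.+1%:R / (2 * gam))%:E * c%:E - ((2 * gam)^-1 * 0)%:E))%E.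
  apply: cvgeB => //; first by apply: cvgeZl.
  apply: cvg_EFin; first exact: nearW.
  by apply: cvgMr; exact: cvg_bell.
apply: (cvg_unique _ L1) => //.
rewrite mulr0 sube0 -EFinM mulrAC in L3.
apply: cvg_trans L3; apply: near_eq_cvg; near=> n.
have n0 : 0 < n%:R :> R.
  by rewrite ltr0n; near: n; exact: nbhs_infty_gt.
have := integral_bell_by_parts j n0.
have fin := integrable_bell_fin; have := fin j n%:R; have := fin j.+2 n%:R.
case: (\int[mu]_(x in `[0%R, n%:R]) (bell j.+2 x)%:E)%E => // u _.
case: (\int[mu]_(x in `[0%R, n%:R]) (bell j x)%:E)%E => // v _.
rewrite -!EFinM -EFinD -EFinB => -[E]; congr _%:E.
rewrite mulrAC -E; field.
by rewrite gt_eqF.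
Unshelve. all: by end_near. Qed.

End GaussianHalfLine.

Section RealLine.
Variable R : realType.
Local Notation mu := (@lebesgue_measure R).
Local Open Scope classical_set_scope.

Lemma ge0_integral_fold (H : R -> R) : (forall x, 0 <= H x) -> continuous H ->
  (\int[mu]_x (H x)%:E = \int[mu]_(x in `[0%R, +oo[) (H x + H (- x))%:E)%E.
Proof.
move=> H0 cH.
have mH : measurable_fun [set: R] H by exact: continuous_measurable_fun.
have mHN : measurable_fun [set: R] (fun x => H (- x)) by exact: measurableT_comp.
have mpos : measurable [set x : R | 0 <= x]%R by rewrite -set_itvcy.
under [RHS]eq_integral do rewrite EFinD.
rewrite ge0_integralD //; last 4 first.
- by move=> x _; rewrite lee_fin.
- exact/measurable_EFinP/measurable_funTS.
- by move=> x _; rewrite lee_fin.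
- exact/measurable_EFinP/measurable_funTS.
rewrite -(setUv [set x : R | 0 <= x]%R) ge0_integral_setU//= ; last 4 first.
- exact: measurableC.
- by apply/measurable_EFinP; rewrite setUv.
- by move=> x _; rewrite lee_fin.
- exact/disj_setPCl.
rewrite -set_itvcy// setCitvr; congr (_ + _)%E.
rewrite integral_itv_bndo_bndc; last exact/measurable_EFinP/measurable_funTS.
rewrite -{1}oppr0 ge0_integration_by_substitutionNy//.
exact: continuous_subspaceT.
Qed.

Lemma ge0_integral_shift (G : R -> R) (m : R) : (forall x, 0 <= G x) ->
  continuous G -> (\int[mu]_x (G x)%:E = \int[mu]_x (G (x + m))%:E)%E.
Proof.
move=> G0 cG.
have dF (x : R) : is_derive x (1 : R) (fun x : R => x + m) 1.
  by apply: is_derive_eq; rewrite addr0.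
have F'E : (fun x : R => x + m)^`() = cst 1.
  by apply/funext => x; rewrite derive1E; case: (dF x).
rewrite (@increasing_ge0_integration_by_substitutionT R (fun x => x + m)) //.
- by apply: eq_integral => x _; rewrite F'E /= [in LHS]mulr1.
- by move=> x y xy; rewrite ltrD2r.
- by rewrite F'E => x; exact: cvg_cst.
- by rewrite F'E; exact: is_cvg_cst.
- by rewrite F'E; exact: is_cvg_cst.
- exact: cvg_addrr_Ny.
- exact: cvg_addrr.
Qed.

End RealLine.

Section GaussianLaw.
Context (d : measure_display) (T : measurableType d) (R : realType).
Variables (P : probability T R) (X : T -> R) (m s : R).
Hypotheses (mX : measurable_fun setT X) (s_neq0 : s != 0).
Hypothesis X_law : forall A : set R, measurable A ->
  P (X @^-1` A)%classic = normal_prob m s A.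
Local Notation mu := (@lebesgue_measure R).
Local Open Scope classical_set_scope.

Let gam : R := (s ^+ 2 *+ 2)^-1.

(** The line is folded at the mean [m], which leaves integrals over the half-line, where all
    [bell gam j] are nonnegative. *)
Lemma ge0_gaussian_expectation (h : R -> R) : (forall x, 0 <= h x) ->
  continuous h ->
  (\int[P]_t (h (X t))%:E =
   (normal_peak s)%:E * \int[mu]_(y in `[0%R, +oo[)
     ((h (m + y) + h (m - y)) * bell gam 0 y)%:E)%E.
Proof.
move=> h0 ch.
have mh : measurable_fun setT h by exact: continuous_measurable_fun.
pose X' : {mfun T >-> R} := HB.pack X (isMeasurableFun.Build _ _ _ _ _ mX).
transitivity (\int[distribution P X']_r (h r)%:E)%E.
  by rewrite ge0_integral_distribution //; exact/measurable_EFinP.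
rewrite -(@ge0_integral_density _ _ _ mu (distribution P X') idfun
  (normal_pdf m s) h) //; try exact: measurable_id; try exact: measurable_normal_pdf;
  try (by move=> x; exact: normal_pdf_ge0);
  try (move=> B mB; rewrite [RHS]X_law // /normal_prob [RHS]integral_mkcond;
    apply: eq_integral => x _; rewrite patchE indicE;
    by case: (x \in B); rewrite ?mul1r ?mul0r).
rewrite /=.
have pdfE y : normal_pdf m s (y + m) = normal_peak s * bell gam 0 y.
  rewrite normal_pdfE // /normal_fun addrK /bell expr0 mul1r.
  by congr (_ * expR _); rewrite /gam; ring.
have c0 : continuous (fun x => h x * normal_pdf m s x).
  move=> x; apply: (@cvgM R); first exact: ch.
  exact: continuous_normal_pdf.
rewrite (@ge0_integral_shift _ _ m) //; last first.
  by move=> x; rewrite mulr_ge0 ?normal_pdf_ge0.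
rewrite ge0_integral_fold; last 2 first.
- by move=> x; rewrite mulr_ge0 ?normal_pdf_ge0.
- move=> x; apply: (continuous_comp (f := fun x : R => x + m)
    (g := fun x => h x * normal_pdf m s x)); last exact: c0.
  by apply: (@cvgD _ R^o); [exact: cvg_id|exact: cvg_cst].
have p0 : 0 <= normal_peak s by exact: normal_peak_ge0.
have mb : measurable_fun setT (bell gam 0).
  by apply: continuous_measurable_fun; exact: continuous_bell.
rewrite -ge0_integralZl_EFin //; last 2 first.
- move=> y _; rewrite lee_fin mulr_ge0 ?addr_ge0 //.
  by rewrite mulr_ge0 ?expr0 ?expR_ge0.
- apply/measurable_EFinP/measurable_funTS/measurable_funM => //.
  apply: measurable_funD; apply: measurableT_comp => //.
    by apply: measurable_funD.
  by apply: measurable_funB.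
apply: eq_integral => y _; rewrite -EFinM !pdfE; congr _%:E.
have -> : bell gam 0 (- y) = bell gam 0 y by rewrite /bell !expr0 sqrrN.
rewrite (addrC m y) (addrC m (- y)); ring.
Qed.

Let gam_gt0 : 0 < gam.
Proof. by rewrite invr_gt0 mulrn_wgt0 // exprn_even_gt0. Qed.

Let integralZ2 j : (\int[mu]_(y in `[0%R, +oo[) (2 * bell gam j y)%:E =
  2%:E * bell_integral gam j)%E.
Proof.
under eq_integral do rewrite EFinM.
rewrite ge0_integralZl_EFin //.
- by move=> y /=; rewrite in_itv /= andbT => y0; rewrite lee_fin bell_ge0.
- apply/measurable_EFinP/measurable_funTS.
  by apply: continuous_measurable_fun; exact: continuous_bell.
Qed.

(** The total mass 1 of the law of [X], that is [h = 1], determines the Gaussian integral; it cannot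
    be infinite since [normal_peak s] is positive. *)
Let bell_integral0 : bell_integral gam 0 = ((2 * normal_peak s)^-1)%:E.
Proof.
have p0 := normal_peak_gt0 s_neq0.
have := @ge0_gaussian_expectation (fun=> 1) (fun=> ler01) (@cst_continuous R R 1).
rewrite integral_cst //= probability_setT mule1 integralZ2.
have : (0 <= bell_integral gam 0)%E.
  apply: integral_ge0 => y /=; rewrite in_itv /= andbT => y0.
  by rewrite lee_fin bell_ge0.
case: (bell_integral gam 0) => [c _||] //.
  rewrite -!EFinM => /(congr1 fine) /= E; congr _%:E; apply: (mulfI (lt0r_neq0 p0)).
  apply: (mulfI (_ : 2 != 0 :> R)); first by rewrite pnatr_eq0.
  by rewrite mulrCA -E mulrA mulfV // mulf_neq0 ?pnatr_eq0 ?gt_eqF.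
by move=> _; rewrite !gt0_muley ?lte_fin.
Qed.

Let bell_integral_even j : bell_integral gam j.*2 =
  ((2 * normal_peak s)^-1 * (s ^+ j.*2 * (j.*2)`!%:R / (2 ^+ j * j`!%:R)))%:E.
Proof.
have p0 := normal_peak_gt0 s_neq0.
elim: j => [|j IH].
  by rewrite double0 bell_integral0 !expr0 !fact0 !mulr1n mul1r divr1 mulr1.
rewrite doubleS (bell_integral_rec gam_gt0 IH); congr _%:E.
have f0 : j`!%:R != 0 :> R by rewrite pnatr_eq0 -lt0n fact_gt0.
rewrite (factS j.*2.+1) (factS j.*2) (factS j) !natrM !exprS.
have -> : gam = (2 * s ^+ 2)^-1 by rewrite /gam -mulr_natl.
have -> : j.*2.+2%:R = 2 * j.+1%:R :> R by rewrite -doubleS -mul2n natrM.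
field.
by rewrite f0 !expf_neq0 ?pnatr_eq0 ?s_neq0 ?gt_eqF //= ?gt_eqF // addrC natr1.
Qed.

Lemma gaussian_even_moment j :
  (\int[P]_t ((X t - m) ^+ j.*2)%:E =
    (s ^+ j.*2 * (j.*2)`!%:R / (2 ^+ j * j`!%:R))%:E)%E.
Proof.
have p0 := normal_peak_gt0 s_neq0.
rewrite (@ge0_gaussian_expectation (fun x => (x - m) ^+ j.*2)); last 2 first.
- by move=> x; rewrite -muln2 exprM sqr_ge0.
- move=> x; apply: (continuous_comp (f := fun x : R => x - m)
    (g := fun x : R => x ^+ j.*2)); last exact: exprn_continuous.
  by apply: (@cvgB _ R^o); [exact: cvg_id|exact: cvg_cst].
under eq_integral => y _.
  rewrite (_ : _ * _ = 2 * bell gam j.*2 y); last first.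
    have -> : m + y - m = y by ring.
    have -> : m - y - m = - y by ring.
    by rewrite /bell -mul2n !exprM sqrrN expr0; ring.
  over.
rewrite integralZ2 bell_integral_even -!EFinM; congr _%:E.
field.
by rewrite !expf_neq0 ?pnatr_eq0 -?lt0n ?fact_gt0 // gt_eqF.
Qed.

Let measurable_center : measurable_fun setT (fun t => X t - m).
Proof. by apply: measurable_funB. Qed.

Lemma gaussian_integrable_center :
  P.-integrable setT (EFin \o (fun t => X t - m)).
Proof.
have i2 : P.-integrable setT (EFin \o (fun t => 1 + (X t - m) ^+ 2)).
  apply: (@integrableD _ _ _ P setT measurableT (EFin \o cst 1)
    (EFin \o (fun t => (X t - m) ^+ 2))).
    exact: finite_measure_integrable_cst.
  apply/integrableP; split.
    by apply/measurable_EFinP; exact: measurable_funX.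
  under eq_integral do rewrite /= ger0_norm ?sqr_ge0 //.
  by rewrite (gaussian_even_moment 1) ltry.
apply: (le_integrable measurableT _ _ i2); first exact/measurable_EFinP.
move=> t _; rewrite /= lee_fin [leRHS]ger0_norm ?addr_ge0 ?sqr_ge0 //.
have := sqr_ge0 (`|X t - m| - 1); rewrite -(real_normK (num_real (X t - m))); nra.
Qed.

(** The fold formula is for nonnegative functions, so [|x - m|] is added: the functions
    [|x - m| + (x - m)] and [|x - m| - (x - m)] are exchanged by reflection at [m] and have equal
    expectations. *)
Lemma gaussian_mean : (\int[P]_t (X t)%:E = m%:E)%E.
Proof.
have ic := gaussian_integrable_center.
have cN (e : R) : continuous (fun x : R => `|x - m| + e * (x - m)).
  move=> x; have c1 : {for x, continuous (fun x : R => x - m)}.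
    by apply: (@cvgB _ R^o); [exact: cvg_id|exact: cvg_cst].
  apply: (@cvgD _ R^o); last exact: (@cvgMr R).
  apply: (continuous_comp (f := fun x : R => x - m) (g := fun x : R => `|x|)) => //.
  exact: norm_continuous.
have h0 (e : R) : `|e| = 1 -> forall x, 0 <= `|x - m| + e * (x - m).
  move=> e1 x; rewrite -lerBlDr sub0r -[leRHS]mul1r -e1 -normrM -normrN.
  by rewrite ler_norm.
have E : (\int[P]_t (`|X t - m| + 1 * (X t - m))%:E =
    \int[P]_t (`|X t - m| + (-1) * (X t - m))%:E)%E.
  rewrite (@ge0_gaussian_expectation (fun x => `|x - m| + 1 * (x - m))) //;
    last by apply: h0; rewrite normr1.
  rewrite (@ge0_gaussian_expectation (fun x => `|x - m| + (-1) * (x - m))) //;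
    last by apply: h0; rewrite normrN1.
  congr (_ * _)%E; apply: eq_integral => y _; congr (_ * _)%:E.
  have -> : m + y - m = y by ring.
  have -> : m - y - m = - y by ring.
  by rewrite normrN; ring.
have ia : P.-integrable setT (EFin \o (fun t => `|X t - m|)).
  exact: integrable_norm ic.
have iZ (e : R) : P.-integrable setT (EFin \o (fun t => e * (X t - m))).
  exact: (integrableZl _ e ic).
have D (e : R) : (\int[P]_t (`|X t - m| + e * (X t - m))%:E =
    \int[P]_t (`|X t - m|)%:E + e%:E * \int[P]_t (X t - m)%:E)%E.
  under eq_integral do rewrite EFinD.
  rewrite integralD //; last exact: iZ.
  by congr (_ + _)%E; under eq_integral do rewrite EFinM; rewrite integralZl.
rewrite !D in E.
have fa := integrable_fin_num measurableT ia.
have fc := integrable_fin_num measurableT ic.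
have z : (\int[P]_t (X t - m)%:E = 0)%E.
  move: E fa fc; rewrite /=.
  case: (\int[P]_t (X t - m)%:E)%E => // c.
  case: (\int[P]_t (`|X t - m|)%:E)%E => // a.
  rewrite -!EFinM -!EFinD => /(congr1 fine) /= h _ _; congr _%:E; lra.
have -> : (\int[P]_t (X t)%:E = \int[P]_t ((X t - m)%:E + (cst m%:E) t))%E.
  by apply: eq_integral => t _; rewrite /= -EFinD subrK.
rewrite integralD //; last exact: finite_measure_integrable_cst.
by rewrite z add0e integral_cst //= probability_setT mule1.
Qed.

End GaussianLaw.

Section GaussianVariable.
Context (d : measure_display) (T : measurableType d) (R : realType).
Variables (P : probability T R).
Local Open Scope classical_set_scope.

(** A point mass obeys the same moment formula with [s = 0], so the degenerate case can be carried
    along until the variance is known. *)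
Lemma gaussian_law_moments (X : T -> R) : measurable_fun setT X ->
  gaussian_law (fun A => P [set t | A (X t)]) ->
  exists m s : R,
  [/\ P.-integrable setT (EFin \o X), (\int[P]_t (X t)%:E = m%:E)%E,
      forall j, (\int[P]_t ((X t - m) ^+ j.*2)%:E =
        (s ^+ j.*2 * (j.*2)`!%:R / (2 ^+ j * j`!%:R))%:E)%E &
      s != 0 -> forall A : set R, measurable A ->
        P (X @^-1` A) = normal_prob m s A].
Proof.
move=> mX [m [s law]]; exists m, s.
have [s0|s0] := eqVneq s 0; last first.
  have X_law (A : set R) : measurable A -> P (X @^-1` A) = normal_prob m s A.
    by move=> mA; rewrite -[LHS]/(P [set t | A (X t)]) law // (negPf s0).
  split => //.
  - have -> : EFin \o X = (EFin \o (fun t => X t - m)) \+ (EFin \o cst m).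
      by apply/funext => t; rewrite /= -EFinD subrK.
    apply: integrableD => //; last exact: finite_measure_integrable_cst.
    exact: (gaussian_integrable_center mX s0 X_law).
  - exact: (gaussian_mean mX s0 X_law).
  - by move=> j; exact: (gaussian_even_moment mX s0 X_law).
have X_law (A : set R) : measurable A -> P (X @^-1` A) = \d_m A.
  by move=> mA; rewrite -[LHS]/(P [set t | A (X t)]) law // s0 eqxx.
have Xm : {ae P, forall t, X t = m}.
  exists (X @^-1` (~` [set m])); split.
  - by rewrite -[X in measurable X]setTI; apply: mX => //; exact: measurableC.
  - rewrite [LHS]X_law; last exact: measurableC.
    by rewrite diracE memNset //= => /(_ erefl).
  - by move=> t /= Xt h; apply: Xt.
have intE (h : R -> R) : measurable_fun setT (h \o X) ->
    (\int[P]_t (h (X t))%:E = (h m)%:E)%E.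
  move=> mh; rewrite (@ae_eq_integral _ _ _ P setT (cst (h m)%:E)) //.
  - by rewrite integral_cst //= probability_setT mule1.
  - exact/measurable_EFinP.
  - by apply: filterS Xm => t /= -> _.
split => //.
- apply/integrableP; split; first exact/measurable_EFinP.
  rewrite /= (intE (fun x => `|x|)) ?ltry //.
  exact: measurableT_comp.
- exact: (intE id).
- move=> j; rewrite (intE (fun r => (r - m) ^+ j.*2)).
    rewrite subrr s0; case: j => [|j]; last by rewrite doubleS !exprS !mul0r.
    by rewrite !expr0 !fact0 !mulr1n mulr1 divr1.
  by apply: measurable_funX; exact: measurable_funB.
Qed.

Lemma cintegrable_le (f : T -> R[i]) (g : T -> R) : cmeasurable f ->
  P.-integrable setT (EFin \o g) -> (forall t, `|f t| <= (g t)%:C) ->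
  cintegrable P f.
Proof.
move=> [m1 m2] ig fg; split.
  apply: (le_integrable measurableT _ _ ig); first exact/measurable_EFinP.
  move=> t _ /=; rewrite lee_fin (le_trans _ (ler_norm _)) //.
  exact: normr_Re_le.
apply: (le_integrable measurableT _ _ ig); first exact/measurable_EFinP.
move=> t _ /=; rewrite lee_fin (le_trans _ (ler_norm _)) //.
exact: normr_Im_le.
Qed.

(** [gaussian_law] leaves the sign of [s] open; the density sees only its square. *)
Lemma normal_prob_sqr (m s s' : R) (A : set R) : s != 0 -> s' != 0 ->
  s ^+ 2 = s' ^+ 2 -> normal_prob m s A = normal_prob m s' A.
Proof.
move=> s0 s'0 ss'; rewrite /normal_prob; apply: eq_integral => x _.
by rewrite !normal_pdfE // /normal_fun /normal_peak ss'.
Qed.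

(** * Mixed moments of a standard complex Gaussian variable *)

Section Standard.
Variable Z : T -> R[i].
Hypothesis Z_std : std_complex_gaussian P Z.

(** This is the real part of [conjc w * Z t], so that [2 * X w t] is
    [conjc w * Z t + w * conjc (Z t)]. *)
Let X (w : R[i]) t := complex.Re w * complex.Re (Z t) + complex.Im w * complex.Im (Z t).

Let mZ : cmeasurable Z.
Proof. by case: Z_std => -[rZ _] _ _ _; exact: random_element_cmeasurable. Qed.

Let mX w : measurable_fun setT (X w).
Proof. by case: mZ => m1 m2; apply: measurable_funD; exact: measurable_funM. Qed.

Let X_moments w := gaussian_law_moments (mX w)
  (let: And4 (conj _ gZ) _ _ _ := Z_std in gZ (complex.Re w) (complex.Im w)).

Let X1 : X 1 = fun t => complex.Re (Z t).
Proof. by apply/funext => t; rewrite /X /= mul1r mul0r addr0. Qed.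

Let Xi : X 'i%C = fun t => complex.Im (Z t).
Proof. by apply/funext => t; rewrite /X /= mul1r mul0r add0r. Qed.

Let mean_Re : (\int[P]_t (complex.Re (Z t))%:E = 0)%E.
Proof.
have [m [s [iX mean _ _]]] := X_moments 1; rewrite X1 in iX mean.
have [_ E0 _ _] := Z_std; move: E0 => /(congr1 (@complex.Re R)) /=.
by rewrite unlock mean => /= ->.
Qed.

Let mean_Im : (\int[P]_t (complex.Im (Z t))%:E = 0)%E.
Proof.
have [m [s [iX mean _ _]]] := X_moments 'i%C; rewrite Xi in iX mean.
have [_ E0 _ _] := Z_std; move: E0 => /(congr1 (@complex.Im R)) /=.
by rewrite unlock mean => /= ->.
Qed.

Let integrable_ReIm : P.-integrable setT (EFin \o (fun t => complex.Re (Z t))) /\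
  P.-integrable setT (EFin \o (fun t => complex.Im (Z t))).
Proof.
split; first by have [m [s [iX _ _ _]]] := X_moments 1; rewrite X1 in iX.
by have [m [s [iX _ _ _]]] := X_moments 'i%C; rewrite Xi in iX.
Qed.

Let X_centered w : exists s : R,
  (forall j, (\int[P]_t (X w t ^+ j.*2)%:E =
        (s ^+ j.*2 * (j.*2)`!%:R / (2 ^+ j * j`!%:R))%:E)%E) /\
  (s != 0 -> forall A : set R, measurable A ->
        P (X w @^-1` A) = normal_prob 0 s A).
Proof.
have [m [s [iX mean ev law]]] := X_moments w.
suff m0 : m = 0.
  exists s; rewrite m0 in ev law; split=> // j; rewrite -ev.
  by apply: eq_integral => t _; rewrite subr0.
apply/eqP; rewrite -(@eqe R) -mean /X.
have [i1 i2] := integrable_ReIm.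
under eq_integral do rewrite EFinD.
rewrite integralD //; try exact: (integrableZl _ _ i1);
  try exact: (integrableZl _ _ i2).
under eq_integral do rewrite EFinM.
under [X in (_ + X)%E]eq_integral do rewrite EFinM.
by rewrite !integralZl // mean_Re mean_Im !mule0 adde0.
Qed.

Let integrable_even w j : P.-integrable setT (EFin \o (fun t => X w t ^+ j.*2)).
Proof.
have [s [ev _]] := X_centered w.
apply/integrableP; split.
  by apply/measurable_EFinP; exact: measurable_funX.
have X0 t : 0 <= X w t ^+ j.*2 by rewrite -mul2n exprM exprn_ge0 ?sqr_ge0.
under eq_integral do rewrite /= ger0_norm //.
by rewrite ev ltry.
Qed.

Let second_moments : exists a b c : R, forall p q r : R,
  P.-integrable setT (EFin \o (fun t => p * complex.Re (Z t) ^+ 2 +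
    q * complex.Im (Z t) ^+ 2 + r * (complex.Re (Z t) * complex.Im (Z t)))) /\
  (\int[P]_t (p * complex.Re (Z t) ^+ 2 + q * complex.Im (Z t) ^+ 2 +
    r * (complex.Re (Z t) * complex.Im (Z t)))%:E = (p * a + q * b + r * c)%:E)%E.
Proof.
have i1 := integrable_even 1 1; rewrite X1 in i1.
have i2 := integrable_even 'i%C 1; rewrite Xi in i2.
have [m1 m2] := mZ.
have i3 : P.-integrable setT (EFin \o (fun t => complex.Re (Z t) * complex.Im (Z t))).
  apply: (le_integrable measurableT _ _ (integrableD _ i1 i2)) => //.
    by apply/measurable_EFinP; exact: measurable_funM.
  move=> t _; rewrite /= lee_fin [leRHS]ger0_norm ?addr_ge0 ?sqr_ge0 //.
  rewrite normrM; have := sqr_ge0 (`|complex.Re (Z t)| - `|complex.Im (Z t)|).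
  rewrite -(real_normK (num_real (complex.Re (Z t)))).
  rewrite -(real_normK (num_real (complex.Im (Z t)))).
  have := sqr_ge0 (`|complex.Re (Z t)|); have := sqr_ge0 (`|complex.Im (Z t)|); nra.
have f1 := integrable_fin_num measurableT i1.
have f2 := integrable_fin_num measurableT i2.
have f3 := integrable_fin_num measurableT i3.
exists (fine (\int[P]_t (complex.Re (Z t) ^+ 2)%:E)),
  (fine (\int[P]_t (complex.Im (Z t) ^+ 2)%:E)),
  (fine (\int[P]_t (complex.Re (Z t) * complex.Im (Z t))%:E)) => p q r.
have j1 := integrableZl measurableT p i1.
have j2 := integrableZl measurableT q i2.
have j3 := integrableZl measurableT r i3.
have j12 := integrableD measurableT j1 j2.
split; first exact: (integrableD measurableT j12 j3).
under eq_integral do rewrite EFinD EFinD.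
rewrite integralD // integralD //.
under eq_integral do rewrite EFinM.
under [X in (_ + X + _)%E]eq_integral do rewrite EFinM.
under [X in (_ + _ + X)%E]eq_integral do rewrite EFinM.
rewrite !integralZl // !EFinD !EFinM.
by rewrite (fineK f1) (fineK f2) (fineK f3).
Qed.

(** [E |Z| ^ 2 = 1] and [E Z ^ 2 = 0] force the covariance matrix of the real and imaginary parts to
    be half the identity; the variance is then 1/2 in every direction. *)
Let variance_X w : `|w| = 1 -> (\int[P]_t (X w t ^+ 2)%:E = (2^-1)%:E)%E.
Proof.
move=> w1; have [a [b [c E]]] := second_moments.
have [_ _ E1 E2] := Z_std.
have h1 : a + b = 1.
  have := congr1 (@complex.Re R) E1; rewrite /= unlock.
  have [_ ] := E 1 1 0.
  rewrite (_ : (fun t => (1 * _ + 1 * _ + 0 * _)%:E) =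
    (fun t => (complex.Re (`|Z t| ^+ 2))%:E)); last first.
    by apply/funext => t; rewrite -add_Re2_Im2 /= !mul1r mul0r addr0.
  by move=> -> /=; rewrite !mul1r mul0r addr0.
have h2 : a - b = 0.
  have := congr1 (@complex.Re R) E2; rewrite /= unlock.
  have [_ ] := E 1 (-1) 0.
  rewrite (_ : (fun t => (1 * _ + -1 * _ + 0 * _)%:E) =
    (fun t => (complex.Re (Z t ^+ 2))%:E)); last first.
    by apply/funext => t; congr _%:E; rewrite [Z t ^+ 2]expr2 complex_ReM; ring.
  by move=> -> /=; rewrite !mul1r mul0r addr0 mulN1r.
have h3 : 2 * c = 0.
  have := congr1 (@complex.Im R) E2; rewrite /= unlock.
  have [_ ] := E 0 0 2.
  rewrite (_ : (fun t => (0 * _ + 0 * _ + 2 * _)%:E) =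
    (fun t => (complex.Im (Z t ^+ 2))%:E)); last first.
    by apply/funext => t; congr _%:E; rewrite [Z t ^+ 2]expr2 complex_ImM; ring.
  by move=> -> /=; rewrite !mul0r !add0r.
have ww : complex.Re w ^+ 2 + complex.Im w ^+ 2 = 1.
  by apply: (@complexI R); rewrite add_Re2_Im2 w1 expr1n.
have [_ Ew] := E (complex.Re w ^+ 2) (complex.Im w ^+ 2)
  (2 * (complex.Re w * complex.Im w)).
transitivity ((complex.Re w ^+ 2 * a + complex.Im w ^+ 2 * b +
  2 * (complex.Re w * complex.Im w) * c)%:E).
  by rewrite -Ew; apply: eq_integral => t _; congr _%:E; rewrite /X; ring.
congr _%:E; have c0 : c = 0 by lra.
have a0 : a = 2^-1 by lra.
have b0 : b = 2^-1 by lra.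
by rewrite c0 mulr0 addr0 a0 b0 -mulrDl ww mul1r.
Qed.

Let law_X w : `|w| = 1 ->
  (forall j, (\int[P]_t (X w t ^+ j.*2)%:E = ((j.*2)`!%:R / (4 ^+ j * j`!%:R))%:E)%E)
  /\ exists s : R, [/\ s != 0, s ^+ 2 = 2^-1 & forall A : set R, measurable A ->
        P (X w @^-1` A) = normal_prob 0 s A].
Proof.
move=> w1; have [s [ev law]] := X_centered w.
have s2 : s ^+ 2 = 2^-1.
  have := variance_X w1; rewrite -[2%N]/(1.*2) ev => /(congr1 fine) /= <-.
  by rewrite -[(1.*2)`!]/2%N -[1`!]/1%N; field.
have s0 : s != 0.
  by apply: contraTneq isT => s0; move: s2; rewrite s0 expr0n /= => /eqP;
    rewrite eq_sym invr_eq0 pnatr_eq0.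
split; last by exists s; split => //; exact: law.
move=> j; rewrite ev; congr _%:E.
have f0 : j`!%:R != 0 :> R by rewrite pnatr_eq0 -lt0n fact_gt0.
rewrite -mul2n exprM s2 (_ : 4 = 2 * 2 :> R); last by ring.
rewrite exprMn exprVn; field.
by rewrite f0 expf_neq0 ?pnatr_eq0.
Qed.

Let exprD_le (x y : R) N : 0 <= x -> 0 <= y ->
  (x + y) ^+ N <= 2 ^+ N * (x ^+ N + y ^+ N).
Proof.
wlog xy : x y / x <= y => [H x0 y0|x0 y0].
  case: (leP x y) => [/H|/ltW/H]; first exact.
  by rewrite (addrC y) (addrC (y ^+ N)); exact.
apply: (@le_trans _ _ ((2 * y) ^+ N)).
  by apply: lerXn2r; rewrite ?nnegrE ?addr_ge0 ?mulr_ge0 //; lra.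
by rewrite exprMn ler_wpM2l ?exprn_ge0 // lerDr exprn_ge0.
Qed.

(** With [N = a + b], domination by [|Z| ^ N <= 1 + |Z| ^ (2 N)] reduces to even moments of the real
    and imaginary parts. *)
Lemma gaussian_monomial_cintegrable a b :
  cintegrable P (fun t => Z t ^+ a * conjc (Z t) ^+ b).
Proof.
pose N := (a + b)%N.
have i1 := integrable_even 1 N; rewrite X1 in i1.
have i2 := integrable_even 'i%C N; rewrite Xi in i2.
apply: (@cintegrable_le _ (fun t => 1 + 2 ^+ N *
    (complex.Re (Z t) ^+ N.*2 + complex.Im (Z t) ^+ N.*2))).
- apply: cmeasurableM; apply: cmeasurableX => //.
  exact: cmeasurable_conj.
- have j0 : P.-integrable setT (EFin \o cst (1 : R)).
    exact: finite_measure_integrable_cst.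
  have := integrableD measurableT j0
    (integrableZl measurableT (2 ^+ N) (integrableD measurableT i1 i2)).
  by apply: eq_integrable => // t _.
move=> t; rewrite normrM !normrX normcJ -exprD -/N.
pose rho : R := complex.Re `|Z t|.
have rhoE : rho%:C = `|Z t| by rewrite RRe_real // normr_real.
have rho0 : 0 <= rho by rewrite -ler0c rhoE.
have rho2 : rho ^+ 2 = complex.Re (Z t) ^+ 2 + complex.Im (Z t) ^+ 2.
  by apply: (@complexI R); rewrite add_Re2_Im2 -rhoE rmorphXn.
rewrite -rhoE -rmorphXn lecR.
apply: (@le_trans _ _ (1 + (rho ^+ 2) ^+ N)).
  rewrite -exprM mulnC exprM; have := exprn_ge0 N rho0.
  by set u := rho ^+ N; have := sqr_ge0 (u - 1); nra.
rewrite lerD2l rho2 -mul2n !exprM.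
by apply: exprD_le; exact: sqr_ge0.
Qed.

(** Odd moments vanish because [X (- w) = - X w] has the law of [X w]: both are centered normal with
    variance 1/2. In the even ones [2 ^ N] cancels the power of 4 in [law_X]. *)
Let half_line_moment N w : `|w| = 1 ->
  Cexpect P (fun t => (2 * X w t)%:C ^+ N) =
  if odd N then 0 else (N`!%:R / (N./2)`!%:R)%:C.
Proof.
move=> w1; have [ev [s [s0 s2 law]]] := law_X w1.
have -> : (fun t => (2 * X w t)%:C ^+ N) = (fun t => ((2 * X w t) ^+ N)%:C).
  by apply/funext => t; rewrite rmorphXn.
have iN : P.-integrable setT (EFin \o (fun t => X w t ^+ N)).
  apply: (@le_integrable _ _ _ P setT measurableT _
    (EFin \o (fun t => 1 + X w t ^+ N.*2))).
  - by apply/measurable_EFinP; exact: measurable_funX.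
  - move=> t _; rewrite /= lee_fin [leRHS]ger0_norm; last first.
      rewrite -mul2n exprM; apply: addr_ge0 => //.
      by apply: exprn_ge0; exact: sqr_ge0.
    rewrite -muln2 exprM; set u := _ ^+ N.
    rewrite -(real_normK (num_real u)); have := sqr_ge0 (`|u| - 1).
    have := normr_ge0 u; nra.
  - have j0 : P.-integrable setT (EFin \o cst (1 : R)).
      exact: finite_measure_integrable_cst.
    by have := integrableD measurableT j0 (integrable_even w N); apply: eq_integrable.
apply: eq_complexP => /=; last first.
  by rewrite (expectation_cst P); case: ifP.
rewrite unlock.
have -> : (\int[P]_t ((2 * X w t) ^+ N)%:E =
    (2 ^+ N)%:E * \int[P]_t (X w t ^+ N)%:E)%E.
  by under eq_integral do rewrite exprMn EFinM; rewrite integralZl.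
case: ifPn => [oN|eN]; last first.
  have : N = (N./2).*2 by rewrite -[LHS]odd_double_half (negPf eN).
  move: (N./2) => h ->; rewrite ev /= -{1}mul2n exprM.
  rewrite (_ : 2 ^+ 2 = 4 :> R); last by ring.
  have f0 : h`!%:R != 0 :> R by rewrite pnatr_eq0 -lt0n fact_gt0.
  by field; rewrite f0 expf_neq0 ?pnatr_eq0.
have w1' : `|- w| = 1 by rewrite normrN.
have [_ [s' [s'0 s'2 law']]] := law_X w1'.
have XN t : X (- w) t = - X w t.
  by rewrite /X; case: (w) => u v /=; ring.
have mP (Y : T -> R) : measurable_fun setT Y -> measurable_fun setT (fun t => Y t ^+ N).
  exact: measurable_funX.
have := @eq_law_expectation _ _ _ P _ _ (mP _ (mX w)) (mP _ (mX (- w))).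
rewrite !unlock => eqE.
have {}eqE : (\int[P]_t (X w t ^+ N)%:E = \int[P]_t (X (- w) t ^+ N)%:E)%E.
  apply: eqE => B mB.
  have mB' : measurable ((fun x : R => x ^+ N) @^-1` B).
    rewrite -[X in measurable X]setTI.
    by apply: (measurable_funX N (@measurable_id _ R setT)).
  transitivity (normal_prob 0 s ((fun x : R => x ^+ N) @^-1` B)).
    exact: (law _ mB').
  rewrite (normal_prob_sqr _ _ s0 s'0) ?s2 ?s'2 //.
  exact: (esym (law' _ mB')).
have {}XN : (\int[P]_t (X (- w) t ^+ N)%:E = - \int[P]_t (X w t ^+ N)%:E)%E.
  rewrite -[RHS]mulN1e -(integralZl measurableT iN (-1)).
  by apply: eq_integral => t _; rewrite XN exprNn -signr_odd oN expr1 -EFinM.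
have := integrable_fin_num measurableT iN; move: eqE; rewrite XN /=.
case: (\int[P]_t (X w t ^+ N)%:E)%E => // u /(congr1 fine) /= uu _.
have -> : u = 0 by lra.
by rewrite mulr0.
Qed.

(* The law of [w^* Z + w Z^*] is the same for all [w] on the unit circle, so that
   its moments, which are Laurent polynomials in [w], are constant; their
   coefficients are the mixed moments. *)
Lemma gaussian_moment a b :
  Cexpect P (fun t => Z t ^+ a * conjc (Z t) ^+ b) = (a == b)%:R * (a`!)%:R.
Proof.
pose M i j := Cexpect P (fun t => Z t ^+ i * conjc (Z t) ^+ j).
rewrite -/(M a b); pose N := (a + b)%N.
pose c : R[i] := if odd N then 0 else (N`!%:R / (N./2)`!%:R)%:C.
(* Multiplication by [w ^ N] clears the negative powers: on the circle [w * (2 * X w)] equals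
   [Z + w ^ 2 * conjc Z]. *)
pose p : {poly R[i]} := \sum_(j < N.+1) ('C(N, j)%:R * M (N - j)%N j) *: 'X^(2 * j).
have pE : p = c *: 'X^N.
  apply/eqP; rewrite -subr_eq0; apply/eqP/poly_unit_circle_eq0 => w w1.
  rewrite hornerD hornerN hornerZ hornerXn; apply/eqP; rewrite subr_eq0.
  have ww : w * conjc w = 1 by rewrite -[conjc w]/(Num.conj w) -normCK w1 expr1n.
  have wE t : w ^+ N * (2 * X w t)%:C ^+ N =
      \sum_(j < N.+1) ('C(N, j)%:R * w ^+ (2 * j)) *
        (Z t ^+ (N - j) * conjc (Z t) ^+ j).
    rewrite -exprMn.
    have -> : w * (2 * X w t)%:C = Z t + w ^+ 2 * conjc (Z t).
      have -> : (2 * X w t)%:C = conjc w * Z t + w * conjc (Z t).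
        rewrite /X; case: (w) (Z t) => u v [x y].
        by apply: eq_complexP; rewrite /= ; ring.
      by rewrite mulrDr mulrA ww mul1r expr2 mulrA.
    rewrite exprDn; apply: eq_bigr => j _.
    by rewrite exprMn -exprM -mulr_natl; ring.
  have hl : _ = c := half_line_moment N w1; rewrite -hl mulrC -CexpectZ; last first.
    have -> : (fun t => (2 * X w t)%:C ^+ N) = (fun t => conjc w ^+ N *
        \sum_(j < N.+1) ('C(N, j)%:R * w ^+ (2 * j)) *
          (Z t ^+ (N - j) * conjc (Z t) ^+ j)).
      by apply: funext => t; rewrite -wE mulrA -exprMn [conjc w * w]mulrC ww expr1n mul1r.
    apply/cintegrableZ/cintegrable_sum => j _.
    by apply: cintegrableZ; exact: gaussian_monomial_cintegrable.
  apply/eqP; transitivity (Cexpect P (fun t => \sum_(j < N.+1)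
      ('C(N, j)%:R * w ^+ (2 * j)) * (Z t ^+ (N - j) * conjc (Z t) ^+ j))).
    rewrite Cexpect_sum => [|j _]; last first.
      by apply: cintegrableZ; exact: gaussian_monomial_cintegrable.
    rewrite /p horner_sum; apply: eq_bigr => j _.
    rewrite CexpectZ; last exact: gaussian_monomial_cintegrable.
    by rewrite hornerZ hornerXn /M mulrAC.
  by apply: eq_Cexpect => t; rewrite wE.
have bN : (b < N.+1)%N by rewrite ltnS leq_addl.
have := congr1 (fun r : {poly R[i]} => r`_(2 * b)) pE.
rewrite /p coef_sum (bigD1 (Ordinal bN)) //= big1 => [|j jb]; last first.
  rewrite coefZ coefXn eqn_mul2l /=; case: eqP => [bj|_]; last by rewrite mulr0.
  by case/eqP: jb; apply: val_inj.
rewrite addr0 !coefZ !coefXn eqxx mulr1 addnK.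
have C0 : 'C(N, b)%:R != 0 :> R[i] by rewrite pnatr_eq0 -lt0n bin_gt0 leq_addl.
have -> : (2 * b == N)%N = (a == b) by rewrite mul2n -addnn eqn_add2r eq_sym.
case: (eqVneq a b) => [ab|_] E; last first.
  by apply: (mulfI C0); rewrite E !(mul0r, mulr0).
apply: (mulfI C0); rewrite E mulr1 mul1r /c /N ab addnn odd_double doubleK.
have f0 : b`!%:R != 0 :> R by rewrite pnatr_eq0 -lt0n fact_gt0.
have bb : (b <= b.*2)%N by rewrite -addnn leq_addr.
rewrite -(bin_fact bb) -{2}addnn addnK mulnA natrM mulfK //.
by rewrite natrM rmorphM !rmorph_nat.
Qed.

End Standard.

End GaussianVariable.

(** * Comparison of the two sides *)

(** The labels [x] occupy at most [#|J|] of the [n] values, so at least [#|J|] values remain. *)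
Lemma exists_fresh_injection (J : finType) (n : nat) (x : J -> 'I_n) :
  (2 * #|J| <= n)%N ->
  exists s : J -> 'I_n, injective s /\ forall i j, x i != s j.
Proof.
move=> Jn; pose A := ~: [set x i | i in J].
have JA : (#|J| <= size (enum A))%N.
  have cA : (#|[set x i | i in J]| + #|A| = n)%N by rewrite cardsC card_ord.
  rewrite -cardE -(leq_add2l #|[set x i | i in J]|) cA (leq_trans _ Jn) //.
  by rewrite mul2n -addnn leq_add2r leq_imset_card.
exists (fun j => nth (x j) (enum A) (enum_rank j)).
have sz (j : J) : (enum_rank j < size (enum A))%N.
  exact: leq_trans (ltn_ord _) JA.
split=> [i j|i j].
  rewrite (set_nth_default (x i) _ (sz j)) => /eqP.
  by rewrite nth_uniq ?enum_uniq // => /eqP/ord_inj/enum_rank_inj.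
have : nth (x j) (enum A) (enum_rank j) \in A by rewrite -mem_enum mem_nth.
by rewrite inE; apply: contraNneq => <-; rewrite imset_f.
Qed.

Section MomentExpansion.
Context (d : measure_display) (T : measurableType d) (R : realType).
Variables (P : probability T R) (n : nat) (U : T -> 'M[R[i]]_n).
Hypothesis U_haar : haar_unitary P U.
Variable J : finType.

Local Notation moment := (moment P U).

(** A first expansion makes the row labels injective and introduces [sg]; [moment_swap] turns
    columns into rows, and a second expansion introduces [ta]. *)
Lemma moment_weingarten (s t x y x' y' : J -> 'I_n) :
  injective s -> injective t ->
  (forall i j, x i != s j) -> (forall i j, y' i != t j) ->
  moment [set: J]%SET x y x' y' =
  \sum_(sg : {perm J}) \sum_(ta : {perm J})
    [forall i, x' i == x (sg i)]%:R * [forall i, y' i == y (ta i)]%:R *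
    wein P U s (t \o (ta^-1)%g) [set: J]%SET (sg^-1 * ta)%g.
Proof.
move=> s_inj t_inj xs y't.
rewrite (moment_expand U_haar _ _ _ s_inj xs); apply: eq_bigr => sg _.
rewrite (moment_swap U_haar) (moment_expand U_haar _ _ _ t_inj y't) mulr_sumr.
(* After the swap [y] and [y'] have exchanged roles, so the compatible permutation appears
   inverted. *)
rewrite (reindex_inj invg_inj) /=; apply: eq_bigr => ta _; rewrite mulrA.
congr (_ * _%:R * _).
  congr (nat_of_bool _); apply/forallP/forallP => h i.
    by rewrite -{1}(permK ta i) -(eqP (h _)).
  by rewrite (eqP (h _)) permKV.
rewrite (moment_swap U_haar) /wein.
have pT : perm_on [set: J]%SET (sg^-1)%g by apply/fintype.subsetP.
rewrite -(moment_reindex_conj _ _ _ _ _ _ pT).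
congr (moment _ _ _ _ _); apply/funext => i /=; first by rewrite permKV.
by rewrite permM permK.
Qed.

Lemma moved_neq1 (p : {perm J}) : moved p != 1%N.
Proof.
apply/negP => /cards1P[i iE].
have pi : p i != i by have := set11 i; rewrite -iE inE.
have : p i \in [set i | p i != i] by rewrite inE (inj_eq perm_inj).
by rewrite iE inE (negPf pi).
Qed.

Lemma moved_quotient (sg ta : {perm J}) :
  moved (sg^-1 * ta)%g = #|[set i | sg i != ta i]|.
Proof.
rewrite /moved -[RHS](card_imset _ (@perm_inj _ sg)); apply: eq_card => j.
rewrite !inE permM -{2 3}(permKV sg j) eq_sym.
by rewrite (mem_imset _ _ (@perm_inj _ sg)) inE.
Qed.

Section NormBound.
Variable th : R.
Hypotheses (th_gt0 : 0 < th) (th2 : th ^+ 2 * n%:R = 9)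
  (q_n2 : 14 * #|J|%:R ^+ 2 <= n%:R ^+ 2 :> R)
  (q_n3 : 9 * #|J|%:R ^+ 2 * th <= 3 * n%:R :> R)
  (th_le1 : (1 < #|J|)%N -> th <= 1).

(** The factor 3/2 of the bound away from the identity is absorbed by [(4 / 3) ^ l], since
    [16 / 9 >= 3 / 2]; this uses [l >= 2]. *)
Lemma wein_bound_le_pow (l : nat) : l != 1%N ->
  wein_bound n #|J| th #|J| l <=
  (1 + 7 * #|J|%:R ^+ 2 / n%:R ^+ 2) * (4 / 3 * th) ^+ l.
Proof.
have C1 : 1 <= 1 + 7 * #|J|%:R ^+ 2 / n%:R ^+ 2 :> R.
  by rewrite lerDl divr_ge0 ?mulr_ge0 ?exprn_ge0 ?ler0n.
rewrite /wein_bound; case: l => [|[//|l]] _; first by rewrite eqxx expr0 mulr1.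
rewrite [l.+2 == 0]/=.
have f : 1 + #|J|%:R / (2 * #|J|%:R) <= 3 / 2 :> R := wein_bound_factor R (leqnn _).
have t0 : 0 <= th ^+ l.+2 by rewrite exprn_ge0 // ltW.
have e1 : 1 <= (4 / 3 : R) ^+ l by apply: exprn_ege1; lra.
have e2 : 3 / 2 <= (4 / 3 : R) ^+ l.+2 by rewrite 2!exprS; lra.
rewrite exprMn [leRHS]mulrA; move: t0 e2; set u := th ^+ _; set v := _ ^+ l.+2 => t0 e2.
apply: le_trans (ler_wpM2r t0 f) _; rewrite ler_wpM2r //; nra.
Qed.

Lemma moment_norm_le (x y x' y' : J -> 'I_n) : (2 * #|J| <= n)%N ->
  n%:R ^+ #|J| * complex.Re `|moment [set: J]%SET x y x' y'| <=
  (1 + 7 * #|J|%:R ^+ 2 / n%:R ^+ 2) *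
  \sum_(sg : {perm J} | [forall i, x' i == x (sg i)])
    \sum_(ta : {perm J} | [forall i, y' i == y (ta i)])
      (4 / 3 * th) ^+ #|[set i | sg i != ta i]|.
Proof.
move=> Jn; have [s [s_inj xs]] := exists_fresh_injection x Jn.
have [t [t_inj y't]] := exists_fresh_injection y' Jn.
pose F (sg ta : {perm J}) : R[i] :=
  [forall i, x' i == x (sg i)]%:R * [forall i, y' i == y (ta i)]%:R *
    wein P U s (t \o (ta^-1)%g) [set: J]%SET (sg^-1 * ta)%g.
have E : moment [set: J]%SET x y x' y' =
    \sum_(p : {perm J} * {perm J}) F p.1 p.2.
  by rewrite (moment_weingarten _ _ s_inj t_inj xs y't) pair_big.
rewrite pair_big_dep /= mulr_sumr.
rewrite (le_trans (ler_wpM2l _ (Re_norm_le E))) ?exprn_ge0 ?ler0n //.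
rewrite [leRHS]big_mkcond mulr_sumr; apply: ler_sum => -[sg ta] _ /=.
have z0 : n%:R ^+ #|J| * complex.Re `|0 : R[i]| = 0 :> R by rewrite normr0 mulr0.
rewrite /F; case: [forall i, x' i == _]; last by rewrite !mul0r z0.
case: [forall i, y' i == _]; last by rewrite mulr0 mul0r z0.
rewrite !mul1r -moved_quotient.
have pT : perm_on [set: J]%SET (sg^-1 * ta)%g by apply/fintype.subsetP.
have ti : injective (t \o (ta^-1)%g) by exact: inj_comp t_inj perm_inj.
rewrite -[in n%:R ^+ _]cardsT.
apply: le_trans (wein_le U_haar s_inj ti th_gt0 th2 q_n2 q_n3 th_le1 _ pT) _.
  by rewrite cardsT.
by rewrite cardsT wein_bound_le_pow ?moved_neq1.
Qed.

End NormBound.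

End MomentExpansion.

(** * Partial matchings and their Gaussian weights *)

Section PartialMatchings.
Variables (J L : finType).
Implicit Types (z : J -> L) (rho : {ffun J -> option J}) (S : {set J}).

Definition matched rho : {set J} := [set i | rho i != None].

Definition matched_to rho : {set J} := [set j | [exists i, rho i == Some j]].

(** [rho i = Some j] pairs the conjugated factor [i] with the plain factor [j]; the second clause is
    injectivity on the matched points. *)
Definition label_matching z z' rho : bool :=
  [forall i, forall j, (rho i == Some j) ==> (z' i == z j)] &&
  [forall i, forall i', (rho i == rho i') && (rho i != None) ==> (i == i')].

Lemma label_matchingP z z' rho :
  reflect ((forall i j, rho i = Some j -> z' i = z j) /\
           (forall i i' j, rho i = Some j -> rho i' = Some j -> i = i'))
          (label_matching z z' rho).
Proof.
apply: (iffP andP) => -[h1 h2]; split.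
- by move=> i j /eqP ij; apply/eqP; have /forallP/(_ j)/implyP := forallP h1 i; apply.
- move=> i i' j ij i'j; apply/eqP; have /forallP/(_ i')/implyP := forallP h2 i.
  by apply; rewrite ij i'j eqxx.
- by apply/forallP => i; apply/forallP => j; apply/implyP => /eqP /h1 ->.
- apply/forallP => i; apply/forallP => i'; apply/implyP => /andP[/eqP ii'].
  by case E: (rho i) => [j|] // _; apply/eqP/(h2 _ _ _ E); rewrite -ii'.
Qed.

Lemma card_matched_to z z' rho :
  label_matching z z' rho -> #|matched_to rho| = #|matched rho|.
Proof.
move=> /label_matchingP[_ inj_rho].
rewrite -(card_imset _ (@Some_inj _)) -[RHS](@card_in_imset _ _ rho); last first.
  move=> i i'; rewrite !inE; case E: (rho i) => [j|] // _ _ /esym E'.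
  exact: inj_rho E E'.
apply: eq_card => -[j|]; last first.
  by apply/imsetP/imsetP => [[j _] //|[j]]; rewrite inE => + N; rewrite -N.
rewrite (mem_imset _ _ (@Some_inj _)) inE.
apply/existsP/imsetP => [[i /eqP ij]|[i _ ij]]; exists i => //.
  by rewrite inE ij.
by rewrite ij.
Qed.

(* Number of the bijections of [S'] onto [S] that respect the labels; by Wick's
   formula, also a mixed moment of independent Gaussian variables. *)
Definition label_weight z z' S S' : nat :=
  \prod_(l : L) ((#|[set j in S | z j == l]| == #|[set i in S' | z' i == l]|) *
                 (#|[set j in S | z j == l]|)`!).

(** Removing a pair of equal labels lowers both counts at that label by one and so takes one factor
    off its factorial. *)
Lemma label_weight_rem z z' S S' i j : i \in S' -> j \in S -> z' i = z j ->
  label_weight z z' S S' =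
  (#|[set j' in S | z j' == z' i]| * label_weight z z' (S :\ j) (S' :\ i))%N.
Proof.
move=> iS' jS ij; rewrite /label_weight (bigD1 (z' i)) //= [in RHS](bigD1 (z' i)) //=.
have rem (z0 : J -> L) (A : {set J}) a l : a \in A ->
    #|[set b in A | z0 b == l]| = ((z0 a == l) + #|[set b in A :\ a | z0 b == l]|)%N.
  move=> aA; rewrite (cardsD1 a) inE aA /=; congr (_ + _)%N.
  by apply: eq_card => b; rewrite !inE andbA.
rewrite (rem z S j) // (rem z' S' i) // -ij eqxx !add1n eqSS factS.
set u := #|_|; set v := #|_|.
rewrite !mulnA [(_ * u.+1)%N]mulnC -!mulnA; congr (_ * (_ * (_ * _)))%N.
apply: eq_bigr => l li; rewrite (rem z S j l) // (rem z' S' i l) //.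
by rewrite -ij ![z' i == l]eq_sym (negPf li).
Qed.

Definition matchings z z' S S' : {set {ffun J -> option J}} :=
  [set rho | [&& label_matching z z' rho, matched rho == S' & matched_to rho == S]].

(** For [i] in [S'], the partner lies in [V], and erasing the pair is injective among matchings with
    a given partner; [label_weight_rem] is the matching recursion on the other side. *)
Lemma card_matchings_le z z' S S' :
  (#|matchings z z' S S'| <= label_weight z z' S S')%N.
Proof.
have [m] := ubnP #|S'|; elim: m S S' => // m IH S S' S'm.
have [S'0|[i iS']] := set_0Vmem S'.
  have [->|[r rM]] := set_0Vmem (matchings z z' S S'); first by rewrite cards0.
  have N0 rho : rho \in matchings z z' S S' -> rho = [ffun=> None].
    rewrite inE S'0 => /and3P[_ /eqP/setP m0 _]; apply/ffunP => i; rewrite ffunE.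
    by have := m0 i; rewrite !inE; case: (rho i).
  have S0 : S = finset.set0.
    move: (rM); rewrite inE => /and3P[_ _ /eqP <-]; apply/setP => j.
    by rewrite !inE (N0 _ rM); apply/existsP => -[i1]; rewrite ffunE.
  have -> : label_weight z z' S S' = 1%N.
    rewrite /label_weight S0 S'0 big1 // => l _.
    have e (z0 : J -> L) : [set b in finset.set0 | z0 b == l] = finset.set0.
      by apply/setP => b; rewrite !inE.
    by rewrite !e cards0.
  rewrite -(cards1 r) subset_leq_card //; apply/fintype.subsetP => rho /N0 ->.
  by rewrite inE (N0 _ rM).
pose V := [set j in S | z j == z' i].
have part : (#|matchings z z' S S'| <=
    \sum_(j in V) #|[set rho in matchings z z' S S' | rho i == Some j]|)%N.
  rewrite -sum1_card (partition_big (fun rho => odflt i (rho i)) (mem V)) /=.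
    apply: leq_sum => j _; rewrite -sum1_card; apply: eq_leq; apply: eq_bigl => rho.
    rewrite !inE; apply: andb_id2l => /and3P[_ /eqP mS' _].
    by move: iS'; rewrite -mS' inE; case: (rho i).
  move=> rho; rewrite !inE => /and3P[/label_matchingP[lab _] /eqP mS' /eqP mS].
  move: iS'; rewrite -mS' inE; case E: (rho i) => [j|] //= _.
  rewrite (lab _ _ E) eqxx andbT -mS inE; apply/existsP; exists i; exact/eqP.
apply: (leq_trans part).
have step j : j \in V ->
    (#|[set rho in matchings z z' S S' | rho i == Some j]| <=
     label_weight z z' (S :\ j) (S' :\ i))%N.
  rewrite inE => /andP[jS /eqP ij].
  have lt : (#|S' :\ i| < m)%N by move: S'm; rewrite (cardsD1 i) iS'.
  apply: leq_trans (IH _ _ lt).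
  pose f rho : {ffun J -> option J} := [ffun i' => if i' == i then None else rho i'].
  rewrite -(@card_in_imset _ _ f); last first.
    move=> r1 r2; rewrite !inE => /andP[_ /eqP e1] /andP[_ /eqP e2] /ffunP e.
    apply/ffunP => i'; have := e i'; rewrite !ffunE.
    by case: eqP => [->|]; rewrite ?e1.
  apply/subset_leq_card/fintype.subsetP => _ /imsetP[rho + ->].
  rewrite !inE => /andP[/and3P[/label_matchingP[lab inj] /eqP mS' /eqP mS] /eqP rij].
  apply/and3P; split.
  - apply/label_matchingP; split => [i1 j1|i1 i2 j1]; rewrite !ffunE.
      by case: eqP => // _; exact: lab.
    by do 2 case: eqP => // _; exact: inj.
  - apply/eqP/setP => i1; rewrite !inE ffunE -mS' inE.
    by case: (eqVneq i1 i).
  - apply/eqP/setP => j1; rewrite !inE -mS inE.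
    apply/existsP/andP => [[i1]|[j1j /existsP[i1 /eqP e1]]].
      rewrite ffunE; case: (eqVneq i1 i) => // ii1 /eqP e1; split.
        by apply: contraNneq ii1 => j1j; apply/eqP/(inj _ _ _ e1); rewrite j1j.
      by apply/existsP; exists i1; apply/eqP.
    exists i1; rewrite ffunE e1; case: (eqVneq i1 i) => // ii1.
    by case/eqP: j1j; move: e1; rewrite ii1 rij => -[].
have [V0|[j0 j0V]] := set_0Vmem V.
  by rewrite big1 // => j; rewrite V0 inE.
apply: (leq_trans (leq_sum _ step)).
(* The weight is the same for every partner in [V], as cancelling [#|V|] in [label_weight_rem]
   shows. *)
rewrite (eq_bigr (fun=> label_weight z z' (S :\ j0) (S' :\ i))) => [|j jV].
  rewrite sum_nat_const; move: j0V; rewrite inE => /andP[j0S /eqP ij0].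
  by rewrite (label_weight_rem iS' j0S (esym ij0)).
have Vpos : (0 < #|V|)%N by apply/card_gt0P; exists j0.
have e j' : j' \in V -> label_weight z z' S S' =
    (#|V| * label_weight z z' (S :\ j') (S' :\ i))%N.
  by rewrite inE => /andP[j'S /eqP ij']; exact: label_weight_rem.
by apply/eqP; rewrite -(eqn_pmul2l Vpos) -e // -e.
Qed.

(** Matchings are grouped by range [S] and domain [S']. These have equal size, so each [c ^ 2]
    splits into a factor [c] for an unmatched plain slot and one for an unmatched conjugated
    slot. *)
Lemma matchings_sum_le (R : realFieldType) (c : R) z z' : 0 <= c ->
  \sum_(rho | label_matching z z' rho) (c ^+ 2) ^+ #|~: matched rho| <=
  \sum_(S : {set J}) \sum_(S' : {set J})
    c ^+ #|~: S| * c ^+ #|~: S'| * (label_weight z z' S S')%:R.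
Proof.
move=> c0.
rewrite pair_big /= (partition_big (fun rho => (matched_to rho, matched rho)) predT) //=.
apply: ler_sum => -[S S'] _ /=.
rewrite (eq_bigr (fun=> c ^+ #|~: S| * c ^+ #|~: S'|)) => [|rho].
  rewrite sumr_const -[leLHS]mulr_natr ler_wpM2l ?mulr_ge0 ?exprn_ge0 // ler_nat.
  apply: leq_trans (card_matchings_le z z' S S'); apply: eq_leq; apply: eq_card => rho.
  by rewrite inE [LHS]unfold_in xpair_eqE [(_ == S) && _]andbC.
move=> /andP[lab /eqP[<- <-]].
have cC (A : {set J}) : #|~: A| = (#|J| - #|A|)%N by rewrite -(cardsC A) addKn.
by rewrite -exprM mulnC exprM !cC (card_matched_to lab) expr2.
Qed.

End PartialMatchings.

Section PermutationPairs.
Variables (R : realFieldType) (J A B : finType).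
Variables (x x' : J -> A) (y y' : J -> B) (eta : R).
Hypothesis eta_ge0 : 0 <= eta.
Implicit Types (rho : {ffun J -> option J}).

(* A pair of permutations is recovered from the partial injection on which they
   agree and from at most [#|J|^2] choices at each of the other points. *)
Definition agreement (p : {perm J} * {perm J}) : {ffun J -> option J} :=
  [ffun i => if p.1 i == p.2 i then Some (p.1 i) else None].

Lemma agreement_Some p i j :
  agreement p i = Some j <-> p.1 i = j /\ p.2 i = j.
Proof.
rewrite ffunE; case: eqP => [<-|ne]; split.
- by case=> <-.
- by case=> ->.
- by [].
- by case=> e1 e2; case: ne; rewrite e1 e2.
Qed.

Lemma unmatched_agreement p :
  ~: matched (agreement p) = [set i | p.1 i != p.2 i].
Proof.
by apply/setP => i; rewrite !inE ffunE; case: (p.1 i == p.2 i).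
Qed.

Lemma card_agreement_fiber_le rho :
  (#|[set p | agreement p == rho]| <= (#|J| ^ 2) ^ #|~: matched rho|)%N.
Proof.
pose Q i (k : J * J) := if rho i is Some j then k == (j, j) else true.
pose f (p : {perm J} * {perm J}) : {ffun J -> J * J} := [ffun i => (p.1 i, p.2 i)].
have f_inj : injective f.
  move=> [p1 p2] [q1 q2] /ffunP e.
  by congr (_, _); apply/permP => i; have := e i; rewrite !ffunE => -[].
rewrite -(card_imset _ f_inj).
apply: (@leq_trans #|[pred g in family Q]|).
  apply/subset_leq_card/fintype.subsetP => _ /imsetP[p + ->].
  rewrite inE => /eqP pr; rewrite inE; apply/familyP => i.
  rewrite unfold_in /Q ffunE -pr; case E: (agreement p i) => [j|] //.
  by have [-> ->] := (agreement_Some p i j).1 E.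
have -> : #|[pred g in family Q]| = \sum_(g in family Q) \prod_(i : J) 1.
  by rewrite -sum1_card; apply: eq_big => [g|g _]; rewrite ?inE // big1.
rewrite -(bigA_distr_big_dep _ (fun i k => 1)) /=.
rewrite -prod_nat_const [leqRHS]big_mkcond /=; apply: leq_prod => i _.
rewrite inE inE negbK /Q; case: (rho i) => [j|] /=; first by rewrite big_pred1_eq.
by rewrite sum1_card card_prod expnS expn1.
Qed.

Lemma permutation_pairs_sum_le :
  \sum_(sg : {perm J} | [forall i, x' i == x (sg i)])
    \sum_(ta : {perm J} | [forall i, y' i == y (ta i)])
      eta ^+ #|[set i | sg i != ta i]| <=
  \sum_(rho | label_matching (fun i => (x i, y i)) (fun i => (x' i, y' i)) rho)
    (#|J|%:R ^+ 2 * eta) ^+ #|~: matched rho|.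
Proof.
rewrite pair_big_dep /= (partition_big agreement
  (label_matching (fun i => (x i, y i)) (fun i => (x' i, y' i)))) /=; last first.
  move=> p /andP[/forallP hx /forallP hy]; apply/label_matchingP; split.
    move=> i j /agreement_Some[p1 p2].
    by rewrite (eqP (hx i)) (eqP (hy i)) p1 p2.
  move=> i i' j /agreement_Some[pi _] /agreement_Some[pi' _].
  by apply: (@perm_inj _ p.1); rewrite pi pi'.
apply: ler_sum => rho _.
rewrite (eq_bigr (fun=> eta ^+ #|~: matched rho|)) => [|p /andP[_ /eqP <-]]; last first.
  by rewrite unmatched_agreement.
rewrite sumr_const -[leLHS]mulr_natl exprMn ler_wpM2r ?exprn_ge0 //.
rewrite -!natrX ler_nat; apply: leq_trans (card_agreement_fiber_le rho).
by apply/subset_leq_card/fintype.subsetP => p; rewrite inE unfold_in => /andP[].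
Qed.

End PermutationPairs.

Lemma prod_add_const (K : comNzRingType) (J : finType) (F : J -> K) (c : K) :
  \prod_j (F j + c) = \sum_(S : {set J}) c ^+ #|~: S| * \prod_(j in S) F j.
Proof.
rewrite bigA_distr; apply: eq_bigr => S _.
rewrite mulrC -prodr_const (bigID (mem S)) /=; congr (_ * _).
  by apply: eq_bigr => j ->.
by apply: eq_big => [j|j /negPf ->]; rewrite ?inE.
Qed.

Lemma prod_by_label (K : comNzRingType) (J L : finType) (F : L -> K) (z : J -> L)
    (S : {set J}) :
  \prod_(j in S) F (z j) = \prod_(l : L) F l ^+ #|[set j in S | z j == l]|%SET.
Proof.
rewrite (partition_big z predT) //=; apply: eq_bigr => l _.
rewrite -prodr_const; apply: eq_big => [j|j /andP[_ /eqP ->]] //.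
by rewrite inE.
Qed.

Section GaussianProducts.
Context (d : measure_display) (T : measurableType d) (R : realType).
Variables (P : probability T R) (L : finType) (G : L -> T -> R[i]).
Hypothesis G_gauss : forall l, std_complex_gaussian P (G l).
Hypothesis G_indep : independent_family P (G : L -> T -> Cplx R).
Variables (J : finType) (z z' : J -> L).
Implicit Types S : {set J}.

(** Grouped by label, the product is one of functions of the independent variables [G l]; the mixed
    moment of each is one factor of [label_weight]. *)
Lemma gaussian_product_moment S S' :
  let f t := \prod_(j in S) G (z j) t * \prod_(i in S') conjc (G (z' i) t) in
  cintegrable P f /\ Cexpect P f = (label_weight z z' S S')%:R.
Proof.
move=> f.
pose h (l : L) (w : g_sigma_algebraType (@open (Cplx R))) : R[i] :=
  (w : R[i]) ^+ #|[set j in S | z j == l]|%SET *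
  conjc (w : R[i]) ^+ #|[set i in S' | z' i == l]|%SET.
have fE : f = fun t => \prod_l h l (G l t).
  apply: funext => t; rewrite /f (prod_by_label (fun l => G l t)).
  by rewrite (prod_by_label (fun l => conjc (G l t))) -big_split.
have mid : cmeasurable (fun w : g_sigma_algebraType (@open (Cplx R)) => w : R[i]).
  split; apply: continuous_borel_measurable.
    exact: continuous_Re.
  exact: continuous_Im.
have mG l : random_element (G l : T -> Cplx R) by have [[]] := G_gauss l.
have mh l : cmeasurable (h l).
  apply: cmeasurableM; apply: cmeasurableX => //.
  exact: cmeasurable_conj.
have ih l : cintegrable P (fun t => h l (G l t)).
  exact: gaussian_monomial_cintegrable (G_gauss l) _ _.
rewrite fE; have [ip ->] := independent_Cexpect_prod mG G_indep mh ih.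
split=> //; rewrite /label_weight natr_prod; apply: eq_bigr => l _.
by rewrite /h (gaussian_moment (G_gauss l)) natrM.
Qed.

Lemma gaussian_shifted_moment (c : R) :
  Cexpect P (fun t => \prod_j (G (z j) t + c%:C) *
                      \prod_i (conjc (G (z' i) t) + c%:C)) =
  (\sum_(S : {set J}) \sum_(S' : {set J})
     c ^+ #|~: S| * c ^+ #|~: S'| * (label_weight z z' S S')%:R)%:C.
Proof.
pose f S S' t := \prod_(j in S) G (z j) t * \prod_(i in S') conjc (G (z' i) t).
transitivity (Cexpect P (fun t => \sum_(S : {set J}) \sum_(S' : {set J})
    (c ^+ #|~: S| * c ^+ #|~: S'|)%:C * f S S' t)).
  apply: eq_Cexpect => t; rewrite !prod_add_const mulr_suml.
  apply: eq_bigr => S _; rewrite mulr_sumr; apply: eq_bigr => S' _.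
  by rewrite rmorphM !rmorphXn mulrACA.
have int S S' : cintegrable P (fun t => (c ^+ #|~: S| * c ^+ #|~: S'|)%:C * f S S' t).
  by apply: cintegrableZ; case: (gaussian_product_moment S S').
rewrite Cexpect_sum => [|S _]; last by apply: cintegrable_sum => S' _.
rewrite rmorph_sum; apply: eq_bigr => S _.
rewrite Cexpect_sum => [|S' _] //; rewrite rmorph_sum; apply: eq_bigr => S' _.
have [if' fE] := gaussian_product_moment S S'.
by rewrite CexpectZ // fE [RHS]rmorphM rmorph_nat.
Qed.

End GaussianProducts.

(** The plain and the conjugated positions are enumerated by the same index type. An arbitrary
    commutative law is allowed because products of variables and sums counting labels are both split
    this way. *)
Lemma balanced_slots (k : nat) (eps : 'I_k -> bool) : balanced eps ->
  exists al be : 'I_k./2 -> 'I_k,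
    forall (A : Type) (e : A) (op : Monoid.com_law e) (F : bool -> 'I_k -> A),
    \big[op/e]_i F (eps i) i =
    op (\big[op/e]_j F false (al j)) (\big[op/e]_j F true (be j)).
Proof.
move=> bal; have kE : (#|[pred i | ~~ eps i]| + #|[pred i | eps i]| = k)%N.
  by rewrite addnC -[RHS](card_ord k) -(cardC [pred i | eps i]); congr (_ + _)%N.
have k0 : k./2 = #|[pred i | ~~ eps i]| by rewrite -{1}kE -bal addnn doubleK.
have k1 : k./2 = #|[pred i | eps i]| by rewrite k0.
exists (fun j => enum_val (cast_ord k0 j)), (fun j => enum_val (cast_ord k1 j)).
move=> A e op F.
have reidx (Q : pred 'I_k) (kQ : k./2 = #|Q|) (H : 'I_k -> A) :
    \big[op/e]_(i | Q i) H i = \big[op/e]_j H (enum_val (cast_ord kQ j)).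
  rewrite (big_enum_val H) (reindex (cast_ord kQ)) //=.
  by exists (cast_ord (esym kQ)) => i _; rewrite ?cast_ordK ?cast_ordKV.
rewrite (bigID (fun i => ~~ eps i)) /=; congr (op _ _).
  rewrite (eq_bigr (F false)) => [|i /negPf -> //].
  exact: (reidx [pred i | ~~ eps i]).
rewrite (eq_big (fun i => eps i) (F true)) => [|i|i]; rewrite ?negbK // => -> //.
Qed.

Section Numerics.
Variables n q : nat.
(* [2 * k ^ (7 / 2) <= n ^ 2], squared, with [k = 2 * q]. *)
Hypothesis qn : (512 * q ^ 7 <= n ^ 4)%N.

Lemma numeric_double : (2 * q <= n)%N.
Proof.
rewrite -(@leq_exp2r _ _ 4) // (leq_trans _ qn) // expnMn.
case: (posnP q) => [->//|q0].
by rewrite leq_mul // leq_pexp2l.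
Qed.

Lemma numeric_sqr : (14 * q ^ 2 <= n ^ 2)%N.
Proof.
rewrite -(@leq_exp2r _ _ 2) // -expnM (leq_trans _ qn) // expnMn -expnM.
case: (posnP q) => [->//|q0].
by rewrite leq_mul // leq_pexp2l.
Qed.

(** In fourth powers, [81 ^ 4 * q ^ 16 <= 512 ^ 3 * q ^ 21 <= n ^ 12]. *)
Lemma numeric_cube : (81 * q ^ 4 <= n ^ 3)%N.
Proof.
rewrite -(@leq_exp2r _ _ 4) // -expnM [(3 * 4)%N]mulnC expnM.
have := qn; rewrite -(@leq_exp2r _ _ 3) //; apply: leq_trans.
rewrite (expnMn 81) (expnMn 512) -!expnM.
have hq : (q ^ (4 * 4) <= q ^ (7 * 3))%N.
  by case: (posnP q) => [->|q0]; [rewrite !exp0n | rewrite leq_pexp2l].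
apply: leq_mul hq.
(* [81 ^ 4 = 243 ^ 3 * 3] and [512 ^ 3 = 256 ^ 3 * 8], so these unary numbers are compared without
   being evaluated. *)
have h : (243 ^ 3 <= 256 ^ 3)%N by rewrite leq_exp2r.
rewrite (_ : 81 ^ 4 = 243 ^ 3 * 3)%N; last first.
  by rewrite -[81%N]/(3 ^ 4)%N -[243%N]/(3 ^ 5)%N -!expnM -expnSr.
rewrite (_ : 512 ^ 3 = 256 ^ 3 * 8)%N; last first.
  by rewrite -[512%N]/(2 ^ 9)%N -[256%N]/(2 ^ 8)%N -[8%N]/(2 ^ 3)%N -!expnM -expnD.
exact: leq_mul h (isT : 3 <= 8)%N.
Qed.

Lemma numeric_large : (1 < q)%N -> (9 <= n)%N.
Proof.
move=> q1; rewrite leqNgt; apply/negP => n9.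
have h : (n ^ 4 <= 8 ^ 4)%N by rewrite leq_exp2r.
have h2 : (2 ^ 7 <= q ^ 7)%N by rewrite leq_exp2r.
by have := qn; lia.
Qed.

End Numerics.

Section Comparison.
Context (d : measure_display) (T : measurableType d) (R : realType).
Variables (P : probability T R) (n q : nat).
Variables (U : T -> 'M[R[i]]_n) (G : 'I_n -> 'I_n -> T -> R[i]).
Hypothesis U_haar : haar_unitary P U.
Hypothesis G_gauss : forall i j, std_complex_gaussian P (G i j).
Hypothesis G_indep : independent_family P (fun ij : 'I_n * 'I_n => G ij.1 ij.2).

Lemma moment_le_gaussian (J : finType) (x y x' y' : J -> 'I_n) (K c : R) :
  #|J| = q -> (4 <= n)%N -> 0 <= K -> K ^+ 2 = (2 * q%:R) ^+ 7 ->
  2 * K <= n%:R ^+ 2 -> c = 2 * q%:R * n%:R `^ (- (1 / 4)) ->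
  n%:R ^+ q * `|moment P U [set: J]%SET x y x' y'| <=
  (1 + 3 * K * n%:R ^- 2)%:C *
  Cexpect P (fun t => \prod_j (G (x j) (y j) t + c%:C) *
                      \prod_j (conjc (G (x' j) (y' j) t) + c%:C)).
Proof.
move=> Jq n4 K0 K2 Kn cE.
(* [K] stands for the real power k^(7/2); squaring leaves integers, with
   [4 * (2 * q) ^ 7 = 512 * q ^ 7]. *)
have qn : (512 * q ^ 7 <= n ^ 4)%N.
  rewrite -(ler_nat R) natrM !natrX.
  have : (2 * K) ^+ 2 <= (n%:R ^+ 2) ^+ 2 by rewrite lerXn2r ?nnegrE ?mulr_ge0 ?exprn_ge0.
  have -> : (2 * K) ^+ 2 = 512 * q%:R ^+ 7 by rewrite exprMn K2; ring.
  by rewrite -exprM.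
have n0 : 0 < n%:R :> R by rewrite ltr0n (leq_trans _ n4).
pose r : R := n%:R `^ (- (1 / 4)).
have r0 : 0 < r by exact: powR_gt0.
have r4 : r ^+ 4 * n%:R = 1.
  rewrite -powR_mulrn ?ltW // -powRrM -[X in _ * X]powRr1 ?ltW // -powRD.
    by rewrite (_ : _ + 1 = 0) ?powRr0 //; field.
  by apply/implyP => _; rewrite gt_eqF.
pose th := 3 * r ^+ 2.
have th0 : 0 < th by rewrite mulr_gt0 ?exprn_gt0.
have th2 : th ^+ 2 * n%:R = 9.
  transitivity (9 * (r ^+ 4 * n%:R)); first by rewrite /th; ring.
  by rewrite r4 mulr1.
have q1 : 14 * #|J|%:R ^+ 2 <= n%:R ^+ 2 :> R.
  by rewrite Jq -!natrX -natrM ler_nat numeric_sqr.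
have q2 : 9 * #|J|%:R ^+ 2 * th <= 3 * n%:R :> R.
  suff : 9 * q%:R ^+ 2 * r ^+ 2 <= n%:R by rewrite Jq /th; lra.
  have r_ge0 := ltW r0.
  rewrite -(@ler_pXn2r _ 2) ?nnegrE ?mulr_ge0 ?exprn_ge0 ?ler0n //.
  rewrite -(ler_pM2r n0).
  rewrite (_ : _ * n%:R = 81 * q%:R ^+ 4 * (r ^+ 4 * n%:R)); last by ring.
  rewrite r4 mulr1 -exprSr -!natrX -natrM ler_nat.
  exact: numeric_cube.
have q3 : (1 < #|J|)%N -> th <= 1.
  rewrite Jq => /(numeric_large qn) n9.
  rewrite -(@ler_pXn2r _ 2) ?nnegrE ?(ltW th0) // expr1n -(ler_pM2r n0) th2 mul1r.
  by rewrite (ler_nat _ 9).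
have Jn : (2 * #|J| <= n)%N by rewrite Jq numeric_double.
have c0 : 0 <= c by rewrite cE !mulr_ge0 // ltW.
have := moment_norm_le U_haar th0 th2 q1 q2 q3 x y x' y' Jn.
have eta0 : 0 <= 4 / 3 * th by rewrite mulr_ge0 // ltW.
have := permutation_pairs_sum_le x x' y y' eta0.
(* Both sides are [4 * q ^ 2 * r ^ 2]: the shift [k * n ^ (-1/4)] is exactly what the choices at an
   unmatched point cost. *)
have -> : #|J|%:R ^+ 2 * (4 / 3 * th) = c ^+ 2.
  by rewrite Jq cE /th -/r; field.
have := matchings_sum_le (fun i => (x i, y i)) (fun i => (x' i, y' i)) c0.
set W := \sum_S _; set M := \sum_(rho | _) _; set E := \sum_(sg | _) _.
move=> MW EM mE.
have E0 : 0 <= E by rewrite /E; do 2 (apply: sumr_ge0 => ? _); rewrite exprn_ge0.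
have -> : Cexpect P (fun t => \prod_j (G (x j) (y j) t + c%:C) *
    \prod_j (conjc (G (x' j) (y' j) t) + c%:C)) = W%:C.
  exact: (gaussian_shifted_moment (fun l => G_gauss l.1 l.2) G_indep
    (fun i => (x i, y i)) (fun i => (x' i, y' i)) c).
rewrite -rmorphM /=.
set m := moment P U _ _ _ _ _ in mE *.
have mR : `|m| = (complex.Re `|m|)%:C by rewrite RRe_real ?normr_real.
have -> : n%:R ^+ q * `|m| = (n%:R ^+ q * complex.Re `|m|)%:C.
  by rewrite [in LHS]mR [RHS]rmorphM rmorphXn rmorph_nat.
rewrite lecR -{1}Jq; apply: (le_trans mE).
apply: ler_pM => //; last exact: le_trans EM MW.
rewrite lerD2l ler_wpM2r ?invr_ge0 ?exprn_ge0 // Jq.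
(* It remains that [7 * q ^ 2 <= 3 * K]; squared, [49 * q ^ 4 <= 1152 * q ^ 7]. *)
rewrite -(@ler_pXn2r _ 2) ?nnegrE ?mulr_ge0 ?exprn_ge0 //.
have -> : (7 * q%:R ^+ 2) ^+ 2 = (49 * q ^ 4)%:R :> R by rewrite natrM natrX; ring.
have -> : (3 * K) ^+ 2 = (1152 * q ^ 7)%:R.
  by rewrite exprMn K2 natrM natrX; ring.
rewrite ler_nat; case: (posnP q) => [->|q_gt0]; first by rewrite !exp0n.
by rewrite leq_mul ?leq_pexp2l.
Qed.

Lemma moment_eq0_odd (J : finType) (x y x' y' : J -> 'I_n) (u : 'I_n) :
  (#|[pred j | x j == u]| != #|[pred j | x' j == u]|) ||
  (#|[pred j | y j == u]| != #|[pred j | y' j == u]|) ->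
  moment P U [set: J]%SET x y x' y' = 0.
Proof.
have E (z : J -> 'I_n) : #|[pred j | z j == u]| = #|[set j in [set: J] | z j == u]|%SET.
  by apply: eq_card => j; rewrite !inE.
rewrite !E => /orP[h|h].
  exact: (moment_weight U_haar _ _ h).
by rewrite (moment_swap U_haar); apply: (moment_weight U_haar (u := u)); rewrite eq_sym.
Qed.

End Comparison.

Theorem theorem11 (R : realType) (d : measure_display) (T : measurableType d)
    (P : probability T R) (n k : nat)
    (U : T -> 'M[R[i]]_n) (G : 'I_n -> 'I_n -> T -> R[i])
    (x y : 'I_k -> 'I_n) (eps : 'I_k -> bool)
    (k_even : ~~ odd k)
    (eps_balanced : balanced eps)
    (U_haar : haar_unitary P U)
    (G_gauss : forall i j, std_complex_gaussian P (G i j))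
    (G_indep : independent_family P
       (fun ij : 'I_n * 'I_n => G ij.1 ij.2)) :
  ((4 <= n)%N ->
   2 * (k%:R : R) `^ (7 / 2) <= (n%:R : R) ^+ 2 ->
   n%:R ^+ k./2
     * `| Cexpect P (fun t => \prod_(i < k) conj_pow (eps i) (U t (x i) (y i))) |
   <= (1 + 3 * (k%:R : R) `^ (7 / 2) * (n%:R : R) ^- 2)%:C
     * Cexpect P (fun t => \prod_(i < k)
         (conj_pow (eps i) (G (x i) (y i) t)
          + (k%:R * (n%:R : R) `^ (- (1 / 4)))%:C)))
  /\
  (~ even_sequence x y ->
   Cexpect P (fun t => \prod_(i < k) conj_pow (eps i) (U t (x i) (y i))) = 0).
Proof.
have [al [be slots]] := balanced_slots eps_balanced.
have UE : Cexpect P (fun t => \prod_(i < k) conj_pow (eps i) (U t (x i) (y i))) =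
    moment P U [set: 'I_k./2]%SET (x \o al) (y \o al) (x \o be) (y \o be).
  apply: eq_Cexpect => t.
  rewrite (slots _ _ _ (fun b i => conj_pow b (U t (x i) (y i)))) /monomial.
  by congr (_ * _); apply: eq_bigl => j; rewrite inE.
rewrite UE; split=> [n4 kn|odd_xy].
  set c := k%:R * _.
  have -> : Cexpect P (fun t => \prod_(i < k)
      (conj_pow (eps i) (G (x i) (y i) t) + c%:C)) =
    Cexpect P (fun t => \prod_j (G (x (al j)) (y (al j)) t + c%:C) *
      \prod_j (conjc (G (x (be j)) (y (be j)) t) + c%:C)).
    apply: eq_Cexpect => t.
    exact: (slots _ _ _ (fun b i => conj_pow b (G (x i) (y i) t) + c%:C)).
  have kE : k%:R = 2 * (k./2)%:R :> R.
    by rewrite -{1}[k]odd_double_half (negPf k_even) add0n -mul2n natrM.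
  apply: (moment_le_gaussian U_haar G_gauss G_indep) => //.
  - by rewrite card_ord.
  - rewrite -kE -!powR_mulrn ?powR_ge0 // -powRrM; congr (_ `^ _); by field.
  - by rewrite -kE.
have [u /orP odd_u] : exists u, odd #|[pred i | x i == u]| || odd #|[pred i | y i == u]|.
  apply/existsP; apply: contra_notT odd_xy => /existsPn h u.
  by have := h u; rewrite negb_or => /andP.
apply: (@moment_eq0_odd _ _ _ _ _ _ U_haar _ _ _ _ _ u).
have cardE (z : 'I_k -> 'I_n) : #|[pred i | z i == u]| =
    (#|[pred j | (z \o al) j == u]| + #|[pred j | (z \o be) j == u]|)%N.
  have S (I : finType) (Q : pred I) : #|[pred i | Q i]| = (\sum_i (Q i : nat))%N.
    by rewrite -sum1_card big_mkcond.
  by rewrite !S; exact: (slots _ _ _ (fun _ i => nat_of_bool (z i == u))).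
(* An odd number of occurrences cannot split equally between plain and conjugated factors. *)
have odd_ne z : odd #|[pred i | z i == u]| ->
    #|[pred j | (z \o al) j == u]| != #|[pred j | (z \o be) j == u]|.
  by rewrite cardE; apply: contraTneq => ->; rewrite addnn odd_double.
by case: odd_u => /odd_ne ->; rewrite ?orbT.
Qed.
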